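(* Let $\epsilon\in(0,1)$, let $l=|S_0|=|S_1|$ be the length of the strings, and let $\alpha_1:=\sqrt{\frac{\ln\epsilon^{-1}}{2n}}$, where $n$ is the number of quantum communication rounds of Protocol OT (described in the context) in which the measurement station has clicked. Let $D$ be such that dishonest Bob's quantum memory $Q$ satisfies $\log\dim(Q)\le D$, let ${\rm leak}_O=|O|$ be the size in bits of the error correction information sent by Alice, and let $$\lambda=\tfrac12-2\delta',\qquad \delta'=\Big(2-\log\sqrt{(32\ln\epsilon^{-1})/n}\Big)\sqrt{(32\ln\epsilon^{-1})/n}.$$ If $\lambda-{\rm leak}_O/n-2\alpha_1>0$ and $$n\ \ge\ 2\,\frac{l+D+1-2\log\!\big(1-\sqrt{1-\epsilon^2}\big)}{\lambda-{\rm leak}_O/n-2\alpha_1},$$ then Protocol OT (in which honest parties have perfect single photon sources) implements a Randomized 1-out-2 $(l,8\epsilon)$-Oblivious String Transfer.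
   Context: Logarithms $\log$ are base 2; $\approx_\epsilon$ means $\epsilon$-close in trace distance; $\tau_R$ is the maximally mixed state on register $R$. Protocol OT. Write $|0\rangle_0=|0\rangle,|1\rangle_0=|1\rangle,|0\rangle_1=|+\rangle,|1\rangle_1=|-\rangle$. Preparation phase: in each round Alice picks $X_i,\Theta_i\in\{0,1\}$ uniformly at random and sends the single-qubit state $|X_i\rangle_{\Theta_i}$ to a measurement station; Bob picks $\hat X_i,\hat\Theta_i\in\{0,1\}$ uniformly and sends $|\hat X_i\rangle_{\hat\Theta_i}$ to the station. The (honest) station performs a possibly probabilistic Bell measurement (some measurement operators are projections on orthogonal maximally entangled two-qubit states; all other outcomes, and detected losses, count as ''failure'') and publicly announces the outcome or failure; depending on the outcome Bob flips his bit or not, so that without noise $X_i=\hat X_i$ whenever $\Theta_i=\hat\Theta_i$. Failure rounds are discarded and $n$ rounds remain. Both wait a time $\Delta t$. Alice sends $\Theta_1^n$ to Bob, who computes $\mathcal I=\{i\in[n]:\Theta_i=\hat\Theta_i\}$ and keeps only $\hat X_{\mathcal I}$. Honest noise is i.i.d. across rounds. Post-processing: (1) Let $m:=(1/2-\alpha_1)n$. If $|\mathcal I|\ge m$ Bob randomly truncates $\mathcal I$ to size $m$; otherwise he aborts. (2) Bob picks a random subset $\mathcal I_{\rm Bad}\subseteq\mathcal I^c$ of size $m$ and a uniformly random bit $C$, renames $(\mathcal I,\mathcal I_{\rm Bad})$ into $(I_C,I_{1-C})$ and sends $(I_0,I_1)$ to Alice. (3) Alice sends Bob error correction information $O$, of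 predetermined size ${\rm leak}_O$, for $X_{I_0}$ and $X_{I_1}$. (4) Bob uses $O$ to correct $\hat X_{\mathcal I}$. (5) Alice picks independent uniformly random 2-universal hash functions $r_0,r_1$ with $l$-bit outputs and sends them to Bob. (6) Alice outputs $(S_0,S_1)=(r_0(X_{I_0}),r_1(X_{I_1}))$ and Bob outputs $(\hat S_C,C)$ with $\hat S_C=r_C$ applied to his corrected string. The size ${\rm leak}_O$ is fixed in advance so that for honest parties the error correction aborts with probability at most $\epsilon$ and otherwise fails with probability at most $\epsilon$. An aborting honest party continues as if not aborting until the end; then honest parties output uniformly random values. Adversary model: the dishonest party fully controls the measurement station and is otherwise arbitrary, except that dishonest Bob's quantum memory $Q$ surviving the waiting time satisfies $\log\dim Q\le D$. Honest parties' sources are trusted and emit perfect single photons. Randomized 1-out-2 $(l,\epsilon)$-Oblivious String Transfer: a protocol satisfying (Correctness) if both are honest there is an ideal state $\sigma_{S_0S_1CS_C}$, $S_0,S_1\in\{0,1\}^l$, $C\in\{0,1\}$, with $\sigma_{S_0S_1C}=\tau_{S_0}\otimes\tau_{S_1}\otimes\tau_C$ and $\rho_{S_0S_1C\hat S_C}\approx_\epsilon\sigma_{S_0S_1CS_C}$; (Security for Bob) if Bob is honest there is an ideal state $\sigma_{AS_0S_1C}=\sigma_{AS_0S_1}\otimes\tau_C$ with $\rho_{AC\hat S_C}\approx_\epsilon\sigma_{ACS_C}$; (Security for Alice) if Alice is honest there is an ideal state $\sigma_{S_0S_1BC}=\sigma_{S_CBC}\otimes\tau_{S_{1-C}}$,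 $C$ binary, with $\rho_{S_0S_1B}\approx_\epsilon\sigma_{S_0S_1B}$. Here $\rho$ is the real state produced by the protocol and $A$ (resp. $B$) is all information of a dishonest Alice (resp. Bob).
   Formalization: After an abort Bob's output string becomes uniform, but his bit C stays the uniformly random bit chosen in step (2), and the abort is not revealed to a dishonest Alice; redrawing C or announcing the abort would let her bias or learn C by spoiling the error correction of one string. *)

(* Defs.v *)
From HB Require Import structures.
From mathcomp Require Import all_boot all_order all_algebra.
From mathcomp Require Import all_reals exp.
From mathcomp.real_closed Require Import complex.
From mathcomp.real_closed Require mxtens.

Set Implicit Arguments.
Unset Strict Implicit.
Unset Printing Implicit Defensive.

Import Order.TTheory GRing.Theory Num.Theory.
Local Open Scope ring_scope.
Local Open Scope complex_scope.
Local Open Scope sesquilinear_scope.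

Definition log2 (R : realType) (x : R) : R := ln x / ln 2.

Section Quantum.
Variable R : realType.
Local Notation C := R[i].

Definition psd d (A : 'M[C]_d) : Prop :=
  forall v : 'cV[C]_d, 0 <= (v^t* *m A *m v) 0 0.

(* tr sqrt (A^dagger A): the sum of the singular values. *)
Definition tracenorm d (A : 'M[C]_d) : C :=
  \sum_i sqrtC (spectral_diag (A^t* *m A) 0 i).

(* An operator on a classical register T and a quantum register of dimension d,
   block-diagonal in T; block t carries the (unnormalised) conditional state.
   Purely classical laws are the case d = 1. *)
Definition cq (T : finType) (d : nat) := T -> 'M[C]_d.

Definition is_state (T : finType) d (rho : cq T d) : Prop :=
  (forall t, psd (rho t)) /\ \sum_t \tr (rho t) = 1.

Definition trdist (T : finType) d (rho sigma : cq T d) : C :=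
  2^-1 * \sum_t tracenorm (rho t - sigma t).

Definition pure d (v : 'cV[C]_d) : 'M[C]_d := v *m v^t*.

(* A quantum instrument with classical outcomes in K; the maps for the different
   outcomes are completely positive (Kraus form), their sum trace preserving. *)
Record instrument (K : finType) (d d' : nat) := Instrument {
  kraus_index : finType;
  kraus : K -> kraus_index -> 'M[C]_(d', d);
  kraus_complete :
    \sum_k \sum_j (kraus k j)^t* *m kraus k j = 1%:M }.

Arguments kraus {K d d'} i k j.

Definition apply_instr (K : finType) d d' (E : instrument K d d') (k : K)
    (rho : 'M[C]_d) : 'M[C]_d' :=
  \sum_j kraus E k j *m rho *m (kraus E k j)^t*.

Definition bits (n : nat) : finType := {ffun 'I_n -> bool}.

(* |x>_theta: theta = false is the computational basis, theta = true the
   Hadamard basis. *)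
Definition qubit (x theta : bool) : 'cV[C]_2 :=
  \col_(b < 2)
    if theta then (-1) ^+ (x && (b == 1)) / sqrtC 2
    else (b == x :> nat)%:R.

(* |x_1>_{theta_1} (x) ... (x) |x_N>_{theta_N}, in the computational basis
   indexed by functions 'I_N -> 'I_2. *)
Definition hdim (N : nat) : nat := #|{ffun 'I_N -> 'I_2}|.

Definition ket N (x theta : bits N) : 'cV[C]_(hdim N) :=
  \col_(i < hdim N) \prod_(j < N) qubit (x j) (theta j) (enum_val i j) 0.

Definition ket2 (x theta x' theta' : bool) : 'cV[C]_(2 * 2) :=
  mxtens.tensmx (qubit x theta) (qubit x' theta').

(* Both marginals of a two-qubit vector with coefficient matrix A are A A^dagger
   and the conjugate of A^dagger A; the first one being 1/2 says that A is a
   multiple of a unitary, hence so is the second. The vector is then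
   normalised. *)
Definition max_entangled (v : 'cV[C]_(2 * 2)) : Prop :=
  let A := \matrix_(i < 2, j < 2) v (mxtens.mxtens_index (i, j)) 0 in
  A *m A^t* = (2^-1)%:M.

End Quantum.

Definition nsub (N n : nat) : finType := {K : {set 'I_N} | #|K| == n}.

(* The ordered pairs (I_0, I_1) that are valid messages of Bob. *)
Definition ipair (n m : nat) : finType :=
  {p : {set 'I_n} * {set 'I_n} |
    [&& #|p.1| == m, #|p.2| == m & [disjoint p.1 & p.2]]}.

Definition part n m (p : ipair n m) (c : bool) : {set 'I_n} :=
  if c then (val p).2 else (val p).1.

(* x restricted to the positions in J, listed in increasing order; meaningful
   when #|J| = k. *)
Definition restr N k (J : {set 'I_N}) (x : bits N) : bits k :=
  [ffun j : 'I_k => nth false [seq x i | i <- enum J] j].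

Definition agree n (theta theta' : bits n) : {set 'I_n} :=
  [set i | theta i == theta' i].

Definition sel (T : Type) (c : bool) (s0 s1 : T) : T := if c then s1 else s0.

Record hash_family (m l : nat) := HashFamily {
  hash_key : finType;
  hash : hash_key -> bits m -> bits l;
  hash_key_gt0 : (0 < #|hash_key|)%N;
  hash_two_universal : forall x y : bits m, x != y ->
    (#|[set r | hash r x == hash r y]| * 2 ^ l <= #|hash_key|)%N }.

(* ec_enc theta p x0 x1 o is the probability that Alice sends o; ec_dec theta p c
   y o is Bob's correction of his string y for I_c, None being an abort.
   Both parties know the public data theta and p = (I_0, I_1). *)
Record ec_scheme (R : realType) (n m leak : nat) := EcScheme {
  ec_enc : bits n -> ipair n m -> bits m -> bits m -> bits leak -> R[i];
  ec_enc_ge0 : forall theta p x0 x1 o, 0 <= ec_enc theta p x0 x1 o;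
  ec_enc_sum1 : forall theta p x0 x1, \sum_o ec_enc theta p x0 x1 o = 1;
  ec_dec : bits n -> ipair n m -> bool -> bits m -> bits leak ->
    option (bits m) }.

(* The joint probability that Alice and Bob draw (x, theta) and (x', theta')
   and that the station, projecting on v after the noise channel, clicks. *)
Definition click_weight (R : realType) (J : finType)
    (noise : J -> 'M[R[i]]_(2 * 2)) (v : 'cV[R[i]]_(2 * 2))
    (x theta x' theta' : bool) : R[i] :=
  16^-1 * (v^t* *m
    (\sum_j noise j *m pure (ket2 R x theta x' theta') *m (noise j)^t*) *m v) 0 0.

(* The honest measurement station with the noise of one round. The outcomes in
   hd_out are the successes, every other outcome is a failure. Trace that
   the noise channel loses is a detected loss, i.e. also a failure. Since the
   channel may act jointly on the two qubits, it covers source-to-station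
   transmission as well as imperfections of the station. *)
Record honest_device (R : realType) := HonestDevice {
  hd_out : finType;
  hd_vec : hd_out -> 'cV[R[i]]_(2 * 2);
  hd_max_entangled : forall k, max_entangled (hd_vec k);
  hd_orthogonal : forall k k', k != k' -> (hd_vec k)^t* *m hd_vec k' = 0;
  (* whether Bob flips his bit, given the outcome and his own basis *)
  hd_flip : hd_out -> bool -> bool;
  hd_flip_correct : forall k theta x x', x != x' (+) hd_flip k theta ->
    (hd_vec k)^t* *m ket2 R x theta x' theta = 0;
  hd_noise_index : finType;
  hd_noise : hd_noise_index -> 'M[R[i]]_(2 * 2);
  hd_noise_trace_le :
    psd (1%:M - \sum_j (hd_noise j)^t* *m hd_noise j);
  hd_click_gt0 : 0 < \sum_(x : bool) \sum_(theta : bool) \sum_(x' : bool)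
    \sum_(theta' : bool) \sum_k click_weight hd_noise (hd_vec k) x theta x' theta' }.

Section Security.
Variables (R : realType) (l : nat).

Definition ot_correct (e : R)
    (rho : cq R (bits l * bits l * bool * bits l)%type 1) : Prop :=
  exists sigma : cq R (bits l * bits l * bool)%type 1,
    [/\ is_state sigma,
        forall s0 s1 c, sigma (s0, s1, c) = ((2 ^ l * 2 ^ l * 2)%N%:R^-1)%:M
      & trdist rho (fun '(s0, s1, c, s) =>
          if s == sel c s0 s1 then sigma (s0, s1, c) else 0) <= e%:C].

(* rho is the state of (A, C, S_C-hat); A consists of a classical register V and
   a quantum one. *)
Definition ot_secure_for_bob (V : finType) q (e : R)
    (rho : cq R (V * bool * bits l)%type q) : Prop :=
  exists sigma : cq R (V * bits l * bits l * bool)%type q,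
    [/\ is_state sigma,
        forall a s0 s1 c,
          sigma (a, s0, s1, c) = 2^-1 *: \sum_(c' : bool) sigma (a, s0, s1, c')
      & trdist rho (fun '(a, c, s) =>
          \sum_(s0 : bits l) \sum_(s1 : bits l | sel c s0 s1 == s)
             sigma (a, s0, s1, c)) <= e%:C].

Definition ot_secure_for_alice (V : finType) q (e : R)
    (rho : cq R (bits l * bits l * V)%type q) : Prop :=
  exists sigma : cq R (bits l * bits l * V * bool)%type q,
    [/\ is_state sigma,
        forall s0 s1 b,
          sigma (s0, s1, b, false) =
            ((2 ^ l)%N%:R^-1) *: \sum_(t : bits l) sigma (s0, t, b, false),
        forall s0 s1 b,
          sigma (s0, s1, b, true) =
            ((2 ^ l)%N%:R^-1) *: \sum_(t : bits l) sigma (t, s1, b, true)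
      & trdist rho (fun '(s0, s1, b) =>
          \sum_(c : bool) sigma (s0, s1, b, c)) <= e%:C].

End Security.

Section Protocol.
Variables (R : realType) (n m l leak : nat).
Variables (dev : honest_device R) (h : hash_family m l) (ec : ec_scheme R n m leak).
Local Notation C := R[i].
Local Notation key := (hash_key h).
Local Notation out := (hd_out dev).

(* Probability that an honest Bob draws the bit c and announces p, when G is the
   set of positions where the bases agree: I is a uniform m-subset of G and
   I_Bad a uniform m-subset of the complement of (the truncated) I. If
   #|G| < m, Bob has aborted and goes on with I a uniform m-subset of all
   positions. *)
Definition bob_choice (G : {set 'I_n}) (c : bool) (p : ipair n m) : C :=
  let base := if (m <= #|G|)%N then G else [set: 'I_n] in
  if part p c \subset base then
    ((2 * 'C(#|base|, m) * 'C(n - m, m))%N%:R)^-1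
  else 0.

Definition bob_flip (z : {ffun 'I_n -> out}) (x theta : bits n) : bits n :=
  [ffun i => x i (+) hd_flip (z i) (theta i)].

(* short says that fewer than m bases agree. *)
Definition bob_aborts (short : bool) (guess : option (bits m)) : bool :=
  short || (guess == None).

Definition round_weight (x theta x' theta' : bool) (z : out) : C :=
  click_weight (@hd_noise _ dev) (hd_vec z) x theta x' theta'.

(* The law of a round given that it clicked: discarding the failures leaves n
   independent rounds with this law. *)
Definition round_law (x theta x' theta' : bool) (z : out) : C :=
  round_weight x theta x' theta' z /
    \sum_(y : bool) \sum_(t : bool) \sum_(y' : bool) \sum_(t' : bool) \sum_w
      round_weight y t y' t' w.

(* Expectation, over an honest run up to error correction, of a function of:
   "too few bases agree", X_{I_0}, X_{I_1}, C, Bob's corrected string. *)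
Definition honest_expectation
    (f : bool -> bits m -> bits m -> bool -> option (bits m) -> C) : C :=
  \sum_(x : bits n) \sum_(theta : bits n) \sum_(x' : bits n) \sum_(theta' : bits n)
  \sum_(z : {ffun 'I_n -> out})
    (\prod_i round_law (x i) (theta i) (x' i) (theta' i) (z i)) *
    \sum_(c : bool) \sum_(p : ipair n m)
      let G := agree theta theta' in
      let x0 := restr m (part p false) x in
      let x1 := restr m (part p true) x in
      let y := restr m (part p c) (bob_flip z x' theta') in
      bob_choice G c p *
      \sum_(o : bits leak) ec_enc ec theta p x0 x1 o *
         f (#|G| < m)%N x0 x1 c (ec_dec ec theta p c y o).

Definition ec_abort_probability : C :=
  honest_expectation (fun short _ _ _ guess => (~~ short && (guess == None))%:R).

Definition ec_failure_probability : C :=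
  honest_expectation (fun short x0 x1 c guess =>
    [&& ~~ short, guess != None & guess != Some (sel c x0 x1)]%:R).

Definition ec_reliable (eps : R) : Prop :=
  ec_abort_probability <= eps%:C /\ ec_failure_probability <= eps%:C.

(* After an abort all the strings are replaced by uniform ones; C already is a
   uniform bit. *)
Definition honest_output : cq R (bits l * bits l * bool * bits l)%type 1 :=
  fun '(s0, s1, c, s) =>
    (honest_expectation (fun short x0 x1 c' guess =>
       (c' == c)%:R *
       ((#|key| ^ 2)%N%:R^-1 * \sum_(r0 : key) \sum_(r1 : key)
         if bob_aborts short guess then ((2 ^ l) ^ 3)%N%:R^-1
         else [&& hash r0 x0 == s0, hash r1 x1 == s1
                & omap (hash (sel c r0 r1)) guess == Some s]%:R)))%:M.

(* Controlling the station, Alice receives all of Bob's qubits, in an arbitrary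
   number of rounds. The first instrument yields everything she announces before
   Bob speaks: the n successful rounds, their outcomes, the bases theta, and her
   private classical memory. It acts on all rounds at once, which includes
   every round-by-round strategy. The second one yields the error correction
   information and the two hash functions once she got (I_0, I_1). *)
Definition alice_first (N : nat) (M : finType) : finType :=
  (nsub N n * {ffun 'I_n -> out} * bits n * M)%type.

Definition alice_second (M : finType) : finType :=
  (bits leak * (key * key) * M)%type.

Record dishonest_alice := DishonestAlice {
  da_rounds : nat;
  da_mem : finType;
  da_dim : nat;
  da_station : instrument R (alice_first da_rounds da_mem) (hdim da_rounds) da_dim;
  da_final_mem : finType;
  da_final_dim : nat;
  da_reply : alice_first da_rounds da_mem -> ipair n m ->
    instrument R (alice_second da_final_mem) da_dim da_final_dim }.

Definition alice_view (A : dishonest_alice) : finType :=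
  (alice_first (da_rounds A) (da_mem A) * ipair n m
   * alice_second (da_final_mem A))%type.

(* Bob's abort is not communicated: it only makes his output string uniform, and
   C stays the bit he drew in the second step. Drawing C afresh would bias it
   when Alice spoils the error correction of one string only. *)
Definition real_dishonest_alice (A : dishonest_alice) :
    cq R (alice_view A * bool * bits l)%type (da_final_dim A) :=
  fun '((a, p, b), c, s) =>
    let: (K, z, theta, _) := a in
    let: (o, (r0, r1), _) := b in
    ((4 ^ da_rounds A)%N%:R^-1) *:
    \sum_(x' : bits (da_rounds A)) \sum_(theta' : bits (da_rounds A))
      let thetaK := restr n (val K) theta' in
      let G := agree theta thetaK in
      let y := restr m (part p c) (bob_flip z (restr n (val K) x') thetaK) in
      let guess := ec_dec ec theta p c y o in
      (bob_choice G c p *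
        (if bob_aborts (#|G| < m)%N guess then (2 ^ l)%N%:R^-1
         else (omap (hash (sel c r0 r1)) guess == Some s)%:R)) *:
      apply_instr (@da_reply A a p) b
        (apply_instr (da_station A) a (pure (ket R x' theta'))).

(* Controlling the station, Bob receives all of Alice's qubits. The first
   instrument yields the announced n successful rounds and an unbounded
   classical memory; db_dim is the dimension of the quantum memory Q that
   survives the waiting time. Knowing theta, he then produces (I_0, I_1). *)
Definition bob_first (N : nat) (M : finType) : finType := (nsub N n * M)%type.

Record dishonest_bob := DishonestBob {
  db_rounds : nat;
  db_mem : finType;
  db_dim : nat;
  db_station : instrument R (bob_first db_rounds db_mem) (hdim db_rounds) db_dim;
  db_final_mem : finType;
  db_final_dim : nat;
  db_reply : bob_first db_rounds db_mem -> bits n ->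
    instrument R (ipair n m * db_final_mem)%type db_dim db_final_dim }.

Definition bob_view (B : dishonest_bob) : finType :=
  (bob_first (db_rounds B) (db_mem B) * bits n
   * (ipair n m * db_final_mem B) * bits leak * (key * key))%type.

Definition real_dishonest_bob (B : dishonest_bob) :
    cq R (bits l * bits l * bob_view B)%type (db_final_dim B) :=
  fun '(s0, s1, (a, thetaK, b, o, (r0, r1))) =>
    ((4 ^ db_rounds B * #|key| ^ 2)%N%:R^-1) *:
    \sum_(x : bits (db_rounds B))
    \sum_(theta : bits (db_rounds B) | restr n (val a.1) theta == thetaK)
      let xK := restr n (val a.1) x in
      let x0 := restr m (part b.1 false) xK in
      let x1 := restr m (part b.1 true) xK in
      (ec_enc ec thetaK b.1 x0 x1 o *
        ((hash r0 x0 == s0) && (hash r1 x1 == s1))%:R) *: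
      apply_instr (@db_reply B a thetaK) b
        (apply_instr (db_station B) a (pure (ket R x theta))).

Definition implements_rand_ot (D e : R) : Prop :=
  [/\ ot_correct e honest_output,
      forall A : dishonest_alice, ot_secure_for_bob e (@real_dishonest_alice A)
    & forall B : dishonest_bob, log2 (db_dim B)%:R <= D ->
        ot_secure_for_alice e (@real_dishonest_bob B)].

End Protocol.

(* Main.v *)
(* The security of Alice rests on an uncertainty relation. For a fixed outcome of
   the station, the probabilities p(x, theta) of Alice's strings and bases
   satisfy, in every coordinate, the constraint that the Bloch vector of a qubit
   has length at most 1; hence the sum over x and theta of p^(1+s) factorises into
   one-qubit bounds, and Markov's inequality shows that with probability at least
   1 - eps the string has p(x | theta) <= 2^(- lambda n). Among such strings, and
   given the error correction information, few values of X_{I_1} can have a large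
   marginal. Let C = 1 on those heavy values and C = 0 otherwise: in both cases
   the string X_{I_{1-C}} is spread out even given the other one, and its hash
   value is close to uniform by the second moment bound for 2-universal hashing.
   The quantum memory costs a factor dim Q: the trace norm of k A k^dagger, with k a
   Kraus operator of Bob's final measurement, is bounded by the arithmetic mean
   of a multiple of |k|_2^2, which sums to dim Q, and of |A k^dagger|_2^2.

   For an honest Bob the state emitted in a round, averaged over his bit, does not
   depend on his basis, so that replacing his basis by Alice's where he does not
   use his bit leaves Alice's view unchanged; only the runs with fewer than m
   agreements, of probability at most eps by Hoeffding's inequality, are lost.

   For two honest parties Alice's bits are i.i.d.; the station is bound by the same
   one-qubit constraint, so their law is spread and both hash values are
   uniform. *)
Require Import Defs.
From mathcomp Require Import all_boot all_order all_algebra.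
From mathcomp Require Import all_reals boolp functions normedtype derive sequences realfun exp.
From mathcomp.real_closed Require Import complex.
From mathcomp.real_closed Require mxtens.
From mathcomp Require Import ring lra zify.

Set Implicit Arguments.
Unset Strict Implicit.
Unset Printing Implicit Defensive.

Import Order.TTheory GRing.Theory Num.Theory.
Import numFieldNormedType.Exports.
Local Open Scope ring_scope.
Local Open Scope complex_scope.
Local Open Scope sesquilinear_scope.

(** * Frobenius norm, trace norm and positive matrices *)

Section Frobenius.
Variable R : realType.
Local Notation C := R[i].

(** The estimates use unnormalised weights: trace norms are tested against contractions, and no
    state is divided by its probability. Entropy appears only as the first-order term of [q^(1+s)],
    with an explicit quadratic error in [s]; the choice [s = delta' ln 2] balances the two for the
    given [lambda]. The obstacle on Alice's side is that Bob selects the index sets by measuring [Q]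
    after learning [theta], so the classes depend on his outcome. Hashing is therefore averaged for
    each Kraus operator separately, and the operators are summed last. The code word costs a factor
    [2^leak] because it is fixed inside every class. Light values have relative marginal at most
    [tau]; heavy ones number at most [1 / tau], each with joint weight at most [2^(n - 2 m) beta].
    Equating the two contributions makes [tau] a square root, so each string gets only half of the
    exponent: this is the factor 2 in the condition on [n]. The constant 8 is set by correctness;
    the errors against dishonest parties are smaller. *)

Definition sqn (z : C) : R := complex.Re z ^+ 2 + complex.Im z ^+ 2.

Lemma sqn_ge0 z : 0 <= sqn z.
Proof. by rewrite addr_ge0 ?sqr_ge0. Qed.

Lemma sqnE z : (sqn z)%:C = z * z^*.
Proof. by rewrite /sqn add_Re2_Im2 normCK. Qed.

Lemma Re_sum (I : Type) (r : seq I) (P : pred I) (F : I -> C) :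
  complex.Re (\sum_(i <- r | P i) F i) = \sum_(i <- r | P i) complex.Re (F i).
Proof. by apply: (big_morph (@complex.Re R)) => // -[a b] [c d]. Qed.

Definition fn m n (A : 'M[C]_(m, n)) : R := \sum_i \sum_j sqn (A i j).

Lemma fn_ge0 m n (A : 'M[C]_(m, n)) : 0 <= fn A.
Proof. by apply: sumr_ge0 => i _; apply: sumr_ge0 => j _; exact: sqn_ge0. Qed.

Definition rtr n (A : 'M[C]_n) : R := complex.Re (\tr A).

Lemma fnE m n (A : 'M[C]_(m, n)) : (fn A)%:C = \tr (A *m A^t*).
Proof.
rewrite /fn /mxtrace rmorph_sum; apply: eq_bigr => i _.
rewrite rmorph_sum mxE; apply: eq_bigr => j _ /=.
by rewrite !mxE -sqnE.
Qed.

Lemma ler_sqr_bound (x y : R) : 0 <= y -> x ^+ 2 <= y ^+ 2 -> x <= y.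
Proof.
move=> y0 h; apply: (le_trans (ler_norm x)).
by rewrite -(ger0_norm y0) -ler_sqr ?nnegrE ?normr_ge0 // -!normrX !ger0_norm ?sqr_ge0.
Qed.

Lemma sqnM (z w : C) : sqn (z * w) = sqn z * sqn w.
Proof. by case: z w => [a b] [c d]; rewrite /sqn /=; ring. Qed.

Lemma sqn_conj (z : C) : sqn (Num.conj z) = sqn z.
Proof. by case: z => a b; rewrite /sqn /= sqrrN. Qed.

(** By induction; the cross term of a new summand is at most the arithmetic mean of [A * be] and
    [al * B], so no square root is needed. *)
Lemma sqn_cauchy (I : Type) (r : seq I) (a b : I -> C) :
  sqn (\sum_(i <- r) a i * b i) <=
  (\sum_(i <- r) sqn (a i)) * (\sum_(i <- r) sqn (b i)).
Proof.
elim: r => [|i r IH]; first by rewrite !big_nil mulr0 /sqn /= expr0n /= addr0.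
rewrite !big_cons; set s := \sum_(j <- r) _ in IH *.
set A := \sum_(j <- r) sqn (a j) in IH *; set B := \sum_(j <- r) sqn (b j) in IH *.
have A0 : 0 <= A by apply: sumr_ge0 => j _; exact: sqn_ge0.
have B0 : 0 <= B by apply: sumr_ge0 => j _; exact: sqn_ge0.
have a0 := sqn_ge0 (a i); have b0 := sqn_ge0 (b i).
have := sqnM (a i) (b i).
set z := a i * b i; set al := sqn (a i) in a0 *; set be := sqn (b i) in b0 *.
move: IH; clearbody s z al be A B; case: s z => [x y] [u v]; rewrite /sqn /= => IH hz.
have P : x * u + y * v <= (A * be + al * B) / 2.
  have H1 : (x * u + y * v) ^+ 2 <= (A * B) * (al * be).
    rewrite -hz; apply: (le_trans (y := (x ^+ 2 + y ^+ 2) * (u ^+ 2 + v ^+ 2))).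
      by rewrite -subr_ge0 (_ : _ - _ = (x * v - y * u) ^+ 2) ?sqr_ge0 //; ring.
    by apply: ler_wpM2r => //; rewrite addr_ge0 ?sqr_ge0.
  apply: ler_sqr_bound; first by rewrite divr_ge0 ?addr_ge0 ?mulr_ge0.
  apply: (le_trans H1); rewrite -subr_ge0.
  by rewrite (_ : _ - _ = ((A * be - al * B) / 2) ^+ 2) ?sqr_ge0 //; field.
have -> : (u + x) ^+ 2 + (v + y) ^+ 2 =
  (u ^+ 2 + v ^+ 2) + (x ^+ 2 + y ^+ 2) + 2 * (x * u + y * v) by ring.
rewrite hz (_ : (al + A) * (be + B) = al * be + A * B + 2 * ((A * be + al * B) / 2)); last by field.
by rewrite !lerD // ler_wpM2l.
Qed.

Lemma fnM m n p (A : 'M[C]_(m, n)) (B : 'M[C]_(n, p)) : fn (A *m B) <= fn A * fn B.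
Proof.
rewrite /fn [X in _ <= _ * X]exchange_big /= mulr_suml.
apply: ler_sum => i _; rewrite mulr_sumr; apply: ler_sum => k _.
by rewrite mxE sqn_cauchy.
Qed.

Lemma fn_adj m n (A : 'M[C]_(m, n)) : fn (A^t*) = fn A.
Proof.
rewrite /fn exchange_big /=; apply: eq_bigr => i _; apply: eq_bigr => j _.
by rewrite !mxE sqn_conj.
Qed.

Lemma rtrC m n (A : 'M[C]_(m, n)) (B : 'M[C]_(n, m)) : rtr (A *m B) = rtr (B *m A).
Proof. by rewrite /rtr mxtrace_mulC. Qed.

Lemma rtrD n (A B : 'M[C]_n) : rtr (A + B) = rtr A + rtr B.
Proof. by rewrite /rtr mxtraceD; case: (\tr A) (\tr B) => [? ?] [? ?]. Qed.

Lemma rtrN n (A : 'M[C]_n) : rtr (- A) = - rtr A.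
Proof. by rewrite /rtr raddfN /=; case: (\tr A). Qed.

Lemma rtrB n (A B : 'M[C]_n) : rtr (A - B) = rtr A - rtr B.
Proof. by rewrite rtrD rtrN. Qed.

Lemma rtr0 n : rtr (0 : 'M[C]_n) = 0.
Proof. by rewrite /rtr raddf0. Qed.

Lemma rtr_sum n (I : Type) (r : seq I) (P : pred I) (F : I -> 'M[C]_n) :
  rtr (\sum_(i <- r | P i) F i) = \sum_(i <- r | P i) rtr (F i).
Proof. exact: (big_morph _ (@rtrD n) (@rtr0 n)). Qed.

Lemma rtrZ n (a : R) (A : 'M[C]_n) : rtr (a%:C *: A) = a * rtr A.
Proof. by rewrite /rtr linearZ /=; case: (\tr A) => [x y] /=; rewrite mul0r subr0. Qed.

Lemma rtr_gram m n (A : 'M[C]_(m, n)) : rtr (A *m A^t*) = fn A.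
Proof. by rewrite /rtr -fnE. Qed.

(** Cauchy-Schwarz for the trace in its arithmetic-mean form. The free factor [t] allows the bound
    to be summed over outcomes and keys before [t] is chosen. *)
Lemma rtr_AMGM m n (A : 'M[C]_(m, n)) (B : 'M[C]_(n, m)) (t : R) :
  0 < t -> rtr (A *m B) <= (t * fn A + fn B / t) / 2.
Proof.
move=> t0; rewrite -(fn_adj B) /fn !mulr_sumr mulr_suml -big_split /=.
rewrite /rtr /mxtrace Re_sum mulr_suml; apply: ler_sum => i _.
rewrite mxE Re_sum mulr_sumr mulr_suml -big_split mulr_suml /=; apply: ler_sum => j _.
rewrite !mxE sqn_conj; case: (A i j) (B j i) => [a b] [c d]; rewrite /sqn /=.
rewrite -subr_ge0; set X := (X in 0 <= X).
rewrite (_ : X = ((t * a - c) ^+ 2 + (t * b + d) ^+ 2) / (2 * t)); last by rewrite /X; field; rewrite gt_eqF.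
by rewrite divr_ge0 ?addr_ge0 ?sqr_ge0 // mulr_ge0 // ltW.
Qed.

(** Operator norm at most 1, phrased through the squared Frobenius norm, the only way in which it is
    used. *)
Definition contraction d (W : 'M[C]_d) : Prop :=
  forall n (A : 'M[C]_(d, n)), fn (W *m A) <= fn A.

Lemma contractionN d (W : 'M[C]_d) : contraction W -> contraction (- W).
Proof.
move=> hW n A; rewrite mulNmx (_ : fn (- _) = fn (W *m A)) //.
rewrite /fn; apply: eq_bigr => i _; apply: eq_bigr => j _; rewrite mxE.
by rewrite -mulN1r sqnM /sqn /= oppr0 sqrrN expr1n expr0n addr0 mul1r.
Qed.

Lemma fn_unitary m n (U : 'M[C]_m) (A : 'M[C]_(m, n)) : U \is unitarymx -> fn (U *m A) = fn A.
Proof.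
move=> Uu; apply: complexI; rewrite !fnE trmx_mul map_mxM mulmxA mxtrace_mulC.
by rewrite !mulmxA -trmxC_unitary in Uu *; move/unitarymxP: Uu; rewrite trmxCK => ->; rewrite mul1mx.
Qed.

(** Polar decomposition: [W] is the adjoint of the partial isometry in the polar form of [A]. A
    trace norm thus becomes the value of a linear functional, and distances can be estimated term by
    term. *)
Lemma tracenormP d (A : 'M[C]_d) :
  exists2 W, contraction W & tracenorm A = (rtr (W *m A))%:C.
Proof.
pose U := spectralmx (A^t* *m A); pose D := spectral_diag (A^t* *m A).
have Uu : U \is unitarymx := spectral_unitarymx _.
have UU : U *m U^t* = 1%:M by exact/unitarymxP.
have UU' : U^t* *m U = 1%:M by exact: mulmx1C.
have hN : A^t* *m A \is normalmx.
  apply/normalmxP; rewrite !trmx_mul !map_mxM trmxCK //.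
have /orthomx_spectralP := hN; rewrite -/U -/D invmx_unitary // => hA.
pose B := A *m U^t*.
have hB : B^t* *m B = diag_mx D.
  rewrite /B trmx_mul map_mxM trmxCK mulmxA -(mulmxA U) hA !mulmxA UU mul1mx.
  by rewrite -mulmxA UU mulmx1.
have D0 i : 0 <= D 0 i.
  have /matrixP/(_ i i) := hB; rewrite !mxE eqxx mulr1n => <-.
  by apply: sumr_ge0 => j _; rewrite !mxE mulrC mul_conjC_ge0.
pose s i := sqrtC (D 0 i).
have s0 i : 0 <= s i by rewrite sqrtC_ge0.
have sR i : Num.conj (s i) = s i by apply: conj_Creal; rewrite ger0_real.
have ss i : s i * s i = D 0 i by rewrite -expr2 sqrtCK.
(* The inverse of a zero singular value is 0, so [S] is only a partial isometry; the identity [SS]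
   below is what remains of unitarity. *)
pose S := diag_mx (\row_i (s i)^-1) *m B^t*.
have SB : S *m B = diag_mx (\row_i s i).
  rewrite /S -mulmxA hB; apply/matrixP => i j; rewrite mul_diag_mx !mxE.
  case: eqP => [->|_]; rewrite ?mulr1n ?mulr0n ?mulr0 // -ss.
  by have [->|n0] := eqVneq (s j) 0; rewrite ?mulr0 // mulrA mulVf // mul1r.
have SS : S *m S^t* *m S = S.
  have -> : S^t* = B *m diag_mx (\row_i (s i)^-1).
    rewrite /S trmx_mul map_mxM trmxCK tr_diag_mx map_diag_mx; congr (_ *m diag_mx _).
    by apply/matrixP => i j; rewrite !mxE fmorphV /= sR.
  rewrite (mulmxA S B) SB /S; apply/matrixP => i j; rewrite -mulmxA !mul_diag_mx !mxE.
  have [->|n0] := eqVneq (s i) 0; first by rewrite invr0 !mul0r.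
  by rewrite mulVKf.
exists (U^t* *m S); last first.
  rewrite /tracenorm.
  have -> : U^t* *m S *m A = U^t* *m (S *m B) *m U.
    have AE : A = B *m U by rewrite /B -mulmxA UU' mulmx1.
    have assoc (X Y V Z : 'M[C]_d) : X *m Y *m (V *m Z) = X *m (Y *m V) *m Z by rewrite !mulmxA.
    exact: etrans (congr1 (mulmx (U^t* *m S)) AE) (assoc _ _ _ _).
  rewrite rtrC mulmxA UU mul1mx SB /rtr mxtrace_diag Re_sum rmorph_sum.
  apply: eq_bigr => i _ /=; rewrite mxE -/D -/(s i).
  by have /complex_realP[k ->] : s i \is Num.real by rewrite ger0_real.
move=> n Y; rewrite -mulmxA fn_unitary; last by rewrite trmxC_unitary.
(* [Q] is an orthogonal projection, so [S] loses exactly the squared norm of the complementary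
   component [Z *m Y]. *)
pose Q := S^t* *m S.
have QQ : Q *m Q = Q by rewrite /Q -mulmxA (mulmxA S) SS.
have Qh : Q^t* = Q by rewrite /Q trmx_mul map_mxM trmxCK.
pose Z := 1%:M - Q.
have Zh : Z^t* = Z.
  apply/matrixP => i j; have /matrixP/(_ i j) := Qh; rewrite !mxE => e.
  by rewrite rmorphB /= e eq_sym; case: (i == j); rewrite ?conjC1 ?conjC0.
have ZZ : Z *m Z = 1%:M - Q by rewrite mulmxBl !mulmxBr !mul1mx mulmx1 QQ subrr subr0.
have fnA n' (X : 'M[C]_(d, n')) : fn X = rtr (X^t* *m X).
  by rewrite -(fn_adj X) -rtr_gram trmxCK.
have e1 : fn (S *m Y) = rtr (Y^t* *m (Q *m Y)).
  by rewrite fnA trmx_mul map_mxM /Q !mulmxA.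
have e2 : fn (Z *m Y) = rtr (Y^t* *m (Z *m Y)).
  rewrite fnA trmx_mul map_mxM Zh -mulmxA; congr (rtr (_ *m _)).
  by rewrite mulmxA ZZ.
have e3 : fn (Z *m Y) = fn Y - fn (S *m Y).
  by rewrite e1 e2 (fnA _ Y) /Z mulmxBl mul1mx mulmxBr rtrB.
by rewrite -subr_ge0 -e3 fn_ge0.
Qed.

(** Positivity as an explicit factorisation. It passes to sums, nonnegative multiples and Kraus
    images by construction, and it supplies the factor on which the Frobenius estimates act. *)
Definition gram d (A : 'M[C]_d) : Prop := exists r (B : 'M[C]_(d, r)), A = B *m B^t*.

Lemma gram0 d : gram (0 : 'M[C]_d).
Proof. by exists 0%N, 0; rewrite mul0mx. Qed.

Lemma gramD d (A B : 'M[C]_d) : gram A -> gram B -> gram (A + B).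
Proof.
move=> [r [X ->]] [q [Y ->]]; exists (r + q)%N, (row_mx X Y).
by rewrite tr_row_mx map_col_mx mul_row_col.
Qed.

Lemma gram_sum d (I : Type) (r : seq I) (P : pred I) (F : I -> 'M[C]_d) :
  (forall i, P i -> gram (F i)) -> gram (\sum_(i <- r | P i) F i).
Proof. by move=> h; apply: big_ind => //; [exact: gram0 | exact: gramD]. Qed.

Lemma gramZ d (a : C) (A : 'M[C]_d) : 0 <= a -> gram A -> gram (a *: A).
Proof.
move=> a0 [r [X ->]]; exists r, (sqrtC a *: X).
rewrite linearZ /= map_mxZ /= -scalemxAl -scalemxAr scalerA; congr (_ *: _).
by rewrite conj_Creal ?ger0_real ?sqrtC_ge0 // -expr2 sqrtCK.
Qed.

Lemma gram_kraus d e (k : 'M[C]_(e, d)) (A : 'M[C]_d) : gram A -> gram (k *m A *m k^t*).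
Proof. by move=> [r [X ->]]; exists r, (k *m X); rewrite trmx_mul map_mxM !mulmxA. Qed.

Lemma gram_pure d (v : 'cV[C]_d) : gram (pure v).
Proof. by exists 1%N, v. Qed.

Lemma gram_psd d (A : 'M[C]_d) : gram A -> psd A.
Proof.
move=> [r [X ->]] v; rewrite !mulmxA -mulmxA.
have -> : v^t* *m X = (X^t* *m v)^t* by rewrite trmx_mul map_mxM trmxCK.
rewrite mxE; apply: sumr_ge0 => j _; rewrite !mxE mulrC mul_conjC_ge0 //.
Qed.

Lemma gram_tr d (A : 'M[C]_d) : gram A -> \tr A = (rtr A)%:C.
Proof. by move=> [r [X ->]]; rewrite rtr_gram fnE. Qed.

Lemma gram_rtr_ge0 d (A : 'M[C]_d) : gram A -> 0 <= rtr A.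
Proof. by move=> [r [X ->]]; rewrite rtr_gram fn_ge0. Qed.

(** With [A] the Gram matrix of [X], the arithmetic-mean bound at [t = 1] compares [W *m X] with
    [X]. *)
Lemma rtr_contraction d (W A : 'M[C]_d) : contraction W -> gram A -> rtr (W *m A) <= rtr A.
Proof.
move=> hW [r [X ->]]; rewrite rtr_gram mulmxA.
apply: (le_trans (rtr_AMGM _ _ (ltr01 : 0 < 1 :> R))); rewrite fn_adj divr1 mul1r.
by have := hW _ X; lra.
Qed.

Lemma norm_rtr_contraction d (W A : 'M[C]_d) :
  contraction W -> gram A -> `|rtr (W *m A)| <= rtr A.
Proof.
move=> hW hA; rewrite ler_norml rtr_contraction // andbT.
by rewrite lerNl -rtrN -mulNmx rtr_contraction //; exact: contractionN.
Qed.

(* Cauchy-Schwarz for the positive operator A, i.e. A^2 <= tr(A) A. *)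
Lemma fn_gramM d e (A : 'M[C]_d) (Y : 'M[C]_(d, e)) : gram A ->
  fn (A *m Y) <= rtr A * rtr (Y^t* *m A *m Y).
Proof.
move=> [r [X ->]]; rewrite rtr_gram -mulmxA.
apply: (le_trans (fnM _ _)); rewrite ler_wpM2l ?fn_ge0 //.
rewrite (_ : Y^t* *m _ *m Y = (X^t* *m Y)^t* *m (X^t* *m Y)); last first.
  by rewrite trmx_mul map_mxM trmxCK !mulmxA.
by rewrite rtrC rtr_gram.
Qed.

End Frobenius.

(** * Two-universal hashing *)

Section Hashing.
Variables (R : realType) (m l : nat) (h : hash_family m l).
Local Notation C := R[i].
Local Notation key := (hash_key h).
Let K : R := #|key|%:R.
Let q : R := (2 ^+ l)^-1.

Lemma card_bits n : #|bits n| = (2 ^ n)%N.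
Proof. by rewrite card_ffun card_bool card_ord. Qed.

Lemma sum_bits_const n (a : R) : \sum_(s : bits n) a = 2 ^+ n * a.
Proof. by rewrite sumr_const -(mulr_natl a) card_bits natrX. Qed.

Definition hdev (r : key) (s : bits l) (x : bits m) : R := (hash r x == s)%:R - q.

Lemma hdev_sum r x : \sum_s hdev r s x = 0.
Proof.
rewrite sumrB sum_bits_const divff ?expf_neq0 ?pnatr_eq0 // (bigD1 (hash r x)) //= eqxx.
rewrite big1 ?addr0 ?subrr // => s /negbTE; rewrite eq_sym => -> //.
Qed.

Lemma hdev_corr r x x' :
  \sum_s hdev r s x * hdev r s x' = (hash r x == hash r x')%:R - q.
Proof.
transitivity (\sum_s (hash r x == s)%:R * hdev r s x' - q * \sum_s hdev r s x').
  by rewrite mulr_sumr -sumrB; apply: eq_bigr => s _; rewrite -mulrBl.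
rewrite hdev_sum mulr0 subr0 (bigD1 (hash r x)) //= eqxx mul1r big1 ?addr0.
  by rewrite /hdev eq_sym.
by move=> s /negbTE; rewrite eq_sym => ->; rewrite mul0r.
Qed.

Let kappa x x' : R := \sum_(r : key) ((hash r x == hash r x')%:R - q).

Let quad (y : bits m -> R) := \sum_x \sum_x' kappa x x' * (y x * y x').

Lemma hash_quadE (y : bits m -> R) :
  \sum_r \sum_s (\sum_x hdev r s x * y x) ^+ 2 = quad y.
Proof.
under eq_bigr => r _ do under eq_bigr => s _ do
  (rewrite expr2 big_distrlr /=).
rewrite /quad.
under eq_bigr => r _ do rewrite exchange_big /=.
rewrite exchange_big /=; apply: eq_bigr => x _.
under eq_bigr => r _ do rewrite exchange_big /=.
rewrite exchange_big /=; apply: eq_bigr => x' _.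
rewrite /kappa mulr_suml; apply: eq_bigr => r _.
by rewrite -hdev_corr mulr_suml; apply: eq_bigr => s _; rewrite mulrACA.
Qed.

Lemma kappa_diag x : kappa x x <= K.
Proof.
rewrite /kappa /K -sumr_const -[leRHS]/(\sum_(r : key) 1) ; apply: ler_sum => r _.
by rewrite eqxx lerBlDr lerDl invr_ge0 exprn_ge0.
Qed.

(** Two-universality says exactly that the hash values of distinct strings are nonpositively
    correlated. *)
Lemma kappa_off x x' : x != x' -> kappa x x' <= 0.
Proof.
move=> /(@hash_two_universal _ _ h) H.
rewrite /kappa sumrB sumr_const -natr_sum -sum1_card -/K.
rewrite (_ : (\sum_(r : key) (hash r x == hash r x'))%N = #|[set r : key | hash r x == hash r x']|); last first.
  by rewrite -sum1dep_card [RHS]big_mkcond /=; apply: eq_bigr => r _; case: eqP.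
rewrite subr_le0 sum1_card -(mulr_natl q) ler_pdivlMr ?exprn_gt0 //.
by rewrite -natrX -natrM ler_nat.
Qed.

(* The Gram matrix kappa is positive with nonpositive off-diagonal entries; adding
   the form at |y| to the form at y leaves only the diagonal terms. *)
Lemma hash_quad_le (y : bits m -> R) :
  \sum_r \sum_s (\sum_x hdev r s x * y x) ^+ 2 <= 2 * K * \sum_x y x ^+ 2.
Proof.
rewrite hash_quadE.
have : 0 <= quad (fun x => `|y x|).
  by rewrite -hash_quadE; apply: sumr_ge0 => r _; apply: sumr_ge0 => s _; exact: sqr_ge0.
rewrite -(lerDl (quad y)) => /le_trans; apply.
rewrite /quad -big_split mulr_sumr /=; apply: ler_sum => x _.
rewrite -big_split (bigD1 x) //= -[leRHS]addr0; apply: lerD.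
  rewrite -normrM -expr2 ger0_norm ?sqr_ge0 // -mulr2n -[_ *+ 2]mulr_natl mulrA.
  by rewrite ler_wpM2r ?sqr_ge0 // ler_wpM2l // kappa_diag.
apply: sumr_le0 => x' /negbTE nx; rewrite -mulrDr.
apply: mulr_le0_ge0; first by rewrite kappa_off // eq_sym nx.
by rewrite -normrM -lerBlDl sub0r -normrN ler_norm.
Qed.

(** A bucket sum is its deviation plus the mean [q * Y]. The deviations cancel in the sum over [s],
    so the squares add up without a cross term. *)
Lemma hash_bucket_le (y : bits m -> R) :
  \sum_(r : key) \sum_s (\sum_x (hash r x == s)%:R * y x) ^+ 2 <=
  2 * K * \sum_x y x ^+ 2 + K * q * (\sum_x y x) ^+ 2.
Proof.
apply: le_trans (lerD (hash_quad_le y) (lexx _)); rewrite -lerBlDr.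
rewrite le_eqVlt; apply/orP; left; apply/eqP.
set Y := \sum_x y x.
have -> : K * q * Y ^+ 2 = \sum_(r : key) q * Y ^+ 2.
  by rewrite sumr_const -mulr_natl mulrA.
rewrite -sumrB; apply: eq_bigr => r _.
have aE s : \sum_x (hash r x == s)%:R * y x = \sum_x hdev r s x * y x + q * Y.
  rewrite /Y mulr_sumr -big_split /=; apply: eq_bigr => x _.
  by rewrite /hdev mulrBl subrK.
have S0 : \sum_s \sum_x hdev r s x * y x = 0.
  rewrite exchange_big big1 //= => x _.
  by rewrite -mulr_suml hdev_sum mul0r.
under eq_bigr => s _ do rewrite aE sqrrD -mulrnAr.
rewrite !big_split /= -mulr_suml S0 mul0r addr0 sum_bits_const.
rewrite (_ : 2 ^+ l * _ = q * Y ^+ 2) ?addrK //.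
by rewrite exprMn expr2 !mulrA divff ?mul1r // expf_neq0 ?pnatr_eq0.
Qed.

(** The keys are treated one at a time. The deviation in [r1] leaves squares of the bucket sums for
    [r0]; the mean part of the bucket bound produces the marginal of [x1]. Hence both the joint
    weights and the marginal of the tested string must be small. *)
Lemma hash_joint_leR (y : bits m -> bits m -> R) :
  \sum_(r0 : key) \sum_(r1 : key) \sum_s0 \sum_s1
    (\sum_x0 \sum_x1 (hash r0 x0 == s0)%:R * hdev r1 s1 x1 * y x0 x1) ^+ 2 <=
  K ^+ 2 * (4 * (\sum_x0 \sum_x1 y x0 x1 ^+ 2)
            + 2 * q * \sum_x1 (\sum_x0 y x0 x1) ^+ 2).
Proof.
pose z r0 s0 x1 := \sum_x0 (hash (h := h) r0 x0 == s0)%:R * y x0 x1.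
apply: (@le_trans _ _ (\sum_(r0 : key) \sum_s0 2 * K * \sum_x1 z r0 s0 x1 ^+ 2)).
  apply: ler_sum => r0 _; rewrite exchange_big /=; apply: ler_sum => s0 _.
  apply: le_trans (hash_quad_le _); apply: ler_sum => r1 _; apply: ler_sum => s1 _.
  rewrite le_eqVlt; apply/orP; left; apply/eqP; congr (_ ^+ 2).
  rewrite exchange_big; apply: eq_bigr => x1 _.
  by rewrite mulr_sumr; apply: eq_bigr => x0 _; rewrite mulrCA mulrA.
under eq_bigr => r0 _ do (rewrite -mulr_sumr exchange_big /=).
rewrite -mulr_sumr exchange_big /=.
apply: (@le_trans _ _ (2 * K * \sum_x1 (2 * K * \sum_x0 y x0 x1 ^+ 2 + K * q * (\sum_x0 y x0 x1) ^+ 2))).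
  rewrite ler_wpM2l ?mulr_ge0 ?ler0n //; apply: ler_sum => x1 _; exact: hash_bucket_le.
rewrite big_split /= -!mulr_sumr [in leLHS]exchange_big /=.
by rewrite le_eqVlt; apply/orP; left; apply/eqP; ring.
Qed.

Lemma sqn_sumR (I : finType) (c : I -> R) (y : I -> C) :
  sqn (\sum_i (c i)%:C * y i) =
  (\sum_i c i * complex.Re (y i)) ^+ 2 + (\sum_i c i * complex.Im (y i)) ^+ 2.
Proof.
have -> : \sum_i (c i)%:C * y i = (\sum_i c i * complex.Re (y i)) +i* (\sum_i c i * complex.Im (y i)).
  elim/big_rec3: _ => // i a b _ _ ->.
  by case: (y i) => u v /=; simpc.
by [].
Qed.

Lemma hash_joint_le (y : bits m -> bits m -> C) :
  \sum_(r0 : key) \sum_(r1 : key) \sum_s0 \sum_s1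
    sqn (\sum_x0 \sum_x1 ((hash r0 x0 == s0)%:R * hdev r1 s1 x1)%:C * y x0 x1) <=
  K ^+ 2 * (4 * (\sum_x0 \sum_x1 sqn (y x0 x1))
            + 2 * q * \sum_x1 sqn (\sum_x0 y x0 x1)).
Proof.
under eq_bigr => r0 _ do under eq_bigr => r1 _ do under eq_bigr => s0 _ do
  under eq_bigr => s1 _ do rewrite pair_bigA /= sqn_sumR
    -(pair_bigA _ (fun x0 x1 => ((hash r0 x0 == s0)%:R * hdev r1 s1 x1) * complex.Re (y x0 x1)))
    -(pair_bigA _ (fun x0 x1 => ((hash r0 x0 == s0)%:R * hdev r1 s1 x1) * complex.Im (y x0 x1))) /=.
under eq_bigr => r0 _ do (under eq_bigr => r1 _ do (under eq_bigr => s0 _ do rewrite big_split; rewrite big_split); rewrite big_split).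
rewrite big_split /=; apply: le_trans (lerD (hash_joint_leR _) (hash_joint_leR _)) _.
rewrite -mulrDr ler_wpM2l ?sqr_ge0 //.
rewrite addrACA -!mulrDr -!big_split /=.
under eq_bigr => x0 _ do rewrite -big_split /=.
rewrite lerD // ler_wpM2l ?mulr_ge0 ?invr_ge0 ?exprn_ge0 //.
by apply: ler_sum => x1 _; rewrite /sqn !raddf_sum.
Qed.


Lemma key_gt0 : 0 < K.
Proof. by rewrite ltr0n hash_key_gt0. Qed.

Lemma hash_single_le (y : bits m -> R) (t : R) : 0 < t ->
  \sum_(r : key) \sum_s `|\sum_x hdev r s x * y x| <=
  K * ((t * 2 ^+ l * 2 * \sum_x y x ^+ 2 + t^-1) / 2).
Proof.
move=> t0.
(* The weight [t * 2 ^+ l] makes the constant terms add up to [t^-1] over the [2^l] hash values. *)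
have am (u : R) : `|u| <= ((t * 2 ^+ l) * u ^+ 2 + (t * 2 ^+ l)^-1) / 2.
  have t1 : 0 < t * 2 ^+ l by rewrite mulr_gt0 ?exprn_gt0.
  set w := t * 2 ^+ l in t1 *.
  rewrite -real_normK ?num_real // -subr_ge0.
  rewrite (_ : _ - _ = (w * `|u| - 1) ^+ 2 / (2 * w)); last by field; rewrite gt_eqF.
  by rewrite divr_ge0 ?sqr_ge0 // mulr_ge0 // ltW.
apply: (le_trans (ler_sum _ (fun r _ => ler_sum _ (fun s _ => am _)))).
under eq_bigr => r _ do rewrite -mulr_suml big_split /= -mulr_sumr sum_bits_const.
rewrite -mulr_suml big_split /= -mulr_sumr mulrA ler_pM2r ?invr_gt0 //.
rewrite mulrDr; apply: lerD.
  apply: (le_trans (y := t * 2 ^+ l * (2 * K * \sum_x y x ^+ 2))).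
    by rewrite ler_wpM2l ?hash_quad_le // mulr_ge0 ?exprn_ge0 // ltW.
  by rewrite le_eqVlt; apply/orP; left; apply/eqP; ring.
rewrite sumr_const -(mulr_natl (_ * _)) invfM mulrCA.
have -> : #|(xpredT : pred key)| = #|key| by [].
by rewrite -/K (_ : 2 ^+ l * _ = K / t) //; field; rewrite gt_eqF //= expf_neq0 ?pnatr_eq0.
Qed.

End Hashing.

(** * Real analysis *)

Section Analysis.
Variable R : realType.

Lemma is_dD (f g : R -> R) (x a b : R) : is_derive x 1 f a -> is_derive x 1 g b ->
  is_derive x 1 (fun y => f y + g y) (a + b).
Proof. by move=> h1 h2; exact: is_deriveD. Qed.

Lemma is_dN (f : R -> R) (x a : R) : is_derive x 1 f a -> is_derive x 1 (fun y => - f y) (- a).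
Proof. by move=> h1; exact: is_deriveN. Qed.

Lemma is_dZ (k : R) (f : R -> R) (x a : R) : is_derive x 1 f a ->
  is_derive x 1 (fun y => k * f y) (k * a).
Proof. by move=> h1; exact: is_deriveZ. Qed.

Lemma is_dM (f g : R -> R) (x a b : R) : is_derive x 1 f a -> is_derive x 1 g b ->
  is_derive x 1 (fun y => f y * g y) (f x * b + g x * a).
Proof. by move=> h1 h2; exact: is_deriveM. Qed.

Lemma is_dX (n : nat) (x : R) : is_derive x 1 (fun y : R => y ^+ n) (n%:R * x ^+ n.-1).
Proof.
have := @is_deriveX R R (@id R) n x 1 1 (is_derive_id x 1).
by rewrite exprfctE /GRing.scale /= mulr1.
Qed.

Lemma is_dcomp (f g : R -> R) (x a b : R) : is_derive (g x) 1 f a -> is_derive x 1 g b ->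
  is_derive x 1 (fun y => f (g y)) (a * b).
Proof. exact: is_derive1_comp. Qed.

Lemma le_of_derive_ge0 (f df : R -> R) (b : R) : 0 <= b ->
  (forall x, 0 <= x <= b -> is_derive x 1 f (df x)) ->
  (forall x, 0 <= x <= b -> 0 <= df x) -> f 0 <= f b.
Proof.
move=> b0 hd hp.
have [x||c cab e] := @MVT_segment R f df 0 b b0.
- by rewrite in_itv /= => /andP[x0 xb]; apply: hd; rewrite !ltW.
- apply: derivable_within_continuous => x; rewrite in_itv /= => xab.
  by have [] := hd x xab.
by rewrite -subr_ge0 e subr0 mulr_ge0 // hp.
Qed.

Lemma expR_ge_quad (x : R) : 0 <= x -> 1 + x + x ^+ 2 / 2 <= expR x.
Proof.
move=> x0.
have := @le_of_derive_ge0 (fun y => expR y + - (y + 2^-1 * y ^+ 2))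
  (fun y => expR y + - (1 + 2^-1 * (2%:R * y ^+ 1))) x x0.
rewrite expR0 expr0n /= mulr0 addr0 subr0 => H.
have : 1 <= expR x - (x + 2^-1 * x ^+ 2).
  apply: H => y _; last by have := expR_ge1Dx y; rewrite expr1; lra.
  by apply: is_dD => //; apply: is_dN; apply: is_dD => //; apply: is_dZ; exact: is_dX.
lra.
Qed.

(** The lower bound on [e^t] is inverted by [(1 + t + t^2/2) (1 - t + t^2/2) = 1 + t^4/4]. *)
Lemma expRN_le_quad (t : R) : 0 <= t -> expR (- t) <= 1 - t + t ^+ 2 / 2.
Proof.
move=> t0; have := expR_ge_quad t0.
have q0 : 0 < 1 + t + t ^+ 2 / 2 by have := sqr_ge0 t; lra.
rewrite expRN => h; apply: (le_trans (y := (1 + t + t ^+ 2 / 2)^-1)).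
  by rewrite lef_pV2 ?posrE ?expR_gt0.
rewrite -div1r ler_pdivrMr // -subr_ge0.
by rewrite (_ : _ - _ = (t ^+ 2 / 2) ^+ 2) ?sqr_ge0 //; field.
Qed.

(** The estimate behind Hoeffding's inequality: [cosh x] times [e^(-x^2/2)] decreases because
    [tanh x <= x]. *)
Lemma expR_cosh_le (x : R) : 0 <= x -> expR x + expR (- x) <= 2 * expR (x ^+ 2 / 2).
Proof.
move=> x0.
have dN (y : R) : is_derive y 1 (fun y : R => expR (- y)) (- expR (- y)).
  by have := is_dcomp (is_derive_expR (- y)) (is_dN (is_derive_id y 1)); rewrite mulrN1.
have tanh (y : R) : 0 <= y -> 0 <= y * (expR y + expR (- y)) - (expR y - expR (- y)).
  move=> y0; have := @le_of_derive_ge0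
    (fun y => y * (expR y + expR (- y)) - (expR y - expR (- y)))
    (fun y => y * (expR y - expR (- y)) + (expR y + expR (- y)) * 1 - (expR y - - expR (- y))) y y0.
  rewrite mul0r oppr0 subrr subrr; apply => z /andP[z0 _].
    exact: (is_dD (is_dM (is_derive_id z 1) (is_dD (is_derive_expR z) (dN z)))
      (is_dN (is_dD (is_derive_expR z) (is_dN (dN z))))).
  rewrite mulr1 opprK addrK mulr_ge0 // subr_ge0 ler_expR; lra.
have := @le_of_derive_ge0
  (fun y => - ((expR y + expR (- y)) * expR (- (2^-1 * y ^+ 2))))
  (fun y => - ((expR y + expR (- y)) * (expR (- (2^-1 * y ^+ 2)) * - (2^-1 * (2%:R * y ^+ 1))) +
     expR (- (2^-1 * y ^+ 2)) * (expR y - expR (- y)))) x x0.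
rewrite expr0n /= mulr0 oppr0 expR0 mulr1 => H.
have {}H : -(1 + 1) <= - ((expR x + expR (- x)) * expR (- (2^-1 * x ^+ 2))).
  apply: H => y /andP[y0 _].
    have d3 := is_dcomp (is_derive_expR _) (is_dN (is_dZ 2^-1 (is_dX 2 y))).
    exact: (is_dN (is_dM (is_dD (is_derive_expR y) (dN y)) d3)).
  have := tanh y y0; have := expR_gt0 (- (2^-1 * y ^+ 2)).
  move: (expR (- _ )) (expR y) (expR (- y)) => e a b e0 h; rewrite expr1.
  by rewrite (_ : - _ = e * (y * (a + b) - (a - b))) ?mulr_ge0 // ?ltW //; field.
move: H; rewrite lerN2 (expRN (_ * _)) ler_pdivrMr ?expR_gt0 //.
by rewrite (mulrC 2^-1) (_ : 1 + 1 = 2).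
Qed.

(** Taylor polynomial of [- ln (1 - v)] at 0. *)
Definition logsum (M : nat) (v : R) : R := \sum_(k < M) k.+1%:R^-1 * v ^+ k.+1.

Lemma is_derive_logsum M (v : R) : is_derive v 1 (logsum M) (\sum_(k < M) v ^+ k).
Proof.
elim: M => [|M IH].
  rewrite big_ord0 (_ : logsum 0 = cst 0); first exact: is_derive_cst.
  by apply/funext => x; rewrite /logsum big_ord0.
rewrite big_ord_recr /= (_ : logsum M.+1 = (fun x => logsum M x + M.+1%:R^-1 * x ^+ M.+1)).
  apply: is_dD => //; apply: is_derive_eq; first by apply: is_dZ; exact: is_dX.
  by rewrite mulrA mulVf ?mul1r // pnatr_eq0.
by apply/funext => x; rewrite /logsum big_ord_recr.
Qed.

Lemma is_derive_ln1B (v : R) : v < 1 -> is_derive v 1 (fun x : R => ln (1 - x)) (- (1 - v)^-1).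
Proof.
move=> v1.
have h : is_derive (1 - v) 1 (@ln R) (1 - v)^-1 by apply: is_derive1_ln; rewrite subr_gt0.
have h2 : is_derive v 1 (cst 1 : R -> R) 0 by exact: is_derive_cst.
have := is_dcomp (g := fun x => 1 - x) h (is_dD h2 (is_dN (is_derive_id v 1))).
by rewrite add0r mulrN1.
Qed.

Lemma logsum0 M : logsum M 0 = 0.
Proof. by rewrite /logsum big1 // => i _; rewrite expr0n mulr0. Qed.

Lemma logsum_le (M : nat) (v : R) : 0 <= v < 1 -> logsum M v <= - ln (1 - v).
Proof.
move=> /andP[v0 v1].
have := @le_of_derive_ge0 (fun x => - ln (1 - x) - logsum M x)
  (fun x => - - (1 - x)^-1 - \sum_(k < M) x ^+ k) v v0.
rewrite subr0 ln1 oppr0 logsum0 subr0 subr_ge0; apply => x /andP[x0 xv].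
  apply: is_dD; last by apply: is_dN; exact: is_derive_logsum.
  by apply: is_dN; apply: is_derive_ln1B; apply: le_lt_trans v1.
have x1 : 0 < 1 - x by rewrite subr_gt0 (le_lt_trans xv).
rewrite opprK subr_ge0 -div1r ler_pdivlMr // mulrC -opprB mulNr -subrX1 opprB.
by rewrite gerBl exprn_ge0.
Qed.

(** The derivative of the remainder is [x^M / (1 - x)], at most [2 * 2^-M] on the interval from 0 to
    1/2. *)
Lemma logsum_half (M : nat) : ln 2 <= logsum M 2^-1 + 2 ^- M :> R.
Proof.
have := @le_of_derive_ge0 (fun x => logsum M x + 2 * 2 ^- M * x + ln (1 - x))
  (fun x => \sum_(k < M) x ^+ k + 2 * 2 ^- M * 1 - (1 - x)^-1) 2^-1 _.
rewrite logsum0 mulr0 subr0 ln1 !addr0 => H.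
have {}H : 0 <= logsum M 2^-1 + 2 * 2 ^- M * 2^-1 + ln (1 - 2^-1) :> R.
  apply: H => [|x /andP[x0 xh]|x /andP[x0 xh]]; first by rewrite invr_ge0.
    apply: is_dD; last by apply: is_derive_ln1B; lra.
    exact: (is_dD (is_derive_logsum M x) (is_dZ _ (is_derive_id x 1))).
  have x1 : 0 < 1 - x by lra.
  rewrite subr_ge0 -div1r ler_pdivrMr // mulrDl mulr1.
  have -> : (\sum_(k < M) x ^+ k) * (1 - x) = 1 - x ^+ M.
    by rewrite mulrC -opprB mulNr -subrX1 opprB.
  have xM : x ^+ M <= 2 ^- M by rewrite -exprVn lerXn2r ?nnegrE ?invr_ge0.
  have M0 : 0 <= 2 ^- M :> R by rewrite invr_ge0 exprn_ge0.
  nra.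
move: H; rewrite (_ : 1 - 2^-1 = 2^-1); last by field.
by rewrite lnV ?posrE // mulrAC divff ?pnatr_eq0 ?mul1r // subr_ge0.
Qed.

(** Induction through Chebyshev's inequality [(u - v) (u^k - v^k) >= 0]. *)
Lemma sum_powers_ge (u v : R) k : 0 <= u -> 0 <= v -> u + v = 1 ->
  2 * 2 ^- k <= u ^+ k + v ^+ k.
Proof.
move=> u0 v0 uv; elim: k => [|k IH]; first by rewrite expr0 invr1 !expr0 mulr1.
have : 0 <= (u - v) * (u ^+ k - v ^+ k).
  have [uv'|vu] := leP u v.
    by rewrite mulr_le0 ?subr_le0 // lerXn2r.
  by rewrite mulr_ge0 // subr_ge0 ?lerXn2r // ltW.
move: IH; rewrite !exprS invfM mulrCA; move: (u ^+ k) (v ^+ k) (2 ^- k) => a b c.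
have -> : v = 1 - u by lra.
nra.
Qed.

(** Replaces the passage to the limit in the order of a Taylor polynomial. *)
Lemma le_of_le_exp2 (a b c : R) : (forall M, b - c * 2 ^- M <= a) -> b <= a.
Proof.
move=> H; rewrite leNgt; apply/negP => ab.
have [M hM] : exists M : nat, `|c| < (b - a) * 2 ^+ M.
  exists (Num.bound (`|c| / (b - a))).
  set M := Num.bound _.
  have d0 : 0 < b - a by rewrite subr_gt0.
  rewrite mulrC -ltr_pdivrMr //; apply: (@lt_trans _ _ M%:R).
    by apply: archi_boundP; rewrite divr_ge0 // ltW.
  by rewrite -natrX ltr_nat ltn_expl.
have := H M; rewrite leNgt => /negP; apply.
have p0 : 0 < 2 ^+ M :> R by rewrite exprn_gt0.
rewrite ltrBrDl -ltrBrDr -ltr_pdivlMr ?invr_gt0 // invrK.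
exact: le_lt_trans (ler_norm _) hM.
Qed.

(* Both logarithms are expanded in their (positive) Taylor series at 1, and the
   resulting u^k + v^k are bounded by their value at u = v = 1/2. *)
Lemma binary_entropy_ge (u v : R) : 0 < u -> 0 < v -> u + v = 1 ->
  4 * (u * v) * ln 2 <= - (u * ln u) - v * ln v.
Proof.
move=> u0 v0 uv; apply: (@le_of_le_exp2 _ _ (4 * (u * v))) => M.
have hu : logsum M v <= - ln u by rewrite (_ : u = 1 - v); [apply: logsum_le; lra|lra].
have hv : logsum M u <= - ln v by rewrite (_ : v = 1 - u); [apply: logsum_le; lra|lra].
apply: (@le_trans _ _ (u * logsum M v + v * logsum M u)); last first.
  by rewrite -!mulrN lerD // ler_pM2l.
apply: (@le_trans _ _ (4 * (u * v) * logsum M 2^-1)).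
  have := logsum_half M; rewrite -mulrBr ler_pM2l ?mulr_gt0 //; lra.
rewrite /logsum !mulr_sumr -big_split /=; apply: ler_sum => k _.
have := sum_powers_ge k (ltW u0) (ltW v0) uv.
rewrite !exprS exprVn => h.
have : 0 <= k.+1%:R^-1 :> R by rewrite invr_ge0.
move: k.+1%:R^-1 (2 ^- k) h => a c h a0.
rewrite (_ : 4 * _ * _ = (u * v) * (a * (2 * c))); last by field.
rewrite (_ : u * _ + v * _ = (u * v) * (a * (u ^+ k + v ^+ k))); last by ring.
by apply: ler_wpM2l; [rewrite mulr_ge0 // ltW | exact: ler_wpM2l].
Qed.

(** For [q = e^(-t)] this is [t <= e^(t/2)], which follows from [1 + t/2 + t^2/8 >= t]. *)
Lemma mul_sqr_ln_le (q : R) : 0 < q <= 1 -> q * ln q ^+ 2 <= 1.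
Proof.
move=> /andP[q0 q1].
have t0 : 0 <= - ln q by rewrite oppr_ge0 ln_le0.
set t := - ln q in t0.
have -> : ln q ^+ 2 = t ^+ 2 by rewrite /t sqrrN.
have -> : q = expR (- t) by rewrite /t opprK lnK.
rewrite expRN mulrC ler_pdivrMr ?expR_gt0 // mul1r.
have h : 1 + t / 2 + (t / 2) ^+ 2 / 2 <= expR (t / 2) by rewrite expR_ge_quad // divr_ge0.
have -> : expR t = expR (t / 2) ^+ 2 by rewrite -expRM_natr divfK ?pnatr_eq0.
rewrite lerXn2r ?nnegrE ?expR_ge0 //; apply: le_trans h.
have := sqr_ge0 (t - 2); rewrite -subr_ge0 sqrrB; nra.
Qed.

(** Second-order expansion of [q e^(s ln q)]. Bounding [q ln^2 q] uniformly makes the error in [s]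
    independent of the distribution. *)
Lemma powR_1D_le (q s : R) : 0 <= q <= 1 -> 0 < s ->
  q `^ (1 + s) <= q + s * (q * ln q) + s ^+ 2 / 2.
Proof.
move=> /andP[q0 q1] s0.
have [->|qn] := eqVneq q 0.
  by rewrite powR0 ?gt_eqF ?addr_gt0 // mul0r mulr0 !add0r divr_ge0 ?sqr_ge0.
have qp : 0 < q by rewrite lt0r qn.
rewrite powRD ?(negbTE qn) ?implybT // powRr1 // /powR (negbTE qn).
have t0 : 0 <= - (s * ln q) by rewrite -mulrN mulr_ge0 ?oppr_ge0 ?ln_le0 // ltW.
have := expRN_le_quad t0; rewrite opprK sqrrN => h.
apply: (le_trans (ler_wpM2l q0 h)).
have := @mul_sqr_ln_le q; rewrite qp q1 => /(_ isT) h2.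
have : s ^+ 2 / 2 * (q * ln q ^+ 2) <= s ^+ 2 / 2 * 1 by rewrite ler_wpM2l ?divr_ge0 ?sqr_ge0.
rewrite mulr1; lra.
Qed.

(** The first-order term is [- s] times the binary entropy. Its quadratic minorant [4 u v ln 2] is
    the quantity that a constraint on the Bloch vector controls. *)
Lemma powR_1D_pair_le (u v s : R) : 0 <= u -> 0 <= v -> u + v = 1 -> 0 < s ->
  u `^ (1 + s) + v `^ (1 + s) <= 1 - 4 * (u * v) * (s * ln 2) + s ^+ 2.
Proof.
move=> u0 v0 uv s0.
have uu := @powR_1D_le u s; have vv := @powR_1D_le v s.
have {}uu : u `^ (1 + s) <= u + s * (u * ln u) + s ^+ 2 / 2 by apply: uu => //; lra.
have {}vv : v `^ (1 + s) <= v + s * (v * ln v) + s ^+ 2 / 2 by apply: vv => //; lra.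
have : 4 * (u * v) * ln 2 <= - (u * ln u) - v * ln v.
  have [eu|un] := eqVneq u 0; first by have -> : v = 1 by [lra]; rewrite eu ln1; lra.
  have [ev|vn] := eqVneq v 0; first by have -> : u = 1 by [lra]; rewrite ev ln1; lra.
  by apply: binary_entropy_ge; rewrite ?lt0r ?un ?vn.
rewrite -(ler_pM2l s0); lra.
Qed.

End Analysis.

(** * The uncertainty relation *)

Section BitStrings.

Definition upd N (x : bits N) (j : 'I_N) (b : bool) : bits N :=
  [ffun i => if i == j then b else x i].

Lemma upd_id N (x : bits N) j : upd x j (x j) = x.
Proof. by apply/ffunP => i; rewrite ffunE; case: eqP => [->|]. Qed.

Lemma upd_upd N (x : bits N) j b c : upd (upd x j b) j c = upd x j c.
Proof. by apply/ffunP => i; rewrite !ffunE; case: eqP. Qed.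

Lemma sum_upd (V : nmodType) N (j : 'I_N) (F : bits N -> V) :
  \sum_x \sum_(b : bool) F (upd x j b) = (\sum_x F x) *+ 2.
Proof.
pose flip (x : bits N) := upd x j (~~ x j).
have flipK : involutive flip.
  by move=> x; rewrite /flip upd_upd ffunE eqxx negbK upd_id.
rewrite mulr2n [X in _ + X](reindex_inj (inv_inj flipK)) -big_split /=.
apply: eq_bigr => x _; rewrite /flip big_bool.
by rewrite -{3}(upd_id x j); case: (x j) => //=; rewrite addrC.
Qed.

Lemma upd_invariant (T : Type) N (P : pred 'I_N) (F : bits N -> T) :
  (forall x j b, P j -> F (upd x j b) = F x) ->
  forall x y : bits N, (forall j, ~~ P j -> x j = y j) -> F x = F y.
Proof.
move=> H x y xy.
pose z (s : seq 'I_N) : bits N := [ffun j => if j \in s then y j else x j].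
have zF s : F (z s) = F x.
  elim: s => [|j s IH]; first by congr F; apply/ffunP => j; rewrite ffunE.
  rewrite -IH; have [Pj|nPj] := boolP (P j).
    rewrite (_ : z (j :: s) = upd (z s) j (y j)) ?H //.
    by apply/ffunP => i; rewrite !ffunE inE; case: eqP => [->|].
  congr F; apply/ffunP => i; rewrite !ffunE inE.
  by case: eqP => [->|] //=; rewrite (xy _ nPj) if_same.
rewrite -(zF (enum 'I_N)); congr F; apply/ffunP => j.
by rewrite ffunE mem_enum.
Qed.

Definition bcons n (b : bool) (x : bits n) : bits n.+1 :=
  [ffun i => if unlift ord0 i is Some j then x j else b].

Definition btail n (x : bits n.+1) : bits n := [ffun j => x (lift ord0 j)].

Lemma bcons_btail n (x : bits n.+1) : bcons (x ord0) (btail x) = x.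
Proof. by apply/ffunP => i; rewrite ffunE; case: unliftP => [j ->|->]; rewrite ?ffunE. Qed.

Lemma btail_bcons n b (x : bits n) : btail (bcons b x) = x.
Proof. by apply/ffunP => i; rewrite !ffunE liftK. Qed.

Lemma sum_bcons (V : nmodType) n (F : bits n.+1 -> V) :
  \sum_x F x = \sum_(b : bool) \sum_x F (bcons b x).
Proof.
rewrite pair_bigA /= (reindex (fun q : bool * bits n => bcons q.1 q.2)) //=.
exists (fun x : bits n.+1 => (x ord0, btail x)) => [[b x] _|x _] /=.
  by rewrite btail_bcons ffunE unlift_none.
exact: bcons_btail.
Qed.

Lemma upd_bcons0 n b c (x : bits n) : upd (bcons b x) ord0 c = bcons c x.
Proof. by apply/ffunP => i; rewrite !ffunE; case: unliftP => [j ->|->]. Qed.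

Lemma upd_bcons n b c (x : bits n) j : upd (bcons b x) (lift ord0 j) c = bcons b (upd x j c).
Proof.
apply/ffunP => i; rewrite !ffunE; case: unliftP => [k ->|->]; last by rewrite eq_liftF.
by rewrite !ffunE (inj_eq lift_inj).
Qed.

End BitStrings.

Section Uncertainty.
Variable R : realType.
Local Notation C := R[i].

(* t b theta is the weight of outcome b when a qubit in a fixed (unnormalised)
   state is measured in basis theta: the last clause bounds the length of the
   projection of its Bloch vector on the x-z plane. *)
Definition site (t : bool -> bool -> R) : Prop :=
  [/\ forall b theta, 0 <= t b theta,
      t false false + t true false = t false true + t true true
    & (t false false - t true false) ^+ 2 + (t false true - t true true) ^+ 2 <=
      (t false false + t true false) ^+ 2].

Lemma site0 : site (fun _ _ => 0).
Proof. by split=> //; rewrite subrr addr0 expr0n /= addr0. Qed.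

Lemma siteD t t' : site t -> site t' -> site (fun b theta => t b theta + t' b theta).
Proof.
move=> [p e h] [p' e' h']; split=> [b th||]; first by rewrite addr_ge0.
  by rewrite addrACA e e' addrACA.
move: h h' (p false false) (p true false) (p' false false) (p' true false).
move: (t false false) (t true false) (t false true) (t true true) => a0 a1 a2 a3.
move: (t' false false) (t' true false) (t' false true) (t' true true) => b0 b1 b2 b3.
move=> h h' p0 p1 p0' p1'.
have k1 : (a0 - a1) * (b0 - b1) + (a2 - a3) * (b2 - b3) <= (a0 + a1) * (b0 + b1).
  apply: ler_sqr_bound; first by rewrite mulr_ge0 ?addr_ge0.
  rewrite exprMn; apply: (@le_trans _ _ (((a0 - a1) ^+ 2 + (a2 - a3) ^+ 2) * ((b0 - b1) ^+ 2 + (b2 - b3) ^+ 2))).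
    by rewrite -subr_ge0 (_ : _ - _ = ((a0 - a1) * (b2 - b3) - (a2 - a3) * (b0 - b1)) ^+ 2) ?sqr_ge0 //; ring.
  by apply: ler_pM => //; rewrite addr_ge0 ?sqr_ge0.
rewrite -subr_ge0.
rewrite (_ : _ - _ = ((a0 + a1) ^+ 2 - ((a0 - a1) ^+ 2 + (a2 - a3) ^+ 2)) +
  ((b0 + b1) ^+ 2 - ((b0 - b1) ^+ 2 + (b2 - b3) ^+ 2)) +
  2 * ((a0 + a1) * (b0 + b1) - ((a0 - a1) * (b0 - b1) + (a2 - a3) * (b2 - b3)))); last by ring.
by apply: addr_ge0; [apply: addr_ge0; rewrite subr_ge0 | rewrite mulr_ge0 // subr_ge0].
Qed.

Lemma site_sum (I : Type) (r : seq I) (P : pred I) (t : I -> bool -> bool -> R) :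
  (forall i, P i -> site (t i)) -> site (fun b theta => \sum_(i <- r | P i) t i b theta).
Proof.
move=> h; elim: r => [|i r IH].
  have -> : (fun b theta => \sum_(i <- [::] | P i) t i b theta) = fun _ _ => 0.
    by apply/funext => b; apply/funext => th; rewrite big_nil.
  exact: site0.
have [Pi|nPi] := boolP (P i).
  have -> : (fun b theta => \sum_(j <- i :: r | P j) t j b theta) =
            fun b theta => t i b theta + \sum_(j <- r | P j) t j b theta.
    by apply/funext => b; apply/funext => th; rewrite big_cons Pi.
  by apply: siteD => //; exact: h.
have -> // : (fun b theta => \sum_(j <- i :: r | P j) t j b theta) =
          fun b theta => \sum_(j <- r | P j) t j b theta.
by apply/funext => b; apply/funext => th; rewrite big_cons (negbTE nPi).
Qed.

Lemma siteZ (a : R) t : 0 <= a -> site t -> site (fun b theta => a * t b theta).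
Proof.
move=> a0 [p e h]; split=> [b th||]; first by rewrite mulr_ge0.
  by rewrite -!mulrDr e.
by rewrite -!mulrBr -mulrDr !exprMn -mulrDr ler_wpM2l ?sqr_ge0.
Qed.

Lemma sqn_sqrt2 : sqn (sqrtC 2 : C)^-1 = 2^-1.
Proof.
apply: complexI; rewrite sqnE.
rewrite fmorphV /= conj_Creal ?ger0_real ?sqrtC_ge0 // -invfM -expr2 sqrtCK.
by rewrite fmorphV rmorphD rmorph1.
Qed.

(** For a pure state the slack in the last clause is the square of the y component of the Bloch
    vector, the one that neither basis measures. *)
Lemma site_qubitC (z w : C) :
  site (fun b theta => sqn (qubit R b theta 0 0 * z + qubit R b theta 1 0 * w)).
Proof.
have e0 : sqn (qubit R false false 0 0 * z + qubit R false false 1 0 * w) = sqn z.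
  by rewrite !mxE /= mul1r mul0r addr0.
have e1 : sqn (qubit R true false 0 0 * z + qubit R true false 1 0 * w) = sqn w.
  by rewrite !mxE /= mul1r mul0r add0r.
have e2 : sqn (qubit R false true 0 0 * z + qubit R false true 1 0 * w) = sqn (z + w) / 2.
  by rewrite !mxE /= expr0 mul1r -mulrDr sqnM sqn_sqrt2 mulrC.
have e3 : sqn (qubit R true true 0 0 * z + qubit R true true 1 0 * w) = sqn (z - w) / 2.
  by rewrite !mxE /= expr0 expr1 mulN1r mulNr mul1r -mulrBr sqnM sqn_sqrt2 mulrC.
split=> [b th||]; rewrite ?sqn_ge0 // e0 e1 e2 e3; case: (z) (w) => [a b] [c d]; rewrite /sqn /=.
  by field.
rewrite -subr_ge0.
by rewrite (_ : _ - _ = (2 * (a * d - b * c)) ^+ 2) ?sqr_ge0 //; field.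
Qed.

Lemma site_qubit p q (v w : 'M[C]_(p, q)) :
  site (fun b theta => fn (qubit R b theta 0 0 *: v + qubit R b theta 1 0 *: w)).
Proof.
have -> : (fun b theta => fn (qubit R b theta 0 0 *: v + qubit R b theta 1 0 *: w)) =
  fun b theta => \sum_i \sum_j sqn (qubit R b theta 0 0 * v i j + qubit R b theta 1 0 * w i j).
  apply/funext => b; apply/funext => th; apply: eq_bigr => i _; apply: eq_bigr => j _.
  by rewrite !mxE.
by apply: site_sum => i _; apply: site_sum => j _; exact: site_qubitC.
Qed.

(* For a normalised site, unc s bounds the sum over both bases and both outcomes
   of the (1+s)-th powers of the probabilities, 0 < s. *)
Definition unc (s : R) : R := 2 - s * ln 2 + 2 * s ^+ 2.

Lemma ln2_le1 : ln 2 <= 1 :> R.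
Proof. by have := @le_ln1Dx R 1; rewrite (_ : 1 + 1 = 2) //; apply; lra. Qed.

Lemma unc_ge0 s : 0 <= s -> 0 <= unc s.
Proof. by move=> s0; have := ln2_le1; rewrite /unc; nra. Qed.

(** By homogeneity the weights may be normalised. Since [4 u v = 1 - (u - v)^2], the Bloch
    constraint says that these terms add up to at least 1 over the two bases. *)
Lemma site_powR t s : site t -> 0 < s ->
  \sum_(theta : bool) \sum_(b : bool) t b theta `^ (1 + s) <=
  unc s * (t false false + t true false) `^ (1 + s).
Proof.
move=> [p e h] s0; rewrite !big_bool /=.
have s1 : 1 + s != 0 by rewrite gt_eqF ?addr_gt0.
have p00 := p false false; have p10 := p true false.
have p01 := p false true; have p11 := p true true.
have [T0|Tn] := eqVneq (t false false + t true false) 0.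
  have [-> ->] : t false false = 0 /\ t true false = 0 by split; lra.
  have [-> ->] : t false true = 0 /\ t true true = 0 by split; lra.
  by rewrite addr0 powR0 // !addr0 mulr0.
have Tp : 0 < t false false + t true false by rewrite lt0r Tn addr_ge0.
set T := t false false + t true false in e h Tn Tp *.
pose u th := t false th / T; pose v th := t true th / T.
have tu th : t false th = T * u th by rewrite mulrC divfK.
have tv th : t true th = T * v th by rewrite mulrC divfK.
have u0 th : 0 <= u th by rewrite divr_ge0 // ltW.
have v0 th : 0 <= v th by rewrite divr_ge0 // ltW.
have uv th : u th + v th = 1.
  by rewrite -mulrDl; case: th; rewrite -?e -/T divff.
have H th := powR_1D_pair_le (u0 th) (v0 th) (uv th) s0.
have Hf := H false; have Ht := H true.
have tuE th : t false th `^ (1 + s) = T `^ (1 + s) * u th `^ (1 + s) by rewrite tu powRM // ltW.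
have tvE th : t true th `^ (1 + s) = T `^ (1 + s) * v th `^ (1 + s) by rewrite tv powRM // ltW.
rewrite (tuE false) (tuE true) (tvE false) (tvE true) -!mulrDr mulrC ler_wpM2r ?powR_ge0 //.
have hB : (u false - v false) ^+ 2 + (u true - v true) ^+ 2 <= 1.
  rewrite -(ler_pM2l (exprn_gt0 2 Tp)) mulr1 mulrDr -!exprMn !mulrBr -!tu -!tv //.
have l2 : 0 <= ln 2 :> R by rewrite ln_ge0 // ler1n.
have hc : 1 <= 4 * (u false * v false) + 4 * (u true * v true).
  have := uv false; have := uv true; move: hB.
  move: (u false) (v false) (u true) (v true) => a b c d hB e1 e2.
  have -> : b = 1 - a by lra. have -> : d = 1 - c by lra.
  move: hB; have -> : b = 1 - a by lra. have -> : d = 1 - c by lra. nra.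
have : 1 * (s * ln 2) <= (4 * (u false * v false) + 4 * (u true * v true)) * (s * ln 2).
  by rewrite ler_wpM2r // mulr_ge0 // ltW.
rewrite /unc; lra.
Qed.

(** No signalling: the second clause of [site] changes the bases one position at a time. *)
Lemma mass_indep n (p : bits n -> bits n -> R) :
  (forall x theta j, site (fun b tau => p (upd x j b) (upd theta j tau))) ->
  forall theta theta', \sum_x p x theta = \sum_x p x theta'.
Proof.
move=> hp theta theta'.
apply: (@upd_invariant _ _ predT (fun th => \sum_x p x th)) => // {theta theta'} theta j tau _.
have H ta : (\sum_x p x (upd theta j ta)) *+ 2 = \sum_x (p (upd x j false) (upd theta j false) + p (upd x j true) (upd theta j false)).
  rewrite -(sum_upd j (fun x => p x (upd theta j ta))); apply: eq_bigr => x _; rewrite big_bool /=.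
  by have [_ e _] := hp x theta j; case: ta; rewrite ?e addrC.
have : (\sum_x p x (upd theta j tau)) *+ 2 = (\sum_x p x theta) *+ 2.
  by rewrite -{2}(upd_id theta j) !H.
by move/eqP; rewrite eqrMn2r // => /eqP.
Qed.

(** Induction on the number of qubits, without any independence between them. For a fixed first bit
    and basis the remaining weights satisfy the same hypothesis, and their totals, being sums of
    sites, form a site in the first coordinate. Taking [(1+s)]-th powers makes the two bounds
    multiply. *)
Lemma uncertainty_powR n (p : bits n -> bits n -> R) (s : R) (theta0 : bits n) : 0 < s ->
  (forall x theta j, site (fun b tau => p (upd x j b) (upd theta j tau))) ->
  \sum_theta \sum_x p x theta `^ (1 + s) <= unc s ^+ n * (\sum_x p x theta0) `^ (1 + s).
Proof.
move=> s0; elim: n p theta0 => [|n IH] p theta0 hp.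
  have all1 (x : bits 0) : x = theta0 by apply/ffunP => -[].
  have sum1 (F : bits 0 -> R) : \sum_x F x = F theta0.
    by rewrite (bigD1 theta0) //= big1 ?addr0 // => x; rewrite (all1 x) eqxx.
  by rewrite !sum1 expr0 mul1r.
rewrite sum_bcons; set th0 := btail theta0.
apply: (@le_trans _ _ (\sum_(tau : bool) \sum_(b : bool) unc s ^+ n *
   (\sum_x p (bcons b x) (bcons tau th0)) `^ (1 + s))).
  apply: ler_sum => tau _; under eq_bigr => theta _ do rewrite sum_bcons.
  rewrite exchange_big /=; apply: ler_sum => b _.
  apply: (IH (fun x theta => p (bcons b x) (bcons tau theta))) => x theta j.
  have := hp (bcons b x) (bcons tau theta) (lift ord0 j).
  by congr site; apply/funext => c; apply/funext => ta; rewrite !upd_bcons.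
under eq_bigr => tau _ do rewrite -mulr_sumr.
rewrite -mulr_sumr exprSr -mulrA; apply: ler_wpM2l; first by rewrite exprn_ge0 // unc_ge0 // ltW.
pose t b tau := \sum_x p (bcons b x) (bcons tau th0).
have st : site t.
  apply: site_sum => x _; have := hp (bcons false x) (bcons false th0) ord0.
  by congr site; apply/funext => c; apply/funext => ta; rewrite !upd_bcons0.
have e0 : t false false + t true false = \sum_x p x theta0.
  have -> : \sum_x p x theta0 = \sum_(b : bool) t b (theta0 ord0).
    by rewrite sum_bcons; apply: eq_bigr => b _; rewrite /t /th0 bcons_btail.
  by rewrite big_bool /= addrC; have [_ e _] := st; case: (theta0 ord0); rewrite // e addrC.
by have := site_powR st s0; rewrite e0.
Qed.

Lemma uncertainty n (p : bits n -> bits n -> R) (s beta : R) (theta0 : bits n) :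
  0 < s -> 0 < beta ->
  (forall x theta, 0 <= p x theta) ->
  (forall x theta j, site (fun b tau => p (upd x j b) (upd theta j tau))) ->
  \sum_theta \sum_x (beta * (\sum_y p y theta0) < p x theta)%R%:R * p x theta <=
  unc s ^+ n * beta `^ (- s) * \sum_x p x theta0.
Proof.
move=> s0 b0 p0 hp; set T := \sum_x p x theta0.
have T0 : 0 <= T by apply: sumr_ge0.
have [T00|Tn] := eqVneq T 0.
  rewrite T00 !mulr0 big1 // => theta _; rewrite big1 // => x _.
  suff -> : p x theta = 0 by rewrite mulr0.
  have := mass_indep hp theta theta0; rewrite -/T T00 => /eqP.
  by rewrite psumr_eq0 // => /allP/(_ x (mem_index_enum x))/eqP.
have Tp : 0 < T by rewrite lt0r Tn.
have bT : 0 < beta * T by rewrite mulr_gt0.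
have key : forall x theta, (beta * T < p x theta)%R%:R * p x theta <= (beta * T) `^ (- s) * p x theta `^ (1 + s).
  move=> x theta; case: ltP => /= h; last by rewrite mul0r mulr_ge0 ?powR_ge0.
  have pp : 0 < p x theta by apply: lt_trans h.
  rewrite mul1r powRD ?(gt_eqF pp) ?implybT // (powRr1 (ltW pp)) powRN mulrCA -[leLHS]mulr1.
  rewrite ler_pM2l // mulrC ler_pdivlMr ?powR_gt0 // mul1r.
  by apply: (ge0_ler_powR (ltW s0)); rewrite ?nnegrE ltW.
apply: (le_trans (ler_sum _ (fun theta _ => ler_sum _ (fun x _ => key x theta)))).
under eq_bigr => theta _ do rewrite -mulr_sumr.
rewrite -mulr_sumr.
apply: (le_trans (ler_wpM2l (powR_ge0 _ _) (uncertainty_powR theta0 s0 hp))).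
rewrite -/T (powRM _ (ltW b0) (ltW Tp)) powRD ?(gt_eqF Tp) ?implybT // powRr1 // (powRN T).
have : T `^ s != 0 by rewrite gt_eqF ?powR_gt0.
move: (T `^ s) (beta `^ (- s)) (unc s ^+ n) => a b c an.
by rewrite le_eqVlt; apply/orP; left; apply/eqP; field.
Qed.

End Uncertainty.

(** * Substrings and the choice of the index sets *)

Section Restriction.

(** The constraint is itself a product over coordinates, so sum and product may be exchanged. *)
Lemma sum_prod_constrained (V : comPzRingType) N (J : finType) (e : J -> 'I_N) (u : bool -> V)
    (y : J -> bool) : injective e ->
  \sum_(x : bits N) (\prod_i u (x i)) * [forall j, x (e j) == y j]%:R =
  (\prod_j u (y j)) * (\sum_b u b) ^+ (N - #|J|).
Proof.
move=> ie; pose ok (i : 'I_N) (b : bool) : V := [forall j, (e j == i) ==> (b == y j)]%:R.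
transitivity (\sum_(x : bits N) \prod_i (u (x i) * ok i (x i))).
  apply: eq_bigr => x _; rewrite big_split /=; congr (_ * _).
  have [/forallP H|/forallPn[j nj]] := boolP [forall j, x (e j) == y j].
    rewrite big1 // => i _; rewrite /ok (_ : [forall j, _]) //.
    by apply/forallP => j; apply/implyP => /eqP <-.
  rewrite (bigD1 (e j)) //= {1}/ok (_ : [forall j0, _] = false) ?mul0r //.
  by apply/negbTE/forallPn; exists j; rewrite eqxx.
rewrite -(bigA_distr_bigA (fun i b => u b * ok i b)).
rewrite (bigID (mem (e @: setT))) /=; congr (_ * _).
  rewrite big_imset /=; last by move=> ? ? _ _ /ie.
  rewrite (eq_bigl xpredT); last by move=> j; rewrite inE.
  apply: eq_bigr => j _; rewrite (bigD1 (y j)) //= big1 ?addr0 => [|b /negbTE nb].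
    rewrite /ok (_ : [forall j0, _]) ?mulr1 //.
    by apply/forallP => k; apply/implyP => /eqP/ie ->.
  rewrite /ok (_ : [forall j0, _] = false) ?mulr0 //.
  by apply/negbTE/forallPn; exists j; rewrite eqxx nb.
rewrite (eq_bigr (fun=> \sum_b u b)) => [|i /negP ni].
  rewrite prodr_const; congr (_ ^+ _).
  rewrite (_ : #|_| = #|~: (e @: [set: J])|); last by apply: eq_card => i; rewrite !inE.
  by rewrite cardsCs setCK card_ord card_imset // cardsT.
apply: eq_bigr => b _; rewrite /ok (_ : [forall j, _]) ?mulr1 //.
by apply/forallP => j; apply/implyP => /eqP ej; case: ni; apply/imsetP; exists j.
Qed.

Definition pos N k (J : {set 'I_N}) (hJ : #|J| = k) (j : 'I_k) : 'I_N :=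
  enum_val (cast_ord (esym hJ) j).

Lemma pos_inj N k (J : {set 'I_N}) (hJ : #|J| = k) : injective (pos hJ).
Proof. by move=> i j /enum_val_inj/cast_ord_inj. Qed.

Lemma pos_in N k (J : {set 'I_N}) (hJ : #|J| = k) j : pos hJ j \in J.
Proof. exact: enum_valP. Qed.

Lemma restrE N k (J : {set 'I_N}) (hJ : #|J| = k) (x : bits N) j :
  restr k J x j = x (pos hJ j).
Proof.
rewrite ffunE (nth_map (pos hJ j)) -?cardE ?hJ //; congr (x _).
by rewrite /pos /enum_val; apply: set_nth_default; rewrite -cardE /= hJ.
Qed.

Lemma restr_eqE N k (J : {set 'I_N}) (hJ : #|J| = k) (x : bits N) (y : bits k) :
  (restr k J x == y) = [forall j, x (pos hJ j) == y j].
Proof.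
apply/eqP/forallP => [<- j|H]; first by rewrite restrE.
by apply/ffunP => j; rewrite restrE (eqP (H j)).
Qed.

Lemma restr_upd N k (J : {set 'I_N}) (hJ : #|J| = k) (x : bits N) j b :
  restr k J (upd x (pos hJ j) b) = upd (restr k J x) j b.
Proof.
by apply/ffunP => i; rewrite (restrE hJ) [LHS]ffunE [RHS]ffunE (restrE hJ) (inj_eq (@pos_inj _ _ _ hJ)).
Qed.

Lemma restr_eq_in N k (J : {set 'I_N}) (x y : bits N) : #|J| = k ->
  (forall i, i \in J -> x i = y i) -> restr k J x = restr k J y.
Proof. by move=> hJ H; apply/ffunP => j; rewrite !(restrE hJ) H // pos_in. Qed.

Lemma sum_prod_restr (V : comPzRingType) N k (J : {set 'I_N}) (u : bool -> V) (y : bits k) :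
  #|J| = k ->
  \sum_(x : bits N) (\prod_i u (x i)) * (restr k J x == y)%:R =
  (\prod_j u (y j)) * (\sum_b u b) ^+ (N - k).
Proof.
move=> hJ; have := sum_prod_constrained u y (@pos_inj _ _ _ hJ); rewrite card_ord => <-.
by apply: eq_bigr => x _; rewrite (restr_eqE hJ).
Qed.

Lemma sum_restr (V : comPzRingType) N k (J : {set 'I_N}) (F : bits k -> V) : #|J| = k ->
  \sum_(x : bits N) F (restr k J x) = 2 ^+ (N - k) * \sum_y F y.
Proof.
move=> hJ; rewrite (partition_big (restr k J) xpredT) //= mulr_sumr.
apply: eq_bigr => y _; rewrite (eq_bigr (fun=> F y)) => [|x /eqP -> //].
have := @sum_prod_restr V N k J (fun=> 1) y hJ.
rewrite (big1 _ _ _ (fun (j : 'I_k) _ => erefl)) mul1r big_bool /= => <-; rewrite mulr_suml big_mkcond /=.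
by apply: eq_bigr => x _; rewrite big1 // mul1r; case: eqP; rewrite ?mul1r ?mul0r.
Qed.

Section Pairs.
Variables n m : nat.
Implicit Types p : ipair n m.

Lemma card_part p c : #|part p c| = m.
Proof. by case: p => [[I J]] /= H; rewrite /part; case/and3P: (H) => /eqP ? /eqP ? _; case: c. Qed.

Lemma part_disjoint p c i : i \in part p c -> i \in part p (~~ c) = false.
Proof.
case: p => [[I J] H]; rewrite /part /=; case/and3P: (H) => _ _ d.
by case: c => /= iI; [exact: (disjointFl d)|exact: (disjointFr d)].
Qed.

(** Disjointness makes the two index sets a single injective family of [2 m] positions. *)
Lemma sum_prod_part (V : comPzRingType) p (u : bool -> V) (x0 x1 : bits m) :
  \sum_(x : bits n) (\prod_i u (x i)) *
     ((restr m (part p false) x == x0) && (restr m (part p true) x == x1))%:R =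
  (\prod_j u (x0 j)) * (\prod_j u (x1 j)) * (\sum_b u b) ^+ (n - 2 * m).
Proof.
pose e (cj : bool * 'I_m) := pos (card_part p cj.1) cj.2.
pose y (cj : bool * 'I_m) := sel cj.1 x0 x1 cj.2.
have ie : injective e.
  move=> [c j] [c' j'] /= E.
  have cc : c = c'.
    apply/eqP; apply: contraT => nc; have h := pos_in (card_part p c) j.
    have := part_disjoint h; rewrite -/(e (c, j)) E.
    by rewrite (_ : ~~ c = c') ?pos_in //; case: (c) (c') nc => [] [].
  by move: E; rewrite /e /= -cc => /pos_inj ->.
rewrite mulrC (_ : _ * (_ * _) = \prod_cj u (y cj) * (\sum_b u b) ^+ (n - #|{: bool * 'I_m}|)).
  rewrite -(sum_prod_constrained _ _ ie); apply: eq_bigr => x _; congr (_ * _%:R).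
  rewrite !(restr_eqE (card_part p _)); congr nat_of_bool.
  apply/andP/forallP => [[/forallP H0 /forallP H1] [[] j]|H]; [exact: H1|exact: H0|].
  by split; apply/forallP => j; [apply: (H (false, j))|apply: (H (true, j))].
rewrite card_prod card_bool card_ord mulrC -(pair_bigA _ (fun c j => u (y (c, j)))) !big_bool /=.
by rewrite (mulrC (\prod_j _)).
Qed.

End Pairs.
End Restriction.

(** * Counting Bob's choices of the index sets *)

Section Choice.
Variables (R : realType) (n m : nat).
Local Notation C := R[i].
Implicit Types p : ipair n m.

Lemma card_choices (B : {set 'I_n}) c :
  #|[set p : ipair n m | part p c \subset B]| = ('C(#|B|, m) * 'C(n - m, m))%N.
Proof.
(* [sw] puts [I_c] first: it is chosen inside [B], and the other set then inside its complement. *)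
pose sw (q : {set 'I_n} * {set 'I_n}) := if c then (q.2, q.1) else q.
have swI : injective sw by move=> [a b] [a' b']; rewrite /sw; case: (c) => [[-> ->]|].
rewrite -(card_imset _ (inj_comp swI val_inj)).
transitivity (\sum_(I in [set I : {set 'I_n} | I \subset B & #|I| == m])
   #|[set J : {set 'I_n} | J \subset ~: I & #|J| == m]|).
  rewrite -sum1_card.
  under [RHS]eq_bigr => I _ do rewrite -sum1_card.
  rewrite pair_big_dep /=; apply: eq_bigl => -[I J]; rewrite !inE /=.
  apply/imsetP/idP => [[[[I' J'] H] + E]|/andP[/andP[IB hI] /andP[JI hJ]]].
    rewrite inE -[I]/(I, J).1 -[J]/(I, J).2 E /sw /= /part /=; case/and3P: (H) => /= hI hJ d.
    by case: (c) => /= ->; rewrite hI hJ ?andbT //= -disjoints_subset // disjoint_sym.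
  have v (I' J' : {set 'I_n}) : #|I'| == m -> #|J'| == m -> [disjoint I' & J'] ->
    [&& #|(I', J').1| == m, #|(I', J').2| == m & [disjoint (I', J').1 & (I', J').2]].
    by move=> /= -> -> ->.
  rewrite -disjoints_subset in JI.
  rewrite /sw /part; case: (c).
    by rewrite disjoint_sym in JI; rewrite disjoint_sym in JI; exists (exist _ (J, I) (v _ _ hJ hI JI)); rewrite ?inE.
  by rewrite disjoint_sym in JI; exists (exist _ (I, J) (v _ _ hI hJ JI)); rewrite ?inE.
rewrite (eq_bigr (fun=> 'C(n - m, m))) => [|I]; last first.
  by rewrite inE => /andP[_ /eqP hI]; rewrite cards_draws cardsCs setCK card_ord hI.
by rewrite sum_nat_const cards_draws.
Qed.

Lemma bob_choice_ge0 (G : {set 'I_n}) c p : 0 <= bob_choice R G c p.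
Proof. by rewrite /bob_choice; case: ifP => // _; rewrite invr_ge0. Qed.

(** The value 1/2 is the probability of [c]. The condition [2 * m <= n] keeps both binomials
    nonzero, also when Bob has aborted and draws from all positions. *)
Lemma sum_bob_choice (G : {set 'I_n}) c : (2 * m <= n)%N ->
  \sum_(p : ipair n m) bob_choice R G c p = 2^-1 :> C.
Proof.
move=> mn; rewrite /bob_choice; set B := if _ then _ else _.
have hB : (m <= #|B|)%N by rewrite /B; case: ifP => // _; rewrite cardsT card_ord; lia.
rewrite -big_mkcond /= sumr_const -(mulr_natl (_^-1)).
rewrite (_ : #|_| = ('C(#|B|, m) * 'C(n - m, m))%N); last first.
  by rewrite -(card_choices B c); apply: eq_card => p; rewrite inE.
rewrite -mulnA [(2 * _)%:R]natrM invfM mulrCA mulfV ?mulr1 //.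
by rewrite pnatr_eq0 -lt0n muln_gt0 !bin_gt0; lia.
Qed.

Lemma sum_supersets (V : nmodType) (I : {set 'I_n}) (f : nat -> V) :
  \sum_(G : {set 'I_n} | I \subset G) f #|G| =
  \sum_(k < n.+1) f (n - k)%N *+ 'C(n - #|I|, k).
Proof.
rewrite (reindex_inj (@setC_inj _)) /=.
rewrite (partition_big (fun G : {set 'I_n} => inord #|G| : 'I_n.+1) xpredT) //=.
apply: eq_bigr => k _.
have cG (G : {set 'I_n}) : (#|G| < n.+1)%N by rewrite ltnS -[n in (_ <= n)%N]card_ord max_card.
rewrite (eq_bigr (fun=> f (n - k)%N)) => [|G /andP[_ /eqP <-]]; last first.
  by rewrite inordK // cardsCs setCK card_ord.
rewrite sumr_const; congr (_ *+ _).
have <- : #|~: I| = (n - #|I|)%N by rewrite cardsCs setCK card_ord.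
rewrite -cards_draws; apply: eq_card => G; rewrite !inE -setCS setCK.
by congr (_ && _); apply/eqP/eqP => [<-|e]; [rewrite inordK|apply: val_inj; rewrite /= inordK].
Qed.

(** This is what hides Bob's bit. If enough bases agree, the weight depends on [G] only through its
    size and the inclusion of [part p c], and the supersets of an [m]-set are counted by size alone.
    If too few agree, the base is everything and the inclusion is automatic. *)
Lemma sum_bob_choice_sym (f : nat -> C) p c :
  \sum_(G : {set 'I_n}) f #|G| * bob_choice R G c p =
  \sum_(G : {set 'I_n}) f #|G| * bob_choice R G false p.
Proof.
rewrite (bigID (fun G : {set 'I_n} => (m <= #|G|)%N)) [RHS](bigID (fun G : {set 'I_n} => (m <= #|G|)%N)) /=.
congr (_ + _); last first.
  by apply: eq_bigr => G /negbTE nG; rewrite /bob_choice nG !subsetT.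
pose g k : C := if (m <= k)%N then f k * ((2 * 'C(k, m) * 'C(n - m, m))%N%:R)^-1 else 0.
have H c' : \sum_(G : {set 'I_n} | (m <= #|G|)%N) f #|G| * bob_choice R G c' p =
   \sum_(G : {set 'I_n} | part p c' \subset G) g #|G|.
  rewrite [LHS]big_mkcond [RHS]big_mkcond; apply: eq_bigr => G _.
  by rewrite /g /bob_choice; case: leqP => // _; case: ifP; rewrite ?mulr0.
by rewrite !H !sum_supersets !card_part.
Qed.

End Choice.

(** * Agreeing bases and transmitted qubits *)

Section AgreeTail.
Variable R : realType.

Lemma agree_tail n m (theta : bits n) (a : R) : 0 <= a ->
  (forall k, (k < m)%N -> k%:R <= (2^-1 - a) * n%:R) ->
  \sum_(theta' : bits n) (#|agree theta theta'| < m)%N%:R <=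
  2 ^+ n * expR (- (2 * a ^+ 2 * n%:R)).
Proof.
(* [4 * a] minimises the Chernoff exponent [- a t n + t^2 n / 8]. *)
move=> a0 hm; set t := 4 * a.
have t0 : 0 <= t by rewrite mulr_ge0.
have step (th : bits n) : (#|agree theta th| < m)%N%:R <=
    expR (t * ((2^-1 - a) * n%:R)) * \prod_i (if theta i == th i then expR (- t) else 1).
  case: ltnP => /= h; last by rewrite mulr_ge0 ?expR_ge0 // prodr_ge0 // => i _; case: ifP => // _; rewrite expR_ge0.
  rewrite -big_mkcond /= prodr_const -expRM_natl -expRD -[leLHS]expR0 ler_expR.
  rewrite (_ : #|_| = #|agree theta th|); last by apply: eq_card => i; rewrite !inE.
  by rewrite mulrN mulrC -mulrBl mulr_ge0 // subr_ge0 hm.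
apply: (le_trans (ler_sum _ (fun th _ => step th))).
rewrite -mulr_sumr.
rewrite -(bigA_distr_bigA (fun i b => if theta i == b then expR (- t) else 1)).
rewrite (eq_bigr (fun=> 1 + expR (- t))) => [|i _]; last first.
  by rewrite big_bool /=; case: (theta i) => //=; rewrite addrC.
rewrite prodr_const card_ord.
have hc := @expR_cosh_le R (t / 2) (divr_ge0 t0 (ler0n _ 2)).
have e1 : 1 + expR (- t) = expR (- (t / 2)) * (expR (t / 2) + expR (- (t / 2))).
  by rewrite mulrDr -!expRD addNr expR0; congr (_ + expR _); field.
rewrite e1 exprMn.
apply: (@le_trans _ _ (expR (t * ((2^-1 - a) * n%:R)) * (expR (- (t / 2)) ^+ n * (2 * expR ((t / 2) ^+ 2 / 2)) ^+ n))).
  rewrite ler_wpM2l ?expR_ge0 // ler_wpM2l ?exprn_ge0 ?expR_ge0 //.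
  by rewrite lerXn2r ?nnegrE ?mulr_ge0 ?addr_ge0 ?expR_ge0.
rewrite exprMn -!expRM_natl mulrCA mulrA mulrCA -mulrA -!expRD.
rewrite le_eqVlt; apply/orP; left; apply/eqP; congr (_ * expR _).
by rewrite /t; field.
Qed.

End AgreeTail.

(** * Product states and instruments *)

Section Qubits.
Variable R : realType.
Local Notation C := R[i].

Lemma sum_hdim (V : nmodType) N (F : {ffun 'I_N -> 'I_2} -> V) :
  \sum_(i < hdim N) F (enum_val i) = \sum_f F f.
Proof.
rewrite (reindex (@enum_val _ (mem {ffun 'I_N -> 'I_2}))) /=.
  by [].
exact: onW_bij (enum_val_bij _).
Qed.

(** The product vector with qubit [j] replaced by the computational basis vector [c]; it exposes the
    linear dependence on that qubit. *)
Definition ket_slice N (x theta : bits N) (j : 'I_N) (c : 'I_2) : 'cV[C]_(hdim N) :=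
  \col_(i < hdim N) ((enum_val i j == c)%:R *
    \prod_(k < N | k != j) qubit R (x k) (theta k) (enum_val i k) 0).

Lemma ket_upd N (x theta : bits N) j b tau :
  ket R (upd x j b) (upd theta j tau) =
  qubit R b tau 0 0 *: ket_slice x theta j 0 + qubit R b tau 1 0 *: ket_slice x theta j 1.
Proof.
have lin (a c : C) (U W : 'cV[C]_(hdim N)) i k : (a *: U + c *: W) i k = a * U i k + c * W i k.
  by rewrite !mxE.
apply/matrixP => i k; rewrite lin {lin}.
have sl c : ket_slice x theta j c i k = (enum_val i j == c)%:R *
    \prod_(k0 < N | k0 != j) qubit R (x k0) (theta k0) (enum_val i k0) 0 by rewrite mxE.
have -> : ket R (upd x j b) (upd theta j tau) i k =
   \prod_(j0 < N) qubit R (upd x j b j0) (upd theta j tau j0) (enum_val i j0) 0 by rewrite mxE.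
rewrite !sl {sl}.
pose P := \prod_(k0 < N | k0 != j) qubit R (x k0) (theta k0) (enum_val i k0) 0.
have -> : \prod_(j0 < N) qubit R (upd x j b j0) (upd theta j tau j0) (enum_val i j0) 0 =
   qubit R b tau (enum_val i j) 0 * P.
  rewrite (bigD1 j) //= !ffunE eqxx; congr (_ * _).
  by apply: eq_bigr => k0 /negbTE nk; rewrite !ffunE nk.
rewrite -/P; move: (enum_val i j) P => a P; have [->|->] : a = 0 \/ a = 1.
  by case: a => [[|[|//]] Ha]; [left|right]; apply: val_inj.
- by rewrite eqxx mul1r /= mul0r mulr0 addr0.
- by rewrite eqxx mul1r /= mul0r mulr0 add0r.
Qed.

Lemma site_ket N d (k : 'M[C]_(d, hdim N)) (x theta : bits N) j :
  site (fun b tau => fn (k *m ket R (upd x j b) (upd theta j tau))).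
Proof.
have := site_qubit (k *m ket_slice x theta j 0) (k *m ket_slice x theta j 1).
congr site; apply/funext => b; apply/funext => tau.
by rewrite ket_upd mulmxDr -!scalemxAr.
Qed.

Lemma qubit_unit b tau : \sum_(c < 2) sqn (qubit R b tau c 0) = 1.
Proof.
rewrite !big_ord_recl big_ord0 addr0.
have sqn0 : sqn (0 : C) = 0 by rewrite /sqn /= expr0n addr0.
have sqn1 : sqn (1 : C) = 1 by rewrite /sqn /= expr0n addr0 expr1n.
have sqnN1 : sqn (-1 : C) = 1 by rewrite /sqn /= sqrrN oppr0 expr0n addr0 expr1n.
case: tau b => [] []; rewrite !mxE /= ?expr0 ?expr1 ?mul1r ?sqn0 ?sqn1 ?sqnM ?sqnN1 ?sqn1 ?mul1r ?sqn_sqrt2 ?addr0 ?add0r //; by field.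
Qed.

Lemma fn_ket N (x theta : bits N) : fn (ket R x theta) = 1.
Proof.
rewrite /fn; under eq_bigr => i _ do rewrite big_ord1 mxE.
rewrite (@sum_hdim _ N (fun f => sqn (\prod_(j < N) qubit R (x j) (theta j) (f j) 0))).
have H (f : {ffun 'I_N -> 'I_2}) : sqn (\prod_(j < N) qubit R (x j) (theta j) (f j) 0) =
   \prod_(j < N) sqn (qubit R (x j) (theta j) (f j) 0).
  apply: (big_morph (@sqn R)); first exact: sqnM.
  by rewrite /sqn /= expr0n addr0 expr1n.
under eq_bigr => f _ do rewrite H.
rewrite -(bigA_distr_bigA (fun j c => sqn (qubit R (x j) (theta j) c 0))).
by rewrite big1 // => j _; rewrite qubit_unit.
Qed.

(** Completeness of either basis; in the Hadamard basis the cross terms cancel. *)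
Lemma sum_pure_qubit d (v w : 'cV[C]_d) tau :
  \sum_(b : bool) pure (qubit R b tau 0 0 *: v + qubit R b tau 1 0 *: w) = pure v + pure w.
Proof.
have adj a c : (a *: v + c *: w)^t* = Num.conj a *: v^t* + Num.conj c *: w^t*.
  by apply/matrixP => i j; rewrite !mxE rmorphD /= !rmorphM.
rewrite big_bool /= /pure !adj.
case: tau; rewrite !mxE /= ?expr0 ?expr1; last first.
  by rewrite !conjC0 !conjC1 !scale0r !scale1r !add0r !addr0 addrC.
set a := (sqrtC 2)^-1 : C; have aR : Num.conj a = a.
  by rewrite /a fmorphV /= conj_Creal ?ger0_real ?sqrtC_ge0.
have a2 : a * a = 2^-1 by rewrite /a -invfM -expr2 sqrtCK.
have mulE b c b' c' : (b *: v + c *: w) *m (b' *: v^t* + c' *: w^t*) =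
    (b * b') *: (v *m v^t*) + (b * c') *: (v *m w^t*) +
    ((c * b') *: (w *m v^t*) + (c * c') *: (w *m w^t*)).
  by rewrite mulmxDl !mulmxDr -!scalemxAl -!scalemxAr !scalerA.
rewrite !mul1r !mulN1r rmorphN /= aR !mulE.
rewrite !mulrN !mulNr opprK a2 !scaleNr.
set A := v *m _; set B := v *m _; set D := w *m v^t*; set E := w *m w^t*.
rewrite (_ : _ + _ = (2^-1 + 2^-1) *: A + (2^-1 + 2^-1) *: E); last first.
  rewrite !scalerDl; move: (2^-1 *: A) (2^-1 *: B) (2^-1 *: D) (2^-1 *: E) => a1 b1 d1 e1.
  apply/matrixP => i j; rewrite !mxE; ring.
by rewrite (_ : 2^-1 + 2^-1 = 1) ?scale1r //; field.
Qed.

Lemma sum_pure_indep N (g : bits N -> C) (P : pred 'I_N) (theta theta' : bits N) :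
  (forall x j b, P j -> g (upd x j b) = g x) ->
  (forall j, ~~ P j -> theta j = theta' j) ->
  \sum_x g x *: pure (ket R x theta) = \sum_x g x *: pure (ket R x theta').
Proof.
move=> hg; apply: (@upd_invariant _ _ P (fun th => \sum_x g x *: pure (ket R x th))).
move=> {theta theta'} theta j tau Pj.
have half (A B : 'M[C]_(hdim N)) : A *+ 2 = B *+ 2 -> A = B.
  by rewrite -(scaler_nat 2 A) -(scaler_nat 2 B); apply: scalerI; rewrite pnatr_eq0.
have H ta : (\sum_x g x *: pure (ket R x (upd theta j ta))) *+ 2 =
   \sum_x g x *: (pure (ket_slice x theta j 0) + pure (ket_slice x theta j 1)).
  rewrite -(sum_upd j (fun x => g x *: pure (ket R x (upd theta j ta)))).
  apply: eq_bigr => x _; rewrite big_bool /= !hg // -scalerDr; congr (_ *: _).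
  by rewrite -(sum_pure_qubit _ _ ta) big_bool /= !ket_upd.
have : (\sum_x g x *: pure (ket R x (upd theta j tau))) *+ 2 = (\sum_x g x *: pure (ket R x theta)) *+ 2.
  by rewrite -[in RHS](upd_id theta j) !H.
exact: half.
Qed.

Variables (K : finType) (d d' : nat) (E : instrument R K d d').

Lemma apply_instr_sum k (I : Type) (r : seq I) (P : pred I) (a : I -> C) (F : I -> 'M[C]_d) :
  apply_instr E k (\sum_(i <- r | P i) a i *: F i) =
  \sum_(i <- r | P i) a i *: apply_instr E k (F i).
Proof.
rewrite /apply_instr; under [RHS]eq_bigr => i _ do rewrite scaler_sumr.
rewrite exchange_big /=; apply: eq_bigr => j _.
rewrite mulmx_sumr mulmx_suml; apply: eq_bigr => i _.
by rewrite -scalemxAr -scalemxAl.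
Qed.

Lemma apply_instrZ k (a : C) (A : 'M[C]_d) : apply_instr E k (a *: A) = a *: apply_instr E k A.
Proof. by have := @apply_instr_sum k _ [:: tt] xpredT (fun=> a) (fun=> A); rewrite !big_seq1. Qed.

Lemma apply_instr_sum1 k (I : Type) (r : seq I) (P : pred I) (F : I -> 'M[C]_d) :
  apply_instr E k (\sum_(i <- r | P i) F i) = \sum_(i <- r | P i) apply_instr E k (F i).
Proof.
have := apply_instr_sum k r P (fun=> 1) F.
by under eq_bigr => i _ do rewrite scale1r; under [RHS]eq_bigr => i _ do rewrite scale1r.
Qed.

Lemma gram_apply k (A : 'M[C]_d) : gram A -> gram (apply_instr E k A).
Proof. by move=> gA; apply: gram_sum => j _; exact: gram_kraus. Qed.

Lemma tr_apply (A : 'M[C]_d) : \sum_k \tr (apply_instr E k A) = \tr A.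
Proof.
transitivity (\tr ((\sum_k \sum_j (@kraus _ _ _ _ E k j)^t* *m @kraus _ _ _ _ E k j) *m A)).
  rewrite mulmx_suml raddf_sum; apply: eq_bigr => k _.
  rewrite mulmx_suml /apply_instr !raddf_sum; apply: eq_bigr => j _ /=.
  by rewrite mxtrace_mulC mulmxA.
by rewrite kraus_complete mul1mx.
Qed.

Lemma rtr_apply (A : 'M[C]_d) : \sum_k rtr (apply_instr E k A) = rtr A.
Proof. by rewrite /rtr -tr_apply Re_sum. Qed.

Lemma rtr_apply_pure k (v : 'cV[C]_d) :
  rtr (apply_instr E k (pure v)) = \sum_j fn (@kraus _ _ _ _ E k j *m v).
Proof.
rewrite /apply_instr rtr_sum; apply: eq_bigr => j _.
by rewrite -rtr_gram /pure trmx_mul map_mxM !mulmxA.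
Qed.

End Qubits.

(** * Security for Bob *)

Section Distance.
Variable R : realType.
Local Notation C := R[i].

Lemma sum_pair (V : nmodType) (A B : finType) (F : A * B -> V) :
  \sum_t F t = \sum_a \sum_b F (a, b).
Proof. by rewrite pair_bigA; apply: eq_bigr => -[]. Qed.

(** Duality: a bound for all families of contractions suffices, since one of them attains the trace
    norm in every block. *)
Lemma trdist_le (T : finType) d (rho sigma : cq R T d) (e : R) :
  (forall W : T -> 'M[C]_d, (forall t, contraction (W t)) ->
     2^-1 * \sum_t rtr (W t *m (rho t - sigma t)) <= e) ->
  trdist rho sigma <= e%:C.
Proof.
move=> H.
have ex t : exists w, contraction w /\
    tracenorm (rho t - sigma t) = (rtr (w *m (rho t - sigma t)))%:C.
  by have [w h1 h2] := tracenormP (rho t - sigma t); exists w.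
have [W hW] := boolp.choice ex.
rewrite /trdist; under eq_bigr => t _ do rewrite (hW t).2.
rewrite -rmorph_sum /= (_ : 2^-1 = (2^-1 : R)%:C); last by rewrite fmorphV rmorphD rmorph1.
by rewrite -rmorphM /= lecR; apply: H => t; exact: (hW t).1.
Qed.

Lemma gram_is_state (T : finType) d (rho : cq R T d) :
  (forall t, gram (rho t)) -> \sum_t \tr (rho t) = 1 -> is_state rho.
Proof. by move=> g s; split=> // t; exact: gram_psd. Qed.

(** For states that differ by [X - Y] with both terms positive, the factor 1/2 in the distance
    yields [e] and not [2 e]. *)
Lemma trdist_le_split (T : finType) d (rho sigma X Y : cq R T d) (e : R) :
  (forall t, rho t - sigma t = X t - Y t) ->
  (forall t, gram (X t)) -> (forall t, gram (Y t)) ->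
  \sum_t \tr (X t) <= e%:C -> \sum_t \tr (Y t) <= e%:C ->
  trdist rho sigma <= e%:C.
Proof.
move=> E gX gY hX hY; apply: trdist_le => W hW.
have {hX} : \sum_t rtr (X t) <= e.
  by rewrite -lecR rmorph_sum /=; under eq_bigr => t _ do rewrite -gram_tr //.
have {hY} : \sum_t rtr (Y t) <= e.
  by rewrite -lecR rmorph_sum /=; under eq_bigr => t _ do rewrite -gram_tr //.
have : \sum_t rtr (W t *m (rho t - sigma t)) <= \sum_t (rtr (X t) + rtr (Y t)).
  apply: ler_sum => t _; rewrite E mulmxBr rtrB lerD ?rtr_contraction //.
  have := norm_rtr_contraction (hW t) (gY t); rewrite ler_norml => /andP[+ _].
  by rewrite lerNl.
rewrite big_split /=; lra.
Qed.

Lemma tr_pure_ket N (x theta : bits N) : \tr (pure (ket R x theta)) = 1.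
Proof. by rewrite /pure -fnE fn_ket. Qed.

Lemma natr_embed (k : nat) : (k%:R : C) = (k%:R : R)%:C.
Proof. by rewrite rmorph_nat. Qed.

Lemma sum_tr_instr (K : finType) d N (E : instrument R K (hdim N) d) k (theta theta' : bits N) :
  \sum_x \tr (apply_instr E k (pure (ket R x theta))) =
  \sum_x \tr (apply_instr E k (pure (ket R x theta'))).
Proof.
have := @sum_pure_indep R N (fun=> 1) predT theta theta' (fun _ _ _ _ => erefl) (fun j => ltac:(by [])).
rewrite (eq_bigr _ (fun x _ => scale1r _)) [RHS](eq_bigr _ (fun x _ => scale1r _)).
have trs th : \sum_x \tr (apply_instr E k (pure (ket R x th))) =
   \tr (apply_instr E k (\sum_x pure (ket R x th))) by rewrite apply_instr_sum1 raddf_sum.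
move=> e; apply: (etrans (trs theta)); apply: (etrans _ (esym (trs theta'))).
by congr (\tr (apply_instr E k _)); exact: e.
Qed.

Lemma sum_tr_station (K : finType) d N (E : instrument R K (hdim N) d) (theta : bits N) :
  \sum_k \sum_x \tr (apply_instr E k (pure (ket R x theta))) = 2 ^+ N.
Proof.
rewrite exchange_big /=; under eq_bigr => x _ do rewrite tr_apply tr_pure_ket.
by rewrite sumr_const card_bits -natrX.
Qed.

Lemma sum_sel (T : finType) (c : bool) (s : T) (f0 f1 : T -> C) :
  \sum_s f0 s = 1 -> \sum_s f1 s = 1 ->
  \sum_s0 \sum_(s1 | sel c s0 s1 == s) f0 s0 * f1 s1 = sel c f0 f1 s.
Proof.
move=> h0 h1; case: c => /=.
  rewrite -[RHS]mul1r -h0 mulr_suml; apply: eq_bigr => s0 _.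
  by rewrite big_pred1_eq.
rewrite (bigD1 s) //= (eq_bigl xpredT) => [|s1]; last by rewrite eqxx.
rewrite -mulr_sumr h1 mulr1 big1 ?addr0 // => s0 /negbTE ns.
by rewrite big_pred0 // => s1; rewrite ns.
Qed.

End Distance.

(** * The ideal state for an honest Bob *)

Section SecurityForBob.
Variables (R : realType) (n m l leak N d : nat) (dev : honest_device R).
Variables (h : hash_family m l) (ec : ec_scheme R n m leak) (M M' : finType).
Local Notation C := R[i].
Local Notation First := (alice_first n dev N M).
Local Notation View := (First * ipair n m * alice_second leak h M')%type.

(** Alice's announced bases on the kept rounds. The discarded rounds get the computational basis, an
    arbitrary choice. *)
Definition ext_basis (K : nsub N n) (theta : bits n) : bits N :=
  [ffun i => [exists j, (pos (eqP (valP K)) j == i) && theta j]].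

Lemma ext_basisE K theta j : ext_basis K theta (pos (eqP (valP K)) j) = theta j.
Proof.
rewrite ffunE; apply/existsP/idP => [[k /andP[/eqP/pos_inj -> //]]|tj].
by exists j; rewrite eqxx.
Qed.

Lemma card_nsub (K : nsub N n) : #|val K| = n.
Proof. exact: eqP (valP K). Qed.

Definition view_pos (v : View) : nsub N n := v.1.1.1.1.1.
Definition view_out (v : View) : {ffun 'I_n -> hd_out dev} := v.1.1.1.1.2.
Definition view_basis (v : View) : bits n := v.1.1.1.2.
Definition view_key (v : View) (c : bool) : hash_key h := sel c v.2.1.2.1 v.2.1.2.2.

Definition view_guess (v : View) (x : bits N) (thetaK : bits n) (c : bool) : option (bits m) :=
  ec_dec ec (view_basis v) v.1.2 c
    (restr m (part v.1.2 c) (bob_flip (view_out v) (restr n (val (view_pos v)) x) thetaK))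
    v.2.1.1.

(** A decoding failure is absorbed here, for each index separately, as a uniform string. It then
    occurs identically in the ideal state and costs nothing, even if Alice causes it for one string
    only. *)
Definition output_law (v : View) (c : bool) (g : option (bits m)) (s : bits l) : C :=
  if g == None then (2 ^ l)%N%:R^-1 else (omap (hash (view_key v c)) g == Some s)%:R.

Lemma output_law_ge0 v c g s : 0 <= output_law v c g s.
Proof. by rewrite /output_law; case: ifP => // _; rewrite invr_ge0. Qed.

Lemma sum_const_bits (a : C) : \sum_(s : bits l) a = (2 ^ l)%N%:R * a.
Proof. by rewrite sumr_const card_bits mulr_natl. Qed.

Lemma sum_output_law v c g : \sum_s output_law v c g s = 1.
Proof.
rewrite /output_law; case: g => [y|] /=; last first.
  by rewrite sum_const_bits mulfV // pnatr_eq0 expn_eq0.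
rewrite (bigD1 (hash (view_key v c) y)) //= eqxx big1 ?addr0 // => s /negbTE ns.
by rewrite (_ : _ == _ = false) //; apply/eqP => -[e]; rewrite e eqxx in ns.
Qed.

Definition short_run (a : First) (theta' : bits N) : bool :=
  (#|agree a.1.2 (restr n (val a.1.1.1) theta')| < m)%N.

Definition run_choice (a : First) (p : ipair n m) (c : bool) (theta' : bits N) : C :=
  bob_choice R (agree a.1.2 (restr n (val a.1.1.1) theta')) c p.

Lemma run_choice_ge0 a p c theta' : 0 <= run_choice a p c theta'.
Proof. exact: bob_choice_ge0. Qed.

(** The weight of [p] together with one value of [c], averaged over Bob's bases. Neither the value
    [false] nor the zero string matters, by [sum_bob_choice_sym] and [sum_agree]. *)
Definition pair_weight (p : ipair n m) : C :=
  (2 ^+ n)^-1 * \sum_(t : bits n) bob_choice R (agree [ffun=> false] t) false p.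

Lemma pair_weight_ge0 p : 0 <= pair_weight p.
Proof. by rewrite mulr_ge0 ?invr_ge0 ?exprn_ge0 // sumr_ge0 // => t _; exact: bob_choice_ge0. Qed.

Lemma sum_pair_weight : (2 * m <= n)%N -> \sum_p pair_weight p = 2^-1.
Proof.
move=> mn; rewrite -mulr_sumr exchange_big /=.
under eq_bigr => t _ do rewrite sum_bob_choice //.
by rewrite sumr_const card_bits -(mulr_natl 2^-1) natrX mulrA mulVf ?mul1r // expf_neq0 ?pnatr_eq0.
Qed.

Lemma sum_agree (V : nmodType) (F : {set 'I_n} -> V) (theta : bits n) :
  \sum_(t : bits n) F (agree theta t) = \sum_G F G.
Proof.
rewrite [RHS](reindex (agree theta)) //.
exists (fun G : {set 'I_n} => [ffun i => (i \in G) == theta i] : bits n) => [t _|G _].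
  by apply/ffunP => i; rewrite ffunE inE; case: (theta i) (t i) => [] [].
by apply/setP => i; rewrite inE ffunE; case: (theta i) (i \in G) => [] [].
Qed.

Lemma nsub_le (K : nsub N n) : (n <= N)%N.
Proof. by have := max_card (mem (val K)); rewrite card_ord card_nsub. Qed.

Lemma sum_run_choice a p c : \sum_theta' run_choice a p c theta' = 2 ^+ N * pair_weight p.
Proof.
rewrite /run_choice (sum_restr (fun t => bob_choice R (agree a.1.2 t) c p) (card_nsub _)).
rewrite /pair_weight !(sum_agree (fun G => bob_choice R G _ p)).
have := @sum_bob_choice_sym R n m (fun=> 1) p c.
under eq_bigr => G _ do rewrite mul1r; under [X in _ = X]eq_bigr => G _ do rewrite mul1r.
move=> ->; rewrite mulrA; congr (_ * _).
by rewrite -{2}(subnK (nsub_le a.1.1.1)) exprD mulfK // expf_neq0 ?pnatr_eq0.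
Qed.

(* T v x' theta' is the (unnormalised) state left to Alice with view v when Bob
   sent |x'>_theta'; T_indep says that the basis of a qubit that enters the
   classical data only through a uniformly random bit is irrelevant. *)
Variable T : View -> bits N -> bits N -> 'M[C]_d.
Variable tau : First -> C.
Hypothesis gram_T : forall v x theta, gram (T v x theta).
Hypothesis T_indep : forall v (g : bits N -> C) (P : pred 'I_N) (theta theta' : bits N),
  (forall x j b, P j -> g (upd x j b) = g x) ->
  (forall j, ~~ P j -> theta j = theta' j) ->
  \sum_x g x *: T v x theta = \sum_x g x *: T v x theta'.
Hypothesis tau_ge0 : forall a, 0 <= tau a.
Hypothesis sum_tau : \sum_a tau a = 2 ^+ N.
Hypothesis tr_T : forall a p (theta : bits N),
  \sum_b \sum_x \tr (T (a, p, b) x theta) = tau a.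

Definition view_ext (v : View) : bits N := ext_basis (view_pos v) (view_basis v).

Definition ideal_block (v : View) (c : bool) (s : bits l) : 'M[C]_d :=
  \sum_x output_law v c (view_guess v x (view_basis v) c) s *: T v x (view_ext v).

(** As if Bob had prepared every kept qubit in Alice's announced basis: both strings then exist at
    once, and nothing but the label [c] refers to the choice bit. *)
Definition ideal_bob : cq R (View * bits l * bits l * bool)%type d :=
  fun '(v, s0, s1, c) => ((2 ^+ N)^-1 * pair_weight v.1.2) *:
    \sum_x (output_law v false (view_guess v x (view_basis v) false) s0 *
            output_law v true (view_guess v x (view_basis v) true) s1) *: T v x (view_ext v).

Lemma guess_block_indep v c s theta' :
  part v.1.2 c \subset agree (view_basis v) (restr n (val (view_pos v)) theta') ->
  \sum_x output_law v c (view_guess v x (restr n (val (view_pos v)) theta') c) s *: T v x theta' =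
  ideal_block v c s.
Proof.
move=> sub.
have hp := card_part v.1.2 c.
have gE x : view_guess v x (restr n (val (view_pos v)) theta') c = view_guess v x (view_basis v) c.
  rewrite /view_guess; congr ec_dec; apply: restr_eq_in => // i iI.
  by rewrite [LHS]ffunE [RHS]ffunE; have := fintype.subsetP sub _ iI; rewrite inE => /eqP <-.
under eq_bigr => x _ do rewrite gE.
(* The decoder reads only the bits at kept positions inside [I_c]; the bases of all other qubits may
   be exchanged. *)
apply: (@T_indep v _ (fun i => [forall j, (pos (eqP (valP (view_pos v))) j == i) ==> (j \notin part v.1.2 c)])) => [x j b Pj|j].
  congr (output_law _ _ _ _); rewrite /view_guess; congr ec_dec; apply: restr_eq_in => // i iI.
  rewrite [LHS]ffunE [RHS]ffunE !(restrE (eqP (valP (view_pos v)))) [upd _ _ _ _]ffunE.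
  case: (pos (eqP (valP (view_pos v))) i =P j) => // e.
  by have /forallP/(_ i)/implyP/(_ (introT eqP e)) := Pj; rewrite iI.
rewrite negb_forall => /existsP[k]; rewrite negb_imply negbK => /andP[/eqP <- kI].
rewrite ext_basisE; have := fintype.subsetP sub _ kI.
by rewrite inE (restrE (eqP (valP (view_pos v)))) => /eqP ->.
Qed.

Lemma sum_view_tr (w : First -> ipair n m -> C) (theta : First -> bits N) :
  \sum_(v : View) w v.1.1 v.1.2 * \sum_x \tr (T v x (theta v.1.1)) =
  \sum_a (\sum_p w a p) * tau a.
Proof.
rewrite sum_pair sum_pair /=; apply: eq_bigr => a _.
rewrite mulr_suml; apply: eq_bigr => p _; rewrite -mulr_sumr; congr (_ * _).
exact: tr_T.
Qed.

Lemma tr_ideal_bob v c :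
  \sum_s0 \sum_s1 \tr (ideal_bob (v, s0, s1, c)) =
  (2 ^+ N)^-1 * pair_weight v.1.2 * \sum_x \tr (T v x (view_ext v)).
Proof.
transitivity (\sum_s0 \sum_s1 \sum_x ((2 ^+ N)^-1 * pair_weight v.1.2 * \tr (T v x (view_ext v))) *
    (output_law v false (view_guess v x (view_basis v) false) s0 *
     output_law v true (view_guess v x (view_basis v) true) s1)).
  apply: eq_bigr => s0 _; apply: eq_bigr => s1 _.
  rewrite /ideal_bob mxtraceZ raddf_sum mulr_sumr; apply: eq_bigr => x _ /=.
  by rewrite mxtraceZ mulrCA mulrC mulrA.
under eq_bigr => s0 _ do rewrite exchange_big /=.
rewrite exchange_big mulr_sumr /=; apply: eq_bigr => x _.
under eq_bigr => s0 _ do rewrite -!mulr_sumr sum_output_law mulr1.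
by rewrite -mulr_sumr sum_output_law mulr1.
Qed.

Lemma ideal_bob_state : (2 * m <= n)%N -> is_state ideal_bob.
Proof.
move=> mn; apply: gram_is_state.
  move=> [[[v s0] s1] c] /=; apply: gramZ; first by rewrite mulr_ge0 ?invr_ge0 ?exprn_ge0 ?pair_weight_ge0.
  by apply: gram_sum => x _; apply: gramZ; [rewrite mulr_ge0 ?output_law_ge0 | exact: gram_T].
rewrite sum_pair sum_pair sum_pair.
have E v : \sum_s0 \sum_s1 \sum_c \tr (ideal_bob (v, s0, s1, c)) =
    2 * ((2 ^+ N)^-1 * pair_weight v.1.2 * \sum_x \tr (T v x (view_ext v))).
  under eq_bigr => s0 _ do rewrite exchange_big.
  by rewrite exchange_big big_bool !tr_ideal_bob [RHS]mulr_natl mulr2n.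
rewrite (eq_bigr _ (fun v _ => E v)) -mulr_sumr.
rewrite (@sum_view_tr (fun a p => (2 ^+ N)^-1 * pair_weight p) (fun a => ext_basis a.1.1.1 a.1.2)).
under eq_bigr => a _ do rewrite -mulr_sumr (sum_pair_weight mn).
rewrite -mulr_sumr sum_tau.
have e2 : 2 ^+ N != 0 :> C by rewrite expf_neq0 ?pnatr_eq0.
by field.
Qed.

Lemma secure_for_bob_abstract (e : R) (rho : cq R (View * bool * bits l)%type d) : (2 * m <= n)%N ->
  (forall theta : bits n, \sum_(t : bits n) (#|agree theta t| < m)%N%:R <= 2 ^+ n * e) ->
  (forall v c s, rho (v, c, s) = (4 ^ N)%N%:R^-1 *: \sum_x \sum_theta'
     (run_choice v.1.1 v.1.2 c theta' *
       (let g := view_guess v x (restr n (val (view_pos v)) theta') c in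
        if bob_aborts (short_run v.1.1 theta') g then (2 ^ l)%N%:R^-1
        else (omap (hash (view_key v c)) g == Some s)%:R)) *: T v x theta') ->
  ot_secure_for_bob e rho.
Proof.
move=> mn tail rhoE; exists ideal_bob; split; first exact: ideal_bob_state.
  move=> v s0 s1 c; rewrite big_bool; set I := ideal_bob (v, s0, s1, c).
  rewrite -[ideal_bob (v, s0, s1, true)]/I -[ideal_bob (v, s0, s1, false)]/I /= -mulr2n.
  by rewrite -(scaler_nat 2 I) scalerA mulVf ?pnatr_eq0 // scale1r.
pose sh (v : View) c th : C := (short_run v.1.1 th)%:R * run_choice v.1.1 v.1.2 c th.
(* [X] is what the runs with too few agreements contribute to the real state, [Y] what the same runs
   would contribute to the ideal one. On the other runs the two states coincide. *)
pose X : cq R (View * bool * bits l)%type d := fun '(v, c, s) =>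
  ((4 ^ N)%N%:R^-1 * (2 ^ l)%N%:R^-1) *: \sum_theta' sh v c theta' *: \sum_x T v x theta'.
pose Y : cq R (View * bool * bits l)%type d := fun '(v, c, s) =>
  ((4 ^ N)%N%:R^-1 * \sum_theta' sh v c theta') *: ideal_block v c s.
have sh0 v c th : 0 <= sh v c th by rewrite mulr_ge0 // run_choice_ge0.
have e4 : (4 ^ N)%N%:R = 2 ^+ N * 2 ^+ N :> C by rewrite -exprD addnn -mul2n -natrX expnM.
have e2 : 2 ^+ N != 0 :> C by rewrite expf_neq0 ?pnatr_eq0.
have short_le a : \sum_theta' (short_run a theta')%:R <= (2 ^+ N * e)%:C :> C.
  rewrite /short_run (sum_restr (fun t => (#|agree a.1.2 t| < m)%N%:R : C) (card_nsub _)).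
  have -> : 2 ^+ N = 2 ^+ (N - n) * 2 ^+ n :> R by rewrite -exprD (subnK (nsub_le a.1.1.1)).
  rewrite -mulrA rmorphM rmorphXn rmorph_nat /=.
  rewrite ler_wpM2l ?exprn_ge0 //.
  by have := tail a.1.2; rewrite -lecR rmorph_sum /=; under eq_bigr => t _ do rewrite rmorph_nat.
(* The trace does not depend on Bob's bases, so one bound, with the basis map [th] left open, serves
   both for [X] and for [Y]. *)
have tot (th : First -> bits N -> bits N) :
  (4 ^ N)%N%:R^-1 * \sum_(v : View) \sum_c \sum_theta' sh v c theta' *
     \sum_x \tr (T v x (th v.1.1 theta')) <= e%:C.
  have -> : \sum_(v : View) \sum_c \sum_theta' sh v c theta' * \sum_x \tr (T v x (th v.1.1 theta'))
     = \sum_a (\sum_theta' (short_run a theta')%:R) * tau a.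
    under eq_bigr => v _ do rewrite exchange_big /=.
    rewrite exchange_big /=; under [RHS]eq_bigr => a _ do rewrite mulr_suml.
    rewrite [RHS]exchange_big /=; apply: eq_bigr => th' _.
    under eq_bigr => v _ do rewrite -mulr_suml.
    rewrite (@sum_view_tr (fun a p => \sum_c (short_run a th')%:R * run_choice a p c th') (fun a => th a th')).
    apply: eq_bigr => a _; congr (_ * _); rewrite exchange_big /=.
    under eq_bigr => c _ do rewrite -mulr_sumr sum_bob_choice //.
    by rewrite big_bool /= -mulrDr (_ : 2^-1 + 2^-1 = 1) ?mulr1 //; field.
  rewrite mulrC ler_pdivrMr; last by rewrite e4 lt0r mulf_neq0 // mulr_ge0 ?exprn_ge0.
  apply: (@le_trans _ _ (\sum_a (2 ^+ N * e)%:C * tau a)).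
    by apply: ler_sum => a _; rewrite ler_wpM2r.
  by rewrite -mulr_sumr sum_tau e4 rmorphM rmorphXn rmorph_nat /= mulrAC mulrC.
apply: (@trdist_le_split _ _ _ _ _ X Y) => [[[v c] s]|[[v c] s]|[[v c] s]||].
- have Em : \sum_s0 \sum_(s1 | sel c s0 s1 == s) ideal_bob (v, s0, s1, c) =
      ((2 ^+ N)^-1 * pair_weight v.1.2) *: ideal_block v c s.
    transitivity (((2 ^+ N)^-1 * pair_weight v.1.2) *: \sum_x (\sum_s0 \sum_(s1 | sel c s0 s1 == s)
       (output_law v false (view_guess v x (view_basis v) false) s0 *
        output_law v true (view_guess v x (view_basis v) true) s1)) *: T v x (view_ext v)).
      under [X in _ = _ *: X]eq_bigr => x _ do rewrite scaler_suml.
      rewrite exchange_big scaler_sumr /=; apply: eq_bigr => s0 _.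
      under [X in _ = _ *: X]eq_bigr => x _ do rewrite scaler_suml.
      by rewrite exchange_big scaler_sumr /=.
    congr (_ *: _); apply: eq_bigr => x _; congr (_ *: _).
    by rewrite sum_sel ?sum_output_law //; case: (c).
  have Er : rho (v, c, s) = X (v, c, s) +
     ((4 ^ N)%N%:R^-1 * \sum_theta' (~~ short_run v.1.1 theta')%:R * run_choice v.1.1 v.1.2 c theta') *: ideal_block v c s.
    rewrite rhoE /X -!scalerA -scalerDr; congr (_ *: _).
    rewrite exchange_big scaler_sumr scaler_suml -big_split /=; apply: eq_bigr => th _.
    rewrite /sh /bob_aborts; case: (boolP (short_run v.1.1 th)) => nsh /=.
      rewrite mul0r scale0r addr0 mul1r scalerA scaler_sumr.
      by apply: eq_bigr => x _; rewrite mulrC.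
    rewrite mul0r scale0r scaler0 add0r mul1r.
    have [sub|nsub] := boolP (part v.1.2 c \subset agree (view_basis v) (restr n (val (view_pos v)) th)).
      rewrite -(guess_block_indep s sub) scaler_sumr; apply: eq_bigr => x _.
      by rewrite scalerA.
    have -> : run_choice v.1.1 v.1.2 c th = 0.
      by move: nsh; rewrite /short_run -leqNgt /run_choice /bob_choice => ->; rewrite (negbTE nsub).
    rewrite scale0r big1 // => x _.
    by rewrite mul0r scale0r.
  have hS : \sum_theta' sh v c theta' + \sum_theta' (~~ short_run v.1.1 theta')%:R * run_choice v.1.1 v.1.2 c theta' =
      2 ^+ N * pair_weight v.1.2.
    rewrite -(sum_run_choice v.1.1 v.1.2 c) -big_split /=; apply: eq_bigr => th _.
    by rewrite /sh; case: short_run; rewrite /= mul1r mul0r ?addr0 ?add0r.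
  change (rho (v, c, s) - \sum_s0 \sum_(s1 | sel c s0 s1 == s) ideal_bob (v, s0, s1, c) = X (v, c, s) - Y (v, c, s)).
  rewrite Em Er -addrA -scalerBl; congr (_ + _).
  rewrite -[Y (v, c, s)]/(((4 ^ N)%N%:R^-1 * \sum_theta' sh v c theta') *: ideal_block v c s) -[RHS]scaleNr.
  congr (_ *: _); move: hS; set S := \sum_theta' sh v c theta'; set S' := \sum_theta' _.
  move=> hS; have -> : S' = 2 ^+ N * pair_weight v.1.2 - S by rewrite -hS addrC addKr.
  by rewrite e4; field.
- apply: gramZ; first by rewrite mulr_ge0 ?invr_ge0 ?exprn_ge0.
  by apply: gram_sum => th _; apply: gramZ => //; apply: gram_sum.
- apply: gramZ; first by rewrite mulr_ge0 ?invr_ge0 ?exprn_ge0 ?sumr_ge0.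
  by apply: gram_sum => x _; apply: gramZ; [exact: output_law_ge0|].
- apply: le_trans (tot (fun a th => th)); rewrite sum_pair sum_pair mulr_sumr; apply: ler_sum => v _.
  rewrite mulr_sumr; apply: ler_sum => c _.
  rewrite le_eqVlt; apply/orP; left; apply/eqP.
  rewrite (eq_bigr (fun=> (4 ^ N)%N%:R^-1 * (2 ^ l)%N%:R^-1 *
     \sum_theta' sh v c theta' * \sum_x \tr (T v x theta'))) => [|s _].
    by rewrite sum_const_bits !mulrA (mulrC _ (4 ^ N)%N%:R^-1) mulfK ?pnatr_eq0 ?expn_eq0.
  rewrite /X mxtraceZ; congr (_ * _); rewrite raddf_sum; apply: eq_bigr => th _ /=.
  by rewrite mxtraceZ raddf_sum.
- apply: le_trans (tot (fun a th => ext_basis a.1.1.1 a.1.2)).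
  rewrite sum_pair sum_pair mulr_sumr; apply: ler_sum => v _.
  rewrite mulr_sumr; apply: ler_sum => c _.
  rewrite le_eqVlt; apply/orP; left; apply/eqP.
  rewrite /Y; under eq_bigr => s _ do rewrite mxtraceZ.
  rewrite -!mulr_sumr -mulrA -mulr_suml; congr (_ * (_ * _)).
  rewrite /ideal_block; under eq_bigr => s _ do rewrite raddf_sum.
  rewrite exchange_big /=; apply: eq_bigr => x _.
  under eq_bigr => s _ do rewrite mxtraceZ.
  by rewrite -mulr_suml sum_output_law mul1r.
Qed.

End SecurityForBob.

Lemma secure_for_bob (R : realType) (n m l leak : nat) (dev : honest_device R)
    (h : hash_family m l) (ec : ec_scheme R n m leak) (A : dishonest_alice n leak dev h) (e : R) :
  (2 * m <= n)%N ->
  (forall theta : bits n, \sum_(t : bits n) (#|agree theta t| < m)%N%:R <= 2 ^+ n * e) ->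
  ot_secure_for_bob e (@real_dishonest_alice R n m l leak dev h ec A).
Proof.
move=> mn tail.
pose T (v : alice_view A) (x theta : bits (da_rounds A)) :=
  apply_instr (da_reply (d := A) v.1.1 v.1.2) v.2
    (apply_instr (da_station A) v.1.1 (pure (ket R x theta))).
pose tau a := \sum_x \tr (apply_instr (da_station A) a (pure (ket R x [ffun=> false]))).
apply: (@secure_for_bob_abstract R n m l leak (da_rounds A) (da_final_dim A) dev h ec _ _ T tau).
- by move=> v x theta; do 2!apply: gram_apply; exact: gram_pure.
- move=> v g P theta theta' hg ht; rewrite /T.
  have lin th : \sum_x g x *: apply_instr (da_reply (d := A) v.1.1 v.1.2) v.2
      (apply_instr (da_station A) v.1.1 (pure (ket R x th))) =
    apply_instr (da_reply (d := A) v.1.1 v.1.2) v.2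
      (apply_instr (da_station A) v.1.1 (\sum_x g x *: pure (ket R x th))).
    by rewrite !apply_instr_sum.
  apply: (etrans (lin theta)); apply: (etrans _ (esym (lin theta'))).
  by congr (apply_instr _ _ (apply_instr _ _ _)); exact: sum_pure_indep hg ht.
- by move=> a; apply: sumr_ge0 => x _; rewrite gram_tr ?ler0c ?gram_rtr_ge0 //; apply: gram_apply; exact: gram_pure.
- exact: sum_tr_station.
- move=> a p theta; rewrite exchange_big /=.
  apply: (etrans _ (sum_tr_instr (da_station A) a theta _)).
  apply: eq_bigr => x _; have := tr_apply (da_reply (d := A) a p) (apply_instr (da_station A) a (pure (ket R x theta))).
  by [].
- exact: mn.
- exact: tail.
- by move=> [[[[[K z] theta] mem] p] [[o [r0 r1]] mem']] c s; rewrite /= /view_key /=; case: c.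
Qed.

(** * Correctness *)

Section HonestRound.
Variable R : realType.
Local Notation C := R[i].

Lemma quad_form_sqn (J : finType) (d : nat) (N : J -> 'M[C]_d) (v k : 'cV[C]_d) :
  (v^t* *m (\sum_j N j *m pure k *m (N j)^t*) *m v) 0 0 =
  (\sum_j sqn ((v^t* *m N j *m k) 0 0))%:C.
Proof.
rewrite mulmx_sumr mulmx_suml summxE rmorph_sum; apply: eq_bigr => j _ /=.
rewrite sqnE /pure.
have -> : v^t* *m (N j *m (k *m k^t*) *m (N j)^t*) *m v =
  (v^t* *m N j *m k) *m (v^t* *m N j *m k)^t*.
  by rewrite !trmx_mul !map_mxM trmxCK !mulmxA.
by rewrite mxE big_ord1 !mxE.
Qed.

Definition ket2_coef (w : 'rV[C]_(2 * 2)) (a b : 'I_2) : C := w 0 (mxtens.mxtens_index (a, b)).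

Lemma mul_ket2 (w : 'rV[C]_(2 * 2)) x theta x' theta' :
  (w *m ket2 R x theta x' theta') 0 0 =
  \sum_(a < 2) \sum_(b < 2) qubit R x theta a 0 * qubit R x' theta' b 0 * ket2_coef w a b.
Proof.
rewrite mxE pair_bigA /= (reindex (@mxtens.mxtens_index 2 2)) /=.
  by apply: eq_bigr => -[a b] _; rewrite mulrC /ket2 mxE !mxtens.mxtens_indexK /= !ord1.
by exists (@mxtens.mxtens_unindex 2 2) => i _; [exact: mxtens.mxtens_indexK|exact: mxtens.mxtens_unindexK].
Qed.

Lemma ord2E (V : nmodType) (F : 'I_2 -> V) : \sum_(a < 2) F a = F 0 + F 1.
Proof. by rewrite !big_ord_recl big_ord0 addr0; congr (_ + F _); apply: val_inj. Qed.

Definition ket2_weight (w : 'rV[C]_(2 * 2)) (x theta x' theta' : bool) : R :=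
  sqn ((w *m ket2 R x theta x' theta') 0 0).

(** With Bob's qubit fixed, the amplitude is a linear form in Alice's qubit. *)
Lemma site_ket2_left w x' theta' : site (fun x theta => ket2_weight w x theta x' theta').
Proof.
have := site_qubitC (\sum_(b < 2) qubit R x' theta' b 0 * ket2_coef w 0 b)
   (\sum_(b < 2) qubit R x' theta' b 0 * ket2_coef w 1 b).
congr site; apply/funext => x; apply/funext => theta.
rewrite /ket2_weight; congr sqn; rewrite mul_ket2 [RHS]ord2E !mulr_sumr.
by congr (_ + _); apply: eq_bigr => b _; rewrite mulrA.
Qed.

Lemma site_ket2_right w x theta : site (fun x' theta' => ket2_weight w x theta x' theta').
Proof.
have := site_qubitC (\sum_(a < 2) qubit R x theta a 0 * ket2_coef w a 0)
   (\sum_(a < 2) qubit R x theta a 0 * ket2_coef w a 1).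
congr site; apply/funext => x'; apply/funext => theta'.
rewrite /ket2_weight; congr sqn; rewrite mul_ket2 exchange_big [RHS]ord2E !mulr_sumr /=.
by congr (_ + _); apply: eq_bigr => b _; rewrite mulrA (mulrC (qubit R x' theta' _ _)).
Qed.

Variable dev : honest_device R.

Definition round_weightR (x theta x' theta' : bool) (z : hd_out dev) : R :=
  16^-1 * \sum_j ket2_weight ((hd_vec z)^t* *m @hd_noise _ dev j) x theta x' theta'.

Lemma round_weightE x theta x' theta' z :
  round_weight x theta x' theta' z = (round_weightR x theta x' theta' z)%:C.
Proof.
rewrite /round_weight /click_weight quad_form_sqn rmorphM fmorphV rmorph_nat /=.
by congr (_ * _).
Qed.

Definition round_total : R :=
  \sum_(x : bool) \sum_(theta : bool) \sum_(x' : bool) \sum_(theta' : bool) \sum_z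
    round_weightR x theta x' theta' z.

Definition round_lawR x theta x' theta' z : R := round_weightR x theta x' theta' z / round_total.

Lemma round_totalE :
  \sum_(x : bool) \sum_(theta : bool) \sum_(x' : bool) \sum_(theta' : bool) \sum_(z : hd_out dev)
    round_weight x theta x' theta' z = round_total%:C.
Proof.
rewrite /round_total !rmorph_sum; apply: eq_bigr => x _; rewrite rmorph_sum.
apply: eq_bigr => th _; rewrite rmorph_sum; apply: eq_bigr => x' _; rewrite rmorph_sum.
apply: eq_bigr => th' _; rewrite rmorph_sum; apply: eq_bigr => z _.
by rewrite round_weightE.
Qed.

Lemma round_lawE x theta x' theta' z :
  round_law x theta x' theta' z = (round_lawR x theta x' theta' z)%:C.
Proof.
by rewrite /round_law round_totalE round_weightE /round_lawR [RHS]rmorphM [X in _ = _ * X]fmorphV.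
Qed.

Lemma round_total_gt0 : 0 < round_total.
Proof. by rewrite -ltcR -round_totalE; exact: hd_click_gt0. Qed.

Lemma site_left x' theta' z : site (fun x theta => round_lawR x theta x' theta' z).
Proof.
have -> : (fun x theta => round_lawR x theta x' theta' z) = fun x theta =>
    (16 * round_total)^-1 * \sum_j ket2_weight ((hd_vec z)^t* *m @hd_noise _ dev j) x theta x' theta'.
  apply/funext => x; apply/funext => th; rewrite /round_lawR /round_weightR invfM.
  by rewrite mulrAC.
apply: siteZ; first by rewrite invr_ge0 mulr_ge0 // ltW ?round_total_gt0.
by apply: site_sum => j _; exact: site_ket2_left.
Qed.

Lemma site_right x theta z : site (fun x' theta' => round_lawR x theta x' theta' z).
Proof.
have -> : (fun x' theta' => round_lawR x theta x' theta' z) = fun x' theta' =>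
    (16 * round_total)^-1 * \sum_j ket2_weight ((hd_vec z)^t* *m @hd_noise _ dev j) x theta x' theta'.
  apply/funext => x'; apply/funext => th; rewrite /round_lawR /round_weightR invfM.
  by rewrite mulrAC.
apply: siteZ; first by rewrite invr_ge0 mulr_ge0 // ltW ?round_total_gt0.
by apply: site_sum => j _; exact: site_ket2_right.
Qed.

Lemma round_lawR_total :
  \sum_(x : bool) \sum_(theta : bool) \sum_(x' : bool) \sum_(theta' : bool) \sum_z
    round_lawR x theta x' theta' z = 1.
Proof.
rewrite -(divff (lt0r_neq0 round_total_gt0)) [X in _ = X / _]/round_total mulr_suml.
apply: eq_bigr => x _; rewrite mulr_suml; apply: eq_bigr => th _; rewrite mulr_suml.
apply: eq_bigr => x' _; rewrite mulr_suml; apply: eq_bigr => th' _; rewrite mulr_suml.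
by [].
Qed.

End HonestRound.

(** * The law of Alice's bit in a round that clicked *)

Section BitLaw.
Variables (R : realType) (Z : finType) (law : bool -> bool -> bool -> bool -> Z -> R).
Hypothesis site_left : forall x' theta' z, site (fun x theta => law x theta x' theta' z).
Hypothesis site_right : forall x theta z, site (fun x' theta' => law x theta x' theta' z).
Hypothesis law_total : \sum_(x : bool) \sum_(theta : bool) \sum_(x' : bool)
  \sum_(theta' : bool) \sum_z law x theta x' theta' z = 1.

(** Bob's basis is frozen at [false]. By [alice_lawE] the other basis gives the same value:
    conditioning on a click leaves his basis uniform and independent of Alice's data. *)
Definition alice_law (x theta : bool) : R := \sum_(x' : bool) \sum_z law x theta x' false z.

Lemma alice_lawE x theta theta' :
  \sum_(x' : bool) \sum_z law x theta x' theta' z = alice_law x theta.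
Proof.
rewrite /alice_law exchange_big [RHS]exchange_big /=; apply: eq_bigr => z _.
rewrite !big_bool /=; have [_ e _] := site_right x theta z.
by case: theta' => //; rewrite addrC -e addrC.
Qed.

Lemma site_alice_law : site alice_law.
Proof. by apply: site_sum => x' _; apply: site_sum => z _; exact: site_left. Qed.

Lemma alice_law_ge0 x theta : 0 <= alice_law x theta.
Proof. by have [h _ _] := site_alice_law. Qed.

Lemma sum_alice_law theta : \sum_(x : bool) alice_law x theta = 4^-1.
Proof.
have [_ e _] := site_alice_law.
have : \sum_(x : bool) \sum_(theta : bool) alice_law x theta *+ 2 = 1.
  rewrite -law_total; apply: eq_bigr => x _; apply: eq_bigr => th _.
  by rewrite exchange_big /= (eq_bigr _ (fun th' _ => alice_lawE x th th')) sumr_const card_bool.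
rewrite !big_bool /=; move: (e); case: theta => /=; lra.
Qed.

(** The factor 2 accounts for Bob's two bases. *)
Definition bit_law (x : bool) : R := 2 * \sum_(theta : bool) alice_law x theta.

Lemma bit_law_ge0 x : 0 <= bit_law x.
Proof. by rewrite mulr_ge0 // sumr_ge0 // => th _; exact: alice_law_ge0. Qed.

Lemma sum_bit_law : bit_law false + bit_law true = 1.
Proof.
have := sum_alice_law false; have := sum_alice_law true.
rewrite /bit_law !big_bool /=; lra.
Qed.

(** The biases in the two bases are the coordinates of a vector in the unit disc, so their average
    is at most [1 / sqrt 2], and [4 u v] is 1 minus its square. *)
Lemma bit_law_spread : 2^-1 <= 4 * (bit_law false * bit_law true).
Proof.
have := sum_alice_law false; have := sum_alice_law true.
have [p e h] := site_alice_law; rewrite /bit_law !big_bool /= => h1 h2.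
set a := alice_law false false in h h2 *; set b := alice_law true false in h h2 *.
set c := alice_law false true in h h1 *; set d := alice_law true true in h h1 *.
have {}h : (a - b) ^+ 2 + (c - d) ^+ 2 <= 16^-1.
  by apply: (le_trans h); rewrite (_ : a + b = 4^-1); [lra|lra].
have -> : 4 * (2 * (c + a) * (2 * (d + b))) = (2 * (a + b + c + d)) ^+ 2 - 4 * (a - b + (c - d)) ^+ 2.
  by ring.
rewrite (_ : a + b + c + d = 2^-1); last by lra.
by have := sqr_ge0 ((a - b) - (c - d)); rewrite -subr_ge0; nra.
Qed.

End BitLaw.

(** * Honest runs as a finite probability space *)

Section HonestRun.
Local Arguments part : simpl never.
Variables (R : realType) (n m leak : nat) (Z : finType).
Variables (law : bool -> bool -> bool -> bool -> Z -> R) (flip : Z -> bool -> bool).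
Variable ec : ec_scheme R n m leak.
Local Notation C := R[i].
Hypothesis site_left : forall x' theta' z, site (fun x theta => law x theta x' theta' z).
Hypothesis site_right : forall x theta z, site (fun x' theta' => law x theta x' theta' z).
Hypothesis law_total : \sum_(x : bool) \sum_(theta : bool) \sum_(x' : bool)
  \sum_(theta' : bool) \sum_z law x theta x' theta' z = 1.
Local Notation run := (bits n * bits n * bits n * bits n * {ffun 'I_n -> Z} * bool
   * ipair n m * bits leak)%type.

Definition choiceR (G : {set 'I_n}) (c : bool) (p : ipair n m) : R := complex.Re (bob_choice R G c p).

Lemma choiceRE G c p : (choiceR G c p)%:C = bob_choice R G c p.
Proof. by rewrite /choiceR RRe_real // ger0_real // bob_choice_ge0. Qed.

Lemma choiceR_ge0 G c p : 0 <= choiceR G c p.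
Proof. by rewrite -ler0c choiceRE bob_choice_ge0. Qed.

Lemma sum_choiceR G c : (2 * m <= n)%N -> \sum_p choiceR G c p = 2^-1.
Proof.
move=> mn; apply: complexI; rewrite rmorph_sum fmorphV rmorph_nat /= -(sum_bob_choice R G c mn).
by apply: eq_bigr => p _; rewrite choiceRE.
Qed.

Lemma sum_choiceR_sym p c : \sum_G choiceR G c p = \sum_G choiceR G false p.
Proof.
have E c' : (\sum_G choiceR G c' p)%:C = \sum_(G : {set 'I_n}) 1 * bob_choice R G c' p.
  by rewrite rmorph_sum; apply: eq_bigr => G _; rewrite mul1r -choiceRE.
by apply: complexI; rewrite !E (sum_bob_choice_sym (fun=> 1)).
Qed.

Definition encR theta p x0 x1 o : R := complex.Re (ec_enc ec theta p x0 x1 o).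

Lemma encRE theta p x0 x1 o : (encR theta p x0 x1 o)%:C = ec_enc ec theta p x0 x1 o.
Proof. by rewrite /encR RRe_real // ger0_real // ec_enc_ge0. Qed.

Lemma encR_ge0 theta p x0 x1 o : 0 <= encR theta p x0 x1 o.
Proof. by rewrite -ler0c encRE ec_enc_ge0. Qed.

Lemma sum_encR theta p x0 x1 : \sum_o encR theta p x0 x1 o = 1.
Proof.
apply: complexI; rewrite rmorph_sum rmorph1 -(ec_enc_sum1 ec theta p x0 x1) /=.
by apply: eq_bigr => o _; rewrite encRE.
Qed.

Definition run_short (w : run) : bool :=
  let: (x, theta, x', theta', z, c, p, o) := w in (#|agree theta theta'| < m)%N.
Definition run_x (b : bool) (w : run) : bits m :=
  let: (x, theta, x', theta', z, c, p, o) := w in restr m (part p b) x.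
Definition run_bit (w : run) : bool :=
  let: (x, theta, x', theta', z, c, p, o) := w in c.
Definition run_guess (w : run) : option (bits m) :=
  let: (x, theta, x', theta', z, c, p, o) := w in
  ec_dec ec theta p c (restr m (part p c) [ffun i => x' i (+) flip (z i) (theta' i)]) o.

Definition run_prob (w : run) : R :=
  let: (x, theta, x', theta', z, c, p, o) := w in
  (\prod_i law (x i) (theta i) (x' i) (theta' i) (z i)) * choiceR (agree theta theta') c p *
  encR theta p (restr m (part p false) x) (restr m (part p true) x) o.

Lemma law_ge0 x theta x' theta' z : 0 <= law x theta x' theta' z.
Proof. by have [h _ _] := site_left x' theta' z; exact: h. Qed.

Lemma run_prob_ge0 w : 0 <= run_prob w.
Proof.
case: w => [[[[[[[x theta] x'] theta'] z] c] p] o] /=.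
by rewrite !mulr_ge0 ?choiceR_ge0 ?encR_ge0 // prodr_ge0 // => i _; exact: law_ge0.
Qed.

Definition expect (F : run -> R) : R := \sum_w run_prob w * F w.

Definition run_sum (f : bool -> bits m -> bits m -> bool -> option (bits m) -> C) : C :=
  \sum_(x : bits n) \sum_(theta : bits n) \sum_(x' : bits n) \sum_(theta' : bits n)
  \sum_(z : {ffun 'I_n -> Z})
    (\prod_i (law (x i) (theta i) (x' i) (theta' i) (z i))%:C) *
    \sum_(c : bool) \sum_(p : ipair n m)
      let G := agree theta theta' in
      let x0 := restr m (part p false) x in
      let x1 := restr m (part p true) x in
      let y := restr m (part p c) [ffun i => x' i (+) flip (z i) (theta' i)] in
      bob_choice R G c p *
      \sum_(o : bits leak) ec_enc ec theta p x0 x1 o *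
         f (#|G| < m)%N x0 x1 c (ec_dec ec theta p c y o).

Lemma run_sumE (f : bool -> bits m -> bits m -> bool -> option (bits m) -> R) :
  run_sum (fun sh x0 x1 c g => (f sh x0 x1 c g)%:C) =
  (expect (fun w => f (run_short w) (run_x false w) (run_x true w) (run_bit w) (run_guess w)))%:C.
Proof.
rewrite /run_sum.
rewrite /expect 7!sum_pair !rmorph_sum; apply: eq_bigr => x _.
rewrite rmorph_sum; apply: eq_bigr => theta _; rewrite rmorph_sum; apply: eq_bigr => x' _.
rewrite rmorph_sum; apply: eq_bigr => theta' _; rewrite rmorph_sum; apply: eq_bigr => z _.
rewrite mulr_sumr rmorph_sum; apply: eq_bigr => c _.
rewrite mulr_sumr rmorph_sum; apply: eq_bigr => p _ /=.
rewrite mulrA mulr_sumr rmorph_sum; apply: eq_bigr => o _ /=.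
by rewrite !rmorphM rmorph_prod /= choiceRE encRE !mulrA.
Qed.

Local Notation al := (alice_law law).

(** A quantity that ignores Bob's bits and the code word sees only Alice's law; the weight no longer
    couples it to Bob's bases except through the choice of the index sets. *)
Lemma expect_alice (H : bits n -> bits n -> bits n -> bool -> ipair n m -> R) :
  expect (fun w => let: (x, theta, x', theta', z, c, p, o) := w in H x theta theta' c p) =
  \sum_(x : bits n) \sum_(theta : bits n) \sum_(theta' : bits n) (\prod_i al (x i) (theta i)) *
     \sum_c \sum_p choiceR (agree theta theta') c p * H x theta theta' c p.
Proof.
rewrite /expect 7!sum_pair; apply: eq_bigr => x _; apply: eq_bigr => theta _.
rewrite exchange_big /=; apply: eq_bigr => theta' _.
have -> : \prod_i al (x i) (theta i) = \sum_(x' : bits n) \sum_(z : {ffun 'I_n -> Z})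
    \prod_i law (x i) (theta i) (x' i) (theta' i) (z i).
  under eq_bigr => i _ do rewrite -(alice_lawE site_right _ _ (theta' i)).
  rewrite (bigA_distr_bigA (fun i b => \sum_z law (x i) (theta i) b (theta' i) z)).
  apply: eq_bigr => x' _.
  by rewrite (bigA_distr_bigA (fun i z => law (x i) (theta i) (x' i) (theta' i) z)).
rewrite mulr_suml; apply: eq_bigr => x' _; rewrite mulr_suml; apply: eq_bigr => z _.
rewrite mulr_sumr; apply: eq_bigr => c _; rewrite mulr_sumr; apply: eq_bigr => p _.
under eq_bigr => o _ do rewrite mulrAC.
by rewrite -mulr_sumr sum_encR mulr1 mulrA.
Qed.

Lemma prod_alice_law_sum (theta : bits n) : \sum_(x : bits n) \prod_i al (x i) (theta i) = 4 ^- n.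
Proof.
rewrite -(bigA_distr_bigA (fun i b => al b (theta i))).
rewrite (eq_bigr (fun=> 4^-1)) => [|i _]; last exact: sum_alice_law.
by rewrite prodr_const card_ord exprVn.
Qed.

Lemma expect_short (e : R) : (2 * m <= n)%N ->
  (forall theta : bits n, \sum_(t : bits n) (#|agree theta t| < m)%N%:R <= 2 ^+ n * e) ->
  expect (fun w => (run_short w)%:R) <= e.
Proof.
move=> mn tail.
have -> : expect (fun w => (run_short w)%:R) = expect (fun w =>
    let: (x, theta, x', theta', z, c, p, o) := w in (#|agree theta theta'| < m)%N%:R).
  by apply: eq_bigr => -[[[[[[[x theta] x'] theta'] z] c] p] o] _.
rewrite (expect_alice (fun x theta theta' c p => (#|agree theta theta'| < m)%N%:R)).
have -> : \sum_(x : bits n) \sum_(theta : bits n) \sum_(theta' : bits n) (\prod_i al (x i) (theta i)) *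
     \sum_c \sum_p choiceR (agree theta theta') c p * (#|agree theta theta'| < m)%N%:R =
  \sum_(theta : bits n) 4 ^- n * \sum_(theta' : bits n) (#|agree theta theta'| < m)%N%:R.
  rewrite exchange_big /=; apply: eq_bigr => theta _.
  rewrite -(prod_alice_law_sum theta) mulr_suml; apply: eq_bigr => x _.
  rewrite mulr_sumr; apply: eq_bigr => theta' _; congr (_ * _).
  under eq_bigr => c _ do rewrite -mulr_suml sum_choiceR //.
  by rewrite big_bool /= -mulrDl (_ : 2^-1 + 2^-1 = 1) ?mul1r //; field.
apply: (@le_trans _ _ (\sum_(theta : bits n) 4 ^- n * (2 ^+ n * e))).
  by apply: ler_sum => theta _; rewrite ler_wpM2l ?invr_ge0 ?exprn_ge0.
rewrite sum_bits_const (_ : 4 ^+ n = 2 ^+ n * 2 ^+ n :> R); last by rewrite -exprMn -natrM.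
rewrite le_eqVlt; apply/orP; left; apply/eqP; field.
by rewrite expf_neq0 ?pnatr_eq0.
Qed.

Definition string_law (y : bits m) : R := \prod_j bit_law law (y j).

Lemma string_law_ge0 y : 0 <= string_law y.
Proof. by apply: prodr_ge0 => j _; exact: bit_law_ge0. Qed.

Lemma sum_string_law : \sum_(y : bits m) string_law y = 1.
Proof.
rewrite -(bigA_distr_bigA (fun i b => bit_law law b)) big1 // => i _.
by rewrite big_bool /= addrC; exact: sum_bit_law.
Qed.

(** Three independences combine: the agreement set is independent of Alice's bits, the index sets
    are independent of [C] by [sum_choiceR_sym], and disjoint parts of an i.i.d. string are
    independent. *)
Lemma expect_strings (F : bool -> bits m -> bits m -> R) : (2 * m <= n)%N ->
  expect (fun w => F (run_bit w) (run_x false w) (run_x true w)) =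
  2^-1 * \sum_c \sum_y0 \sum_y1 string_law y0 * string_law y1 * F c y0 y1.
Proof.
move=> mn.
have -> : expect (fun w => F (run_bit w) (run_x false w) (run_x true w)) = expect (fun w =>
    let: (x, theta, x', theta', z, c, p, o) := w in
      F c (restr m (part p false) x) (restr m (part p true) x)).
  by apply: eq_bigr => -[[[[[[[x theta] x'] theta'] z] c] p] o] _.
rewrite (expect_alice (fun x theta theta' c p => F c (restr m (part p false) x) (restr m (part p true) x))).
have e2 : 2 ^+ n != 0 :> R by rewrite expf_neq0 ?pnatr_eq0.
have marg c (p : ipair n m) : \sum_(x : bits n) (\prod_i bit_law law (x i)) *
     F c (restr m (part p false) x) (restr m (part p true) x) =
   \sum_y0 \sum_y1 string_law y0 * string_law y1 * F c y0 y1.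
  transitivity (\sum_y0 \sum_y1 \sum_(x : bits n) (\prod_i bit_law law (x i)) *
     ((restr m (part p false) x == y0) && (restr m (part p true) x == y1))%:R * F c y0 y1).
    under [RHS]eq_bigr => y0 _ do rewrite exchange_big /=.
    rewrite [RHS]exchange_big /=; apply: eq_bigr => x _.
    rewrite (bigD1 (restr m (part p false) x)) //= (bigD1 (restr m (part p true) x)) //=.
    rewrite !eqxx mulr1 [X in _ = _ + X + _]big1 => [|y1 n1]; last first.
      by rewrite (eq_sym _ y1) (negbTE n1) andbF mulr0 mul0r.
    rewrite [X in _ = _ + X]big1 ?addr0 // => y0 n0; rewrite big1 // => y1 _.
    by rewrite (eq_sym _ y0) (negbTE n0) mulr0 mul0r.
  apply: eq_bigr => y0 _; apply: eq_bigr => y1 _; rewrite -mulr_suml; congr (_ * _).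
  rewrite sum_prod_part big_bool /= (addrC (bit_law law true)) (sum_bit_law site_left site_right law_total).
  by rewrite expr1n mulr1.
have sth (x : bits n) : \sum_(theta : bits n) \prod_i al (x i) (theta i) = 2 ^- n * \prod_i bit_law law (x i).
  rewrite -(bigA_distr_bigA (fun i th => al (x i) th)) /bit_law big_split /= prodr_const card_ord.
  by rewrite mulrA mulVf // mul1r.
transitivity (\sum_(x : bits n) \sum_(theta : bits n) (\prod_i al (x i) (theta i)) * \sum_c \sum_p
   (\sum_G choiceR G false p) * F c (restr m (part p false) x) (restr m (part p true) x)).
  apply: eq_bigr => x _; apply: eq_bigr => theta _; rewrite -mulr_sumr; congr (_ * _).
  rewrite exchange_big /=; apply: eq_bigr => c _.
  rewrite exchange_big /=; apply: eq_bigr => p _; rewrite -mulr_suml; congr (_ * _).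
  by rewrite (sum_agree (fun G => choiceR G c p)) sum_choiceR_sym.
under eq_bigr => x _ do rewrite -mulr_suml sth mulr_sumr.
rewrite exchange_big mulr_sumr /=; apply: eq_bigr => c _.
under eq_bigr => x _ do rewrite mulr_sumr.
rewrite exchange_big /=.
rewrite (eq_bigr (fun p => 2 ^- n * (\sum_G choiceR G false p) *
    (\sum_y0 \sum_y1 string_law y0 * string_law y1 * F c y0 y1))) => [|p _]; last first.
  by rewrite -(marg c p) mulr_sumr; apply: eq_bigr => x _; ring.
rewrite -mulr_suml; congr (_ * _); rewrite -mulr_sumr exchange_big /=.
under eq_bigr => G _ do rewrite sum_choiceR //.
by rewrite -(sum_agree (fun=> 2^-1) [ffun=> false]) sum_bits_const mulrA mulVf ?mul1r.
Qed.

End HonestRun.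

(** * Honest outputs compared with uniform ones *)

Section Correctness.
Variables (R : realType) (n m l leak : nat) (Z : finType).
Variables (law : bool -> bool -> bool -> bool -> Z -> R) (flip : Z -> bool -> bool).
Variables (h : hash_family m l) (ec : ec_scheme R n m leak).
Local Notation C := R[i].
Local Notation key := (hash_key h).
Hypothesis site_left : forall x' theta' z, site (fun x theta => law x theta x' theta' z).
Hypothesis site_right : forall x theta z, site (fun x' theta' => law x theta x' theta' z).
Hypothesis law_total : \sum_(x : bool) \sum_(theta : bool) \sum_(x' : bool)
  \sum_(theta' : bool) \sum_z law x theta x' theta' z = 1.
Hypothesis double_m : (2 * m <= n)%N.
Local Notation pi := (string_law law (m := m)).
Local Notation run := (bits n * bits n * bits n * bits n * {ffun 'I_n -> Z} * bool
   * ipair n m * bits leak)%type.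
Local Notation E := (expect law ec).
Local Notation guess := (run_guess flip ec).
Local Notation out := (bits l * bits l * bool * bits l)%type.
Let K : R := #|key|%:R.
Let q : R := (2 ^+ l)^-1.

Lemma powR_prod (I : Type) (r : seq I) (F : I -> R) (a : R) : (forall i, 0 <= F i) ->
  (\prod_(i <- r) F i) `^ a = \prod_(i <- r) F i `^ a.
Proof.
move=> F0; elim: r => [|i r IH]; first by rewrite !big_nil powR1.
by rewrite !big_cons powRM ?IH // prodr_ge0.
Qed.

(** Markov's inequality for a power of the likelihood. Each bit contributes [1 - s ln 2 / 2 + s^2],
    which is [unc s / 2]. *)
Lemma string_tail (s beta : R) : 0 < s -> 0 < beta ->
  \sum_y (beta < pi y)%R%:R * pi y <= beta `^ (- s) * (unc s / 2) ^+ m.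
Proof.
move=> s0 b0.
have p0 y : 0 <= pi y by exact: string_law_ge0.
apply: (@le_trans _ _ (\sum_y beta `^ (- s) * pi y `^ (1 + s))).
  apply: ler_sum => y _; case: ltP => hy /=; last by rewrite mul0r mulr_ge0 ?powR_ge0.
  have pp : 0 < pi y by exact: lt_trans hy.
  rewrite mul1r powRD ?(gt_eqF pp) ?implybT // (powRr1 (ltW pp)) powRN mulrCA -[leLHS]mulr1.
  rewrite ler_pM2l // mulrC ler_pdivlMr ?powR_gt0 // mul1r.
  by apply: (ge0_ler_powR (ltW s0)); rewrite ?nnegrE ltW.
rewrite -mulr_sumr ler_wpM2l ?powR_ge0 //.
have b0' b : 0 <= bit_law law b by exact: bit_law_ge0.
have -> : \sum_y pi y `^ (1 + s) = (\sum_b bit_law law b `^ (1 + s)) ^+ m.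
  under eq_bigr => y _ do rewrite powR_prod //.
  rewrite -(bigA_distr_bigA (fun i b => bit_law law b `^ (1 + s))).
  by rewrite prodr_const card_ord.
rewrite lerXn2r ?nnegrE ?divr_ge0 ?unc_ge0 ?sumr_ge0 ?(ltW s0) // => [b _|]; first exact: powR_ge0.
have hb := sum_bit_law site_left site_right law_total.
have hp := bit_law_spread site_left site_right law_total.
have := powR_1D_pair_le (b0' false) (b0' true) hb s0.
rewrite big_bool /= addrC => /le_trans; apply; rewrite /unc.
have l2 : 0 <= ln 2 :> R by rewrite ln_ge0 // ler1n.
have : 2^-1 * (s * ln 2) <= 4 * (bit_law law false * bit_law law true) * (s * ln 2).
  by rewrite ler_wpM2r // mulr_ge0 // ltW.
lra.
Qed.

(** Strings of large probability are charged in full, with a factor 2 because [|hdev|] sums to at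
    most 2 over the hash values. The others have square sum at most [beta], as required by the
    second moment bound. *)
Lemma hash_string_dist (beta t e : R) : 0 < t -> 0 < beta ->
  \sum_y (beta < pi y)%R%:R * pi y <= e ->
  \sum_(r : key) \sum_s `|\sum_y hdev R r s y * pi y| <=
  K * (2 * e + (t * 2 ^+ l * 2 * beta + t^-1) / 2).
Proof.
move=> t0 b0 he.
have p0 y : 0 <= pi y by exact: string_law_ge0.
pose bad y : R := (beta < pi y)%R%:R * pi y.
pose good y : R := (~~ (beta < pi y)%R)%:R * pi y.
have split y : pi y = bad y + good y.
  by rewrite /bad /good; case: ltP => _; rewrite /= ?mul1r ?mul0r ?addr0 ?add0r.
have bad0 y : 0 <= bad y by rewrite mulr_ge0.
have good0 y : 0 <= good y by rewrite mulr_ge0.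
have hgood : \sum_y good y ^+ 2 <= beta.
  rewrite -[leRHS]mulr1 -(sum_string_law m site_left site_right law_total) mulr_sumr.
  apply: ler_sum => y _; rewrite expr2 /good; case: ltP => hy /=.
    by rewrite mul0r mulr0 mulr_ge0 ?(ltW b0).
  by rewrite mul1r ler_wpM2r.
apply: (@le_trans _ _ (\sum_(r : key) \sum_s (`|\sum_y hdev R r s y * bad y| + `|\sum_y hdev R r s y * good y|))).
  apply: ler_sum => r _; apply: ler_sum => s _; apply: le_trans (ler_normD _ _).
  rewrite -big_split /= le_eqVlt; apply/orP; left; apply/eqP; congr `|_|.
  by apply: eq_bigr => y _; rewrite -mulrDr -split.
under eq_bigr => r _ do rewrite big_split.
rewrite big_split /= mulrDr; apply: lerD; last first.
  apply: (le_trans (hash_single_le h good t0)); rewrite ler_wpM2l //.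
  rewrite ler_pM2r ?invr_gt0 // lerD2r ler_wpM2l // !mulr_ge0 ?exprn_ge0 // ltW //.
apply: (@le_trans _ _ (\sum_(r : key) 2 * e)); last by rewrite sumr_const -(mulr_natl (2 * e)).
apply: ler_sum => r _.
apply: (@le_trans _ _ (\sum_s \sum_y `|hdev R r s y| * bad y)).
  apply: ler_sum => s _; apply: (le_trans (ler_norm_sum _ _ _)); apply: ler_sum => y _.
  by rewrite normrM (ger0_norm (bad0 y)).
rewrite exchange_big /=; apply: (@le_trans _ _ (\sum_y 2 * bad y)); last by rewrite -mulr_sumr ler_wpM2l.
apply: ler_sum => y _; rewrite -mulr_suml ler_wpM2r //.
apply: (@le_trans _ _ (\sum_s ((hash r y == s)%:R + q))).
  apply: ler_sum => s _; apply: (le_trans (ler_normB _ _)).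
  by rewrite !ger0_norm // invr_ge0 exprn_ge0.
rewrite big_split /= sum_bits_const divff ?expf_neq0 ?pnatr_eq0 //.
rewrite (bigD1 (hash r y)) //= eqxx big1 ?addr0 // => s /negbTE ns.
by rewrite eq_sym ns.
Qed.

Definition real_out (w : run) (t : out) : R :=
  let '(s0, s1, c, s) := t in
  (run_bit w == c)%:R * (K ^- 2 * \sum_(r0 : key) \sum_(r1 : key)
     if bob_aborts (run_short w) (guess w) then (2 ^+ l * 2 ^+ l * 2 ^+ l)^-1
     else [&& hash r0 (run_x false w) == s0, hash r1 (run_x true w) == s1
            & omap (hash (sel c r0 r1)) (guess w) == Some s]%:R).

Definition ideal_out (w : run) (t : out) : R :=
  let '(s0, s1, c, s) := t in
  (run_bit w == c)%:R * (K ^- 2 * \sum_(r0 : key) \sum_(r1 : key)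
     ((hash r0 (run_x false w) == s0)%:R * (hash r1 (run_x true w) == s1)%:R
       * (s == sel c s0 s1)%:R)).

Lemma sum_delta (T : finType) (a : T) (F : T -> R) : \sum_s (a == s)%:R * F s = F a.
Proof.
rewrite (bigD1 a) //= eqxx mul1r big1 ?addr0 // => s /negbTE ns.
by rewrite eq_sym ns mul0r.
Qed.

Lemma sum_delta1 (T : finType) (a : T) : \sum_s (a == s)%:R = 1 :> R.
Proof. by rewrite -[RHS](sum_delta a (fun=> 1)); apply: eq_bigr => s _; rewrite mulr1. Qed.

Lemma sum_out (b : bool) (phi : bool -> key -> key -> bits l -> bits l -> bits l -> R) :
  (forall c r0 r1, \sum_s0 \sum_s1 \sum_s phi c r0 r1 s0 s1 s = 1) ->
  \sum_s0 \sum_s1 \sum_c \sum_s (b == c)%:R *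
    (K ^- 2 * \sum_(r0 : key) \sum_(r1 : key) phi c r0 r1 s0 s1 s) = 1.
Proof.
move=> H.
have K0 : K != 0 by rewrite gt_eqF // (key_gt0 R h).
transitivity (K ^- 2 * \sum_(r0 : key) \sum_(r1 : key) \sum_s0 \sum_s1 \sum_s phi b r0 r1 s0 s1 s).
  under eq_bigr => s0 _ do under eq_bigr => s1 _ do
    (under eq_bigr => c _ do rewrite -mulr_sumr -mulr_sumr; rewrite sum_delta).
  under eq_bigr => s0 _ do rewrite -mulr_sumr.
  rewrite -mulr_sumr; congr (_ * _).
  under eq_bigr => s0 _ do under eq_bigr => s1 _ do rewrite exchange_big /=.
  under eq_bigr => s0 _ do rewrite exchange_big /=.
  rewrite exchange_big /=; apply: eq_bigr => r0 _.
  under eq_bigr => s0 _ do under eq_bigr => s1 _ do rewrite exchange_big /=.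
  under eq_bigr => s0 _ do rewrite exchange_big /=.
  by rewrite exchange_big.
under eq_bigr => r0 _ do under eq_bigr => r1 _ do rewrite H.
rewrite !sumr_const -[X in _ * X]mulr_natr (_ : _ * _ = K * K) //.
by rewrite -expr2 mulVf // expf_neq0.
Qed.

Lemma sum_real_out w : \sum_t real_out w t = 1.
Proof.
rewrite 3!sum_pair /real_out.
apply: (@sum_out _ (fun c r0 r1 s0 s1 s => if bob_aborts (run_short w) (guess w) then (2 ^+ l * 2 ^+ l * 2 ^+ l)^-1
     else [&& hash r0 (run_x false w) == s0, hash r1 (run_x true w) == s1
            & omap (hash (sel c r0 r1)) (guess w) == Some s]%:R)) => c r0 r1.
have L0 : 2 ^+ l != 0 :> R by rewrite expf_neq0 ?pnatr_eq0.
case: (boolP (bob_aborts (run_short w) (guess w))) => [_|].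
  by rewrite !sum_bits_const; field.
rewrite /bob_aborts negb_or => /andP[_]; case: (guess w) => [y _|//].
have E s0 s1 s : [&& hash r0 (run_x false w) == s0, hash r1 (run_x true w) == s1
            & omap (hash (sel c r0 r1)) (Some y) == Some s]%:R =
   (hash r0 (run_x false w) == s0)%:R * ((hash r1 (run_x true w) == s1)%:R * (hash (sel c r0 r1) y == s)%:R) :> R.
  by rewrite -!natrM !mulnb.
under eq_bigr => s0 _ do under eq_bigr => s1 _ do under eq_bigr => s _ do rewrite E.
under eq_bigr => s0 _ do under eq_bigr => s1 _ do rewrite -mulr_sumr -mulr_sumr sum_delta1 mulr1.
under eq_bigr => s0 _ do rewrite -mulr_sumr sum_delta1 mulr1.
exact: sum_delta1.
Qed.

Lemma sum_ideal_out w : \sum_t ideal_out w t = 1.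
Proof.
rewrite 3!sum_pair /ideal_out.
apply: (@sum_out _ (fun c r0 r1 s0 s1 s => (hash r0 (run_x false w) == s0)%:R *
   (hash r1 (run_x true w) == s1)%:R * (s == sel c s0 s1)%:R)) => c r0 r1.
under eq_bigr => s0 _ do under eq_bigr => s1 _ do
  (rewrite -mulr_sumr; under eq_bigr => s _ do rewrite eq_sym; rewrite sum_delta1 mulr1).
under eq_bigr => s0 _ do rewrite -mulr_sumr sum_delta1 mulr1.
exact: sum_delta1.
Qed.

Lemma real_out_ge0 w t : 0 <= real_out w t.
Proof.
case: t => [[[s0 s1] c] s]; rewrite !mulr_ge0 ?invr_ge0 ?exprn_ge0 //.
apply: sumr_ge0 => r0 _; apply: sumr_ge0 => r1 _; case: ifP => // _.
by rewrite invr_ge0 !mulr_ge0 ?exprn_ge0.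
Qed.

Lemma ideal_out_ge0 w t : 0 <= ideal_out w t.
Proof.
case: t => [[[s0 s1] c] s]; rewrite !mulr_ge0 ?invr_ge0 ?exprn_ge0 //.
by apply: sumr_ge0 => r0 _; apply: sumr_ge0 => r1 _; rewrite !mulr_ge0.
Qed.

Definition run_bad (w : run) : bool :=
  run_short w || (guess w != Some (sel (run_bit w) (run_x false w) (run_x true w))).

Lemma real_out_good w t : ~~ run_bad w -> real_out w t = ideal_out w t.
Proof.
rewrite /run_bad negb_or negbK => /andP[/negbTE ns /eqP gw].
case: t => [[[s0 s1] c] s]; rewrite /real_out /ideal_out gw /bob_aborts ns /=.
case: eqP => [<-|_]; last by rewrite !mul0r.
congr (_ * (_ * _)); apply: eq_bigr => r0 _; apply: eq_bigr => r1 _.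
rewrite -!natrM !mulnb; congr (nat_of_bool _)%:R.
rewrite -andbA; case: (hash r0 _ =P s0) => //= <-; case: (hash r1 _ =P s1) => //= <-.
by case: (run_bit w) => /=; rewrite (eq_sym s); apply/eqP/eqP => [[]|->].
Qed.

(** The two outputs are coupled run by run: they have the same law on good runs, and on a bad one
    two probability laws differ by at most 2. *)
Lemma real_ideal_dist : \sum_t `|E (real_out^~ t) - E (ideal_out^~ t)| <=
  2 * E (fun w => (run_bad w)%:R).
Proof.
apply: (@le_trans _ _ (\sum_t \sum_w run_prob law ec w * `|real_out w t - ideal_out w t|)).
  apply: ler_sum => t _; rewrite /expect -sumrB.
  apply: (le_trans (ler_norm_sum _ _ _)); apply: ler_sum => w _.
  by rewrite -mulrBr normrM (ger0_norm (run_prob_ge0 _ site_left _)).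
rewrite exchange_big mulr_sumr /=; apply: ler_sum => w _.
rewrite -mulr_sumr mulrCA ler_wpM2l ?(run_prob_ge0 _ site_left) //.
have [bad|good] := boolP (run_bad w); last first.
  by rewrite big1 ?mulr0 // => t _; rewrite real_out_good // subrr normr0.
rewrite mulr1; apply: (@le_trans _ _ (\sum_t (real_out w t + ideal_out w t))).
  apply: ler_sum => t _; apply: (le_trans (ler_normB _ _)).
  by rewrite !ger0_norm ?real_out_ge0 ?ideal_out_ge0.
by rewrite big_split /= sum_real_out sum_ideal_out.
Qed.

Definition uniform_out (t : out) : R :=
  let '(s0, s1, c, s) := t in (s == sel c s0 s1)%:R * (2^-1 * (q * q)).

(** Strings and keys are independent for the two indices, so replacing the hash values one after the
    other costs the error of a single hash twice. *)
Lemma ideal_uniform_dist (e : R) :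
  \sum_(r : key) \sum_s `|\sum_y hdev R r s y * pi y| <= K * e ->
  \sum_t `|E (ideal_out^~ t) - uniform_out t| <= 2 * e.
Proof.
move=> he.
have K0 : 0 < K by exact: (key_gt0 R h).
pose P (r : key) s : R := \sum_y (hash r y == s)%:R * pi y.
have PE r s : P r s - q = \sum_y hdev R r s y * pi y.
  under [RHS]eq_bigr => y _ do rewrite mulrBl.
  by rewrite sumrB -mulr_sumr (sum_string_law m site_left site_right law_total) mulr1.
have P0 r s : 0 <= P r s by apply: sumr_ge0 => y _; rewrite mulr_ge0 ?string_law_ge0.
have P1 r : \sum_s P r s = 1.
  rewrite exchange_big /= -[RHS](sum_string_law m site_left site_right law_total).
  by apply: eq_bigr => y _; rewrite -mulr_suml sum_delta1 mul1r.
have q0 : 0 <= q by rewrite invr_ge0 exprn_ge0.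
have KV0 : 0 <= K ^- 2 by rewrite invr_ge0 exprn_ge0 ?(ltW K0).
have Eid s0 s1 c s : E (ideal_out^~ (s0, s1, c, s)) =
    (s == sel c s0 s1)%:R * (2^-1 * (K ^- 2 * \sum_(r0 : key) \sum_(r1 : key) P r0 s0 * P r1 s1)).
  rewrite (expect_strings ec site_left site_right law_total (fun b x0 x1 => (b == c)%:R * (K ^- 2 * \sum_(r0 : key) \sum_(r1 : key)
     ((hash r0 x0 == s0)%:R * (hash r1 x1 == s1)%:R * (s == sel c s0 s1)%:R))) double_m).
  rewrite [RHS]mulrCA; congr (_ * _).
  under eq_bigr => b _ do under eq_bigr => y0 _ do under eq_bigr => y1 _ do rewrite mulrCA.
  under eq_bigr => b _ do (under eq_bigr => y0 _ do rewrite -mulr_sumr; rewrite -mulr_sumr eq_sym).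
  rewrite sum_delta mulrCA.
  under eq_bigr => y0 _ do under eq_bigr => y1 _ do rewrite mulrCA.
  under eq_bigr => y0 _ do rewrite -mulr_sumr; rewrite -mulr_sumr; congr (_ * _).
  rewrite mulr_sumr.
  under eq_bigr => y0 _ do (under eq_bigr => y1 _ do rewrite mulr_sumr; rewrite exchange_big /=).
  rewrite exchange_big /=; apply: eq_bigr => r0 _.
  rewrite mulr_sumr.
  under eq_bigr => y0 _ do (under eq_bigr => y1 _ do rewrite mulr_sumr; rewrite exchange_big /=).
  rewrite exchange_big /=; apply: eq_bigr => r1 _.
  rewrite /P big_distrlr /= mulr_sumr; apply: eq_bigr => y0 _; rewrite mulr_sumr.
  by apply: eq_bigr => y1 _; ring.
rewrite 3!sum_pair.
apply: (@le_trans _ _ (\sum_s0 \sum_s1 K ^- 2 * \sum_(r0 : key) \sum_(r1 : key)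
   (`|P r0 s0 - q| * P r1 s1 + q * `|P r1 s1 - q|))).
  apply: ler_sum => s0 _; apply: ler_sum => s1 _.
  set B := \sum_(r0 : key) _.
  apply: (@le_trans _ _ (\sum_(c : bool) 2^-1 * (K ^- 2 * B))); last first.
    by rewrite big_bool /= -mulrDl (_ : 2^-1 + 2^-1 = 1) ?mul1r //; field.
  apply: ler_sum => c _; under eq_bigr => s _ do rewrite Eid -mulrBr normrM ger0_norm // eq_sym.
  rewrite sum_delta -mulrBr normrM ger0_norm ?invr_ge0 // ler_wpM2l ?invr_ge0 //.
  have -> : q * q = K ^- 2 * \sum_(r0 : key) \sum_(r1 : key) q * q.
    rewrite !sumr_const -!(mulr_natl (q * q)) -(mulr_natl (_ * (q * q))) -/K.
    by field; rewrite gt_eqF.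
  rewrite -mulrBr normrM (ger0_norm KV0) ler_wpM2l //.
  rewrite -sumrB; apply: (le_trans (ler_norm_sum _ _ _)); apply: ler_sum => r0 _.
  rewrite -sumrB; apply: (le_trans (ler_norm_sum _ _ _)); apply: ler_sum => r1 _.
  have -> : P r0 s0 * P r1 s1 - q * q = (P r0 s0 - q) * P r1 s1 + q * (P r1 s1 - q) by ring.
  apply: (le_trans (ler_normD _ _)); rewrite !normrM.
  by rewrite (ger0_norm (P0 r1 s1)) (ger0_norm q0).
have -> : \sum_s0 \sum_s1 K ^- 2 * \sum_(r0 : key) \sum_(r1 : key)
   (`|P r0 s0 - q| * P r1 s1 + q * `|P r1 s1 - q|) =
  K ^- 2 * \sum_(r0 : key) \sum_(r1 : key) (\sum_s `|P r0 s - q| + \sum_s `|P r1 s - q|).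
  under eq_bigr => s0 _ do rewrite -mulr_sumr; rewrite -mulr_sumr; congr (_ * _).
  under eq_bigr => s0 _ do rewrite exchange_big /=.
  rewrite exchange_big /=; apply: eq_bigr => r0 _.
  under eq_bigr => s0 _ do rewrite exchange_big /=.
  rewrite exchange_big /=; apply: eq_bigr => r1 _.
  under eq_bigr => s0 _ do rewrite big_split /= -mulr_sumr P1 mulr1 -mulr_sumr.
  rewrite big_split /= sum_bits_const mulrA divff ?mul1r // expf_neq0 ?pnatr_eq0 //.
under eq_bigr => r0 _ do rewrite big_split /= sumr_const.
rewrite big_split /= sumr_const -sumrMnl -/K.
have {}he : \sum_(r : key) \sum_s `|P r s - q| <= K * e.
  by apply: le_trans he; rewrite le_eqVlt; apply/orP; left; apply/eqP;
     apply: eq_bigr => r _; apply: eq_bigr => s _; rewrite PE.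
rewrite sumrMnl; set D := \sum_(r : key) _ in he *.
rewrite -mulr2n -!(mulr_natl D) -(mulr_natl (_ * D)) -/K.
apply: (@le_trans _ _ (K ^- 2 * (2 * (K * (K * e))))).
  rewrite ler_wpM2l //.
  have : K * D <= K * (K * e) by rewrite ler_pM2l.
  lra.
rewrite le_eqVlt; apply/orP; left; apply/eqP; field; by rewrite gt_eqF.
Qed.

End Correctness.

Section HonestOutput.
Variables (R : realType) (n m l leak : nat).
Variables (dev : honest_device R) (h : hash_family m l) (ec : ec_scheme R n m leak).
Local Notation C := R[i].
Local Notation key := (hash_key h).
Local Notation law := (@round_lawR R dev).
Local Notation flip := (@hd_flip R dev).
Local Notation out := (bits l * bits l * bool * bits l)%type.

Lemma gram1 d : gram (1%:M : 'M[C]_d).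
Proof. by exists d, 1%:M; rewrite tr_scalar_mx map_scalar_mx /= conjC1 mul1mx. Qed.

Lemma tracenorm_scalar_le (r : R) : tracenorm ((r%:C)%:M : 'M[C]_1) <= `|r|%:C.
Proof.
have [W hW ->] := tracenormP ((r%:C)%:M : 'M[C]_1).
rewrite lecR -scalemx1 -scalemxAr rtrZ.
apply: (le_trans (ler_norm _)); rewrite normrM -[leRHS]mulr1 ler_wpM2l //.
by apply: (le_trans (norm_rtr_contraction hW (gram1 1))); rewrite /rtr mxtrace1.
Qed.

Lemma trdist_scalar_le (T : finType) (f g : T -> R) :
  trdist (fun t => ((f t)%:C)%:M : 'M[C]_1) (fun t => ((g t)%:C)%:M) <=
  (2^-1 * \sum_t `|f t - g t|)%:C.
Proof.
rewrite /trdist rmorphM fmorphV rmorph_nat ler_wpM2l ?invr_ge0 // rmorph_sum.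
by apply: ler_sum => t _; rewrite -raddfB -rmorphB tracenorm_scalar_le.
Qed.

Lemma honest_expectationE (f : bool -> bits m -> bits m -> bool -> option (bits m) -> R) :
  honest_expectation dev ec (fun sh x0 x1 c g => (f sh x0 x1 c g)%:C) =
  (expect law ec (fun w => f (run_short w) (run_x false w) (run_x true w) (run_bit w)
     (run_guess flip ec w)))%:C.
Proof.
rewrite -run_sumE; apply: eq_bigr => x _; apply: eq_bigr => theta _; apply: eq_bigr => x' _.
apply: eq_bigr => theta' _; apply: eq_bigr => z _; congr (_ * _).
by apply: eq_bigr => i _; exact: round_lawE.
Qed.

Lemma honest_outputE (t : out) :
  honest_output dev h ec t = ((expect law ec (fun w => real_out flip h ec w t))%:C)%:M.
Proof.
case: t => [[[s0 s1] c] s]; rewrite /honest_output.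
rewrite -(honest_expectationE (fun sh x0 x1 c' guess => (c' == c)%:R *
   (#|key|%:R ^- 2 * \sum_(r0 : key) \sum_(r1 : key)
     if bob_aborts sh guess then (2 ^+ l * 2 ^+ l * 2 ^+ l)^-1
     else [&& hash r0 x0 == s0, hash r1 x1 == s1
            & omap (hash (sel c r0 r1)) guess == Some s]%:R))).
congr (honest_expectation _ _ _)%:M.
apply/funext => sh; apply/funext => x0; apply/funext => x1; apply/funext => c'.
apply/funext => g; rewrite [RHS]rmorphM [X in _ = X * _]rmorph_nat; congr (_ * _).
rewrite [RHS]rmorphM [X in _ = X * _]fmorphV [X in _ = X^-1 * _]rmorphXn [X in _ = (X ^+ _)^-1 * _]rmorph_nat -natrX; congr (_ * _).
rewrite [RHS]rmorph_sum; apply: eq_bigr => r0 _; rewrite rmorph_sum; apply: eq_bigr => r1 _.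
case: ifP => _; last by rewrite rmorph_nat.
by rewrite fmorphV !rmorphM !rmorphXn !rmorph_nat -!natrX -!natrM !mulnA.
Qed.

Lemma expect_bad_le (eps : R) : (2 * m <= n)%N ->
  (forall theta : bits n, \sum_(t : bits n) (#|agree theta t| < m)%N%:R <= 2 ^+ n * eps) ->
  ec_reliable dev ec eps ->
  expect law ec (fun w => (run_bad flip ec w)%:R) <= 3 * eps.
Proof.
move=> mn tail [].
have nat_fun (b : bool -> bits m -> bits m -> bool -> option (bits m) -> bool) :
   honest_expectation dev ec (fun sh x0 x1 c g => (b sh x0 x1 c g)%:R) =
   honest_expectation dev ec (fun sh x0 x1 c g => ((b sh x0 x1 c g)%:R : R)%:C).
  congr (honest_expectation _ _ _).
  apply/funext => sh; apply/funext => x0; apply/funext => x1; apply/funext => c'.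
  by apply/funext => g; rewrite rmorph_nat.
rewrite /ec_abort_probability /ec_failure_probability !nat_fun !honest_expectationE !lecR.
have := expect_short ec (@site_left _ dev) (@site_right _ dev) (@round_lawR_total _ dev) mn tail.
set es := expect _ _ _; set ea := expect _ _ _; set ef := expect _ _ _ => hs ha hf.
have : expect law ec (fun w => (run_bad flip ec w)%:R) <= es + ea + ef.
  rewrite /es /ea /ef /expect -!big_split /=; apply: ler_sum => w _.
  rewrite -!mulrDr ler_wpM2l ?(run_prob_ge0 _ (@site_left _ dev)) //.
  rewrite -!natrD ler_nat /run_bad; case: (run_short w) => //=.
  by case: (run_guess _ _ _).
lra.
Qed.

Lemma honest_correct (eps t beta e1 e : R) : 0 < t -> 0 < beta -> (2 * m <= n)%N ->
  (forall theta : bits n, \sum_(t : bits n) (#|agree theta t| < m)%N%:R <= 2 ^+ n * eps) ->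
  ec_reliable dev ec eps ->
  \sum_y (beta < string_law law (m := m) y)%R%:R * string_law law y <= e1 ->
  3 * eps + 2 * e1 + (t * 2 ^+ l * 2 * beta + t^-1) / 2 <= e ->
  ot_correct e (honest_output dev h ec).
Proof.
move=> t0 b0 mn tail rel he1 he.
have L0 : 2 ^+ l != 0 :> R by rewrite expf_neq0 ?pnatr_eq0.
pose u : R := 2^-1 * ((2 ^+ l)^-1 * (2 ^+ l)^-1).
have uE : u%:C = (2 ^ l * 2 ^ l * 2)%N%:R^-1.
  by rewrite /u -!invfM fmorphV !rmorphM !rmorphXn !rmorph_nat -!natrX -!natrM mulnC.
exists (fun=> (u%:C)%:M); split => //; last 2 first.
- by move=> s0 s1 c; rewrite uE.
- have -> : honest_output dev h ec = fun t => ((expect law ec (fun w => real_out flip h ec w t))%:C)%:M.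
    by apply/funext => w; exact: honest_outputE.
  have -> : (fun '(s0, s1, c, s) => if s == sel c s0 s1 then (u%:C)%:M else 0) =
     fun t : out => ((uniform_out R t)%:C)%:M :> 'M[C]_1.
    apply/funext => -[[[s0 s1] c] s]; rewrite /uniform_out -/u.
    by case: eqP; rewrite /= ?mul1r // mul0r raddf0.
  apply: (le_trans (trdist_scalar_le _ _)); rewrite lecR.
  have H1 := real_ideal_dist flip h ec (@site_left _ dev).
  have H2 := expect_bad_le mn tail rel.
  have H3 := ideal_uniform_dist ec (@site_left _ dev) (@site_right _ dev) (@round_lawR_total _ dev) mn
     (hash_string_dist h (@site_left _ dev) (@site_right _ dev) (@round_lawR_total _ dev) t0 b0 he1).
  set E1 := expect law ec (fun w => (run_bad flip ec w)%:R) in H1 H2.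
  set Dr := \sum_t _ in H1; set Du := \sum_t _ in H3.
  set Da := \sum_t _.
  suff : Da <= Dr + Du by lra.
  rewrite /Da /Dr /Du -big_split /=; apply: ler_sum => w _.
  by apply: le_trans (ler_normD _ _); rewrite addrA subrK.
split=> [w|].
  apply: gram_psd; rewrite -scalemx1; apply: gramZ; last exact: gram1.
  by rewrite ler0c !mulr_ge0 ?invr_ge0 ?exprn_ge0.
under eq_bigr => w _ do rewrite mxtrace_scalar mulr1n.
rewrite sumr_const -[LHS]mulr_natr uE !card_prod card_bool -!mulnA !card_bits mulVf //.
by rewrite pnatr_eq0 -lt0n !muln_gt0 !expn_gt0.
Qed.

End HonestOutput.

(** * Security for Alice *)

Section Decoupling.
Variables (R : realType) (m l : nat) (h : hash_family m l).
Local Notation C := R[i].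
Local Notation key := (hash_key h).
Local Notation HK := (key * key * (bits l * bits l))%type.
Local Notation XX := (bits m * bits m)%type.
Let K : R := #|key|%:R.
Let q : R := (2 ^+ l)^-1.

(* Bob's choice bit is c: the hash value of the string with index ~~ c is
   compared with a uniform one, and coord c picks that string. *)
Definition hcoef (c : bool) (t : HK) (x : XX) : R :=
  if c then hdev R t.1.1 t.2.1 x.1 * (hash t.1.2 x.2 == t.2.2)%:R
  else (hash t.1.1 x.1 == t.2.1)%:R * hdev R t.1.2 t.2.2 x.2.

Definition coord (c : bool) (x : XX) : bits m := if c then x.1 else x.2.

Lemma sum_fst (V : nmodType) (A B : finType) (z : A) (F : A * B -> V) :
  \sum_(x | x.1 == z) F x = \sum_b F (z, b).
Proof.
rewrite big_mkcond sum_pair (bigD1 z) //= [X in _ + X]big1 => [|a /negbTE na]; last by rewrite na big1.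
by rewrite addr0; apply: eq_bigr => b _; rewrite eqxx.
Qed.

Lemma sum_snd (V : nmodType) (A B : finType) (z : B) (F : A * B -> V) :
  \sum_(x | x.2 == z) F x = \sum_a F (a, z).
Proof. by rewrite big_mkcond sum_pair; apply: eq_bigr => a _; rewrite -big_mkcond big_pred1_eq. Qed.

Lemma hash_joint_pair c (y : XX -> C) :
  \sum_t sqn (\sum_x (hcoef c t x)%:C * y x) <=
  K ^+ 2 * (4 * (\sum_x sqn (y x)) + 2 * q * \sum_z sqn (\sum_(x | coord c x == z) y x)).
Proof.
case: c => /=; last first.
  have := hash_joint_le h (fun x0 x1 => y (x0, x1)).
  rewrite -/K -/q 2!sum_pair; rewrite [X in _ -> _ <= _ * (_ + _ * X)](eq_bigr (fun z => sqn (\sum_a y (a, z)))) => [|z _]; last by rewrite sum_snd.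
  congr (_ <= _ * (4 * _ + _)); last by rewrite sum_pair.
  apply: eq_bigr => r0 _; apply: eq_bigr => r1 _; rewrite sum_pair; apply: eq_bigr => s0 _.
  by apply: eq_bigr => s1 _; congr (sqn _); rewrite sum_pair.
have := hash_joint_le h (fun x0 x1 => y (x1, x0)).
rewrite -/K -/q 2!sum_pair; rewrite [X in _ -> _ <= _ * (_ + _ * X)](eq_bigr (fun z => sqn (\sum_a y (z, a)))) => [|z _]; last by rewrite sum_fst.
congr (_ <= _ * (4 * _ + _)); last by rewrite sum_pair exchange_big.
rewrite exchange_big; apply: eq_bigr => r0 _; apply: eq_bigr => r1 _.
rewrite sum_pair exchange_big; apply: eq_bigr => s0 _.
apply: eq_bigr => s1 _; congr (sqn _); rewrite sum_pair exchange_big.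
by apply: eq_bigr => x0 _; apply: eq_bigr => x1 _; rewrite (mulrC (_ == _)%:R).
Qed.

Lemma hash_joint_mx c d e (B : XX -> 'M[C]_(d, e)) :
  \sum_t fn (\sum_x (hcoef c t x)%:C *: B x) <=
  K ^+ 2 * (4 * (\sum_x fn (B x)) + 2 * q * \sum_z fn (\sum_(x | coord c x == z) B x)).
Proof.
have ent (P : pred XX) (F : XX -> C) i j :
    (\sum_(x | P x) F x *: B x) i j = \sum_(x | P x) F x * B x i j.
  by rewrite summxE; apply: eq_bigr => x _; rewrite mxE.
rewrite /fn exchange_big /=.
have -> : \sum_x \sum_i \sum_j sqn (B x i j) = \sum_i \sum_j \sum_x sqn (B x i j).
  by rewrite exchange_big; apply: eq_bigr => i _; rewrite exchange_big.
have -> : \sum_z \sum_i \sum_j sqn ((\sum_(x | coord c x == z) B x) i j) =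
   \sum_i \sum_j \sum_z sqn (\sum_(x | coord c x == z) B x i j).
  rewrite exchange_big; apply: eq_bigr => i _; rewrite exchange_big; apply: eq_bigr => j _.
  by apply: eq_bigr => z _; rewrite summxE.
rewrite !mulr_sumr -big_split mulr_sumr /=; apply: ler_sum => i _.
rewrite exchange_big !mulr_sumr -big_split mulr_sumr /=; apply: ler_sum => j _.
by under eq_bigr => t _ do rewrite ent; exact: hash_joint_pair.
Qed.

Section Class.
Variables (I : finType) (u : I -> XX) (d d' : nat) (c : bool) (A : I -> 'M[C]_d) (p1 p2 : R).
Hypothesis gramA : forall i, gram (A i).
Hypothesis joint_le : forall x, \sum_(i | u i == x) rtr (A i) <= p2.
Hypothesis marginal_le : forall z, \sum_(i | coord c (u i) == z) rtr (A i) <= p1.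

Lemma gram_trace_ge0 (k : 'M[C]_(d', d)) i : 0 <= rtr (k *m A i *m k^t*).
Proof. by apply: gram_rtr_ge0; apply: gram_kraus. Qed.

(** In the Cauchy-Schwarz bound [fn_gramM] one factor is a plain trace, controlled by the joint or
    marginal weight; the other keeps the Kraus operator, so that summing over [k] gives back a
    probability and no second dimension factor. *)
Lemma fn_class_le (k : 'M[C]_(d', d)) :
  \sum_t fn ((\sum_i (hcoef c t (u i))%:C *: A i) *m k^t*) <=
  K ^+ 2 * ((4 * p2 + 2 * q * p1) * rtr (k *m (\sum_i A i) *m k^t*)).
Proof.
pose B x : 'M[C]_(d, d') := \sum_(i | u i == x) A i *m k^t*.
have e1 t : (\sum_i (hcoef c t (u i))%:C *: A i) *m k^t* = \sum_x (hcoef c t x)%:C *: B x.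
  rewrite mulmx_suml (partition_big u xpredT) //=; apply: eq_bigr => x _.
  by rewrite /B scaler_sumr; apply: eq_bigr => i /eqP ->; rewrite -scalemxAl.
have cs (P : pred I) (b : R) : \sum_(i | P i) rtr (A i) <= b ->
    fn (\sum_(i | P i) A i *m k^t*) <= b * \sum_(i | P i) rtr (k *m A i *m k^t*).
  move=> hb; rewrite -mulmx_suml.
  apply: (le_trans (fn_gramM _ (gram_sum _ (fun i _ => gramA i)))).
  have -> : rtr ((k^t*)^t* *m (\sum_(i | P i) A i) *m k^t*) = \sum_(i | P i) rtr (k *m A i *m k^t*).
    by rewrite trmxCK mulmx_sumr mulmx_suml rtr_sum.
  by rewrite rtr_sum ler_wpM2r // sumr_ge0 // => i _; exact: gram_trace_ge0.
under eq_bigr => t _ do rewrite e1.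
apply: (le_trans (hash_joint_mx c B)); rewrite -/K -/q ler_wpM2l ?sqr_ge0 //.
have q0 : 0 <= 2 * q by rewrite mulr_ge0 // invr_ge0 exprn_ge0.
have tot : rtr (k *m (\sum_i A i) *m k^t*) = \sum_i rtr (k *m A i *m k^t*).
  by rewrite mulmx_sumr mulmx_suml rtr_sum.
rewrite tot (mulrDl (4 * p2)); apply: lerD.
  rewrite -mulrA ler_wpM2l // (partition_big u xpredT) //= mulr_sumr.
  by apply: ler_sum => x _; exact: cs.
rewrite -(mulrA (2 * q)) ler_wpM2l // (partition_big (fun i => coord c (u i)) xpredT) //= mulr_sumr.
apply: ler_sum => z _.
have -> : \sum_(x | coord c x == z) B x = \sum_(i | coord c (u i) == z) A i *m k^t*.
  rewrite [RHS](partition_big u (fun x => coord c x == z)) //=; apply: eq_bigr => x /eqP xz.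
  by apply: eq_bigl => i; case: (u i =P x) => [->|]; rewrite ?andbF // xz eqxx.
exact: cs.
Qed.

Variables (J : finType) (Psi : instrument R J d d').

(** Each term is split as [V s *m k] times the rest: the first factor is bounded by [fn k], whatever
    the keys, and the hash estimate applies to the second. Scaling by [M] lets a single [t] serve
    all outcomes. *)
Lemma class_outcome_le (b : J) (V : HK -> 'M[C]_d') (M t : R) : 0 < M -> 0 < t ->
  4 * p2 + 2 * q * p1 <= M -> (forall s, contraction (V s)) ->
  \sum_s rtr (V s *m apply_instr Psi b (\sum_i (hcoef c s (u i))%:C *: A i)) <=
  K ^+ 2 * ((t * (2 ^+ l * 2 ^+ l) * (M * \sum_j fn (@kraus _ _ _ _ Psi b j))
             + rtr (apply_instr Psi b (\sum_i A i)) / t) / 2).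
Proof.
move=> M0 t0 hM hV; pose S s := \sum_i (hcoef c s (u i))%:C *: A i.
apply: (@le_trans _ _ (\sum_s \sum_j (t * M * fn (@kraus _ _ _ _ Psi b j)
   + fn (S s *m (@kraus _ _ _ _ Psi b j)^t*) / (t * M)) / 2)).
  apply: ler_sum => s _; rewrite /apply_instr mulmx_sumr rtr_sum; apply: ler_sum => j _.
  rewrite -!mulmxA mulmxA.
  apply: (le_trans (rtr_AMGM _ _ (mulr_gt0 t0 M0))).
  rewrite ler_pM2r ?invr_gt0 // lerD2r ler_wpM2l ?hV //.
  by rewrite ltW // mulr_gt0.
rewrite exchange_big /=; under eq_bigr => j _ do rewrite -mulr_suml big_split /= -mulr_suml.
rewrite -[leLHS]mulr_suml mulrA ler_wpM2r ?invr_ge0 // big_split /= mulrDr; apply: lerD.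
  under eq_bigr => j _ do rewrite sumr_const -mulr_natr.
  rewrite -[leLHS]mulr_sumr !card_prod !card_bits !natrM !natrX -/K.
  by rewrite le_eqVlt; apply/orP; left; apply/eqP; ring.
rewrite /apply_instr rtr_sum mulr_suml mulr_sumr; apply: ler_sum => j _.
rewrite -[leLHS]mulr_suml ler_pdivrMr ?mulr_gt0 //; set r := rtr _.
have -> : K ^+ 2 * (r / t) * (t * M) = K ^+ 2 * (M * r) by field; rewrite gt_eqF.
apply: (le_trans (fn_class_le _)); rewrite ler_wpM2l ?sqr_ge0 // ler_wpM2r //.
apply: gram_rtr_ge0; apply: gram_kraus; exact: gram_sum.
Qed.

End Class.

(** The trace of the completeness relation; here the dimension of the memory enters. *)
Lemma sum_fn_kraus (J : finType) d d' (Psi : instrument R J d d') :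
  \sum_b \sum_j fn (@kraus _ _ _ _ Psi b j) = d%:R.
Proof.
transitivity (rtr (1%:M : 'M[C]_d)); last by rewrite /rtr mxtrace1 natr_embed.
rewrite -(kraus_complete Psi) rtr_sum; apply: eq_bigr => b _; rewrite rtr_sum.
by apply: eq_bigr => j _; rewrite rtrC rtr_gram.
Qed.

End Decoupling.

(** * The two classes of strings defining Bob's choice bit *)

Section ClassSum.
Local Arguments part : simpl never.
Variables (R : realType) (n m l leak : nat) (h : hash_family m l) (ec : ec_scheme R n m leak).
Variables (Mf : finType) (d d' : nat) (Psi : instrument R (ipair n m * Mf)%type d d').
Variables (theta : bits n) (W : bits n -> 'M[R[i]]_d) (w : R).
Local Notation C := R[i].
Local Notation key := (hash_key h).
Local Notation HK := (key * key * (bits l * bits l))%type.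
Hypothesis gramW : forall y, gram (W y).
Hypothesis sum_W : \sum_y rtr (W y) = w.
Let K : R := #|key|%:R.
Let q : R := (2 ^+ l)^-1.

Definition halves (p : ipair n m) (y : bits n) : bits m * bits m :=
  (restr m (part p false) y, restr m (part p true) y).

Definition encY (p : ipair n m) (y : bits n) (o : bits leak) : R :=
  encR ec theta p (halves p y).1 (halves p y).2 o.

Lemma encY_ge0 p y o : 0 <= encY p y o.
Proof. exact: encR_ge0. Qed.

Lemma sum_encY p y : \sum_o encY p y o = 1.
Proof. exact: sum_encR. Qed.

Lemma encY_le1 p y o : encY p y o <= 1.
Proof.
rewrite -(sum_encY p y) (bigD1 o) //= lerDl sumr_ge0 // => o' _; exact: encY_ge0.
Qed.

Lemma mass_ge0 y : 0 <= rtr (W y).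
Proof. exact: gram_rtr_ge0. Qed.

(** Of the two terms of the arithmetic mean, one sums over the code words to [Mt] and over the
    outcomes to [d]; the other sums to at most [w], because a class is a part of the whole
    ensemble. *)
Lemma class_sum_le (c : bool) (g : ipair n m -> bits leak -> pred (bits n))
    (p1 p2 M : ipair n m -> bits leak -> R) (Mt t : R)
    (V : ipair n m * Mf -> bits leak -> HK -> 'M[C]_d') :
  0 < t -> (forall p o, 0 < M p o) ->
  (forall p o, 4 * p2 p o + 2 * q * p1 p o <= M p o) ->
  (forall p, \sum_o M p o <= Mt) ->
  (forall p o x, \sum_(y | halves p y == x) (g p o y)%:R * encY p y o * rtr (W y) <= p2 p o) ->
  (forall p o z, \sum_(y | coord c (halves p y) == z)
      (g p o y)%:R * encY p y o * rtr (W y) <= p1 p o) ->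
  (forall b o s, contraction (V b o s)) ->
  \sum_b \sum_o \sum_s rtr (V b o s *m apply_instr Psi b
     (\sum_y (hcoef R c s (halves b.1 y))%:C *: (((g b.1 o y)%:R * encY b.1 y o)%:C *: W y))) <=
  K ^+ 2 * ((t * (2 ^+ l * 2 ^+ l) * (Mt * d%:R) + w / t) / 2).
Proof.
move=> t0 M0 hM hMt joint marg hV.
pose A p o y : 'M[C]_d := ((g p o y)%:R * encY p y o)%:C *: W y.
have gA p o y : gram (A p o y) by apply: gramZ => //; rewrite ler0c mulr_ge0 ?encY_ge0.
have joint' p o x : \sum_(y | halves p y == x) rtr (A p o y) <= p2 p o.
  by under eq_bigr => y _ do rewrite rtrZ.
have marg' p o z : \sum_(y | coord c (halves p y) == z) rtr (A p o y) <= p1 p o.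
  by under eq_bigr => y _ do rewrite rtrZ.
have one b o := class_outcome_le (gA b.1 o) (joint' b.1 o) (marg' b.1 o) Psi b (M0 b.1 o) t0
  (hM b.1 o) (hV b o).
apply: (le_trans (ler_sum _ (fun b _ => ler_sum _ (fun o _ => one b o)))).
under eq_bigr => b _ do rewrite -mulr_sumr -mulr_suml big_split /= -mulr_sumr -!mulr_suml.
rewrite -mulr_sumr -mulr_suml big_split /= -mulr_sumr -mulr_suml -/K.
rewrite ler_wpM2l ?sqr_ge0 // ler_wpM2r ?invr_ge0 //; apply: lerD.
  rewrite ler_wpM2l ?mulr_ge0 ?exprn_ge0 ?(ltW t0) //.
  rewrite -(sum_fn_kraus Psi) mulr_sumr; apply: ler_sum => b _.
  by rewrite ler_wpM2r // sumr_ge0 // => j _; exact: fn_ge0.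
rewrite ler_wpM2r ?invr_ge0 ?(ltW t0) // -sum_W.
apply: (@le_trans _ _ (\sum_b \sum_y rtr (apply_instr Psi b (W y)))); last first.
  by rewrite exchange_big /=; under eq_bigr => y _ do rewrite rtr_apply.
apply: ler_sum => b _.
have ap o : rtr (apply_instr Psi b (\sum_y A b.1 o y)) =
    \sum_y (g b.1 o y)%:R * encY b.1 y o * rtr (apply_instr Psi b (W y)).
  by rewrite apply_instr_sum rtr_sum; apply: eq_bigr => y _; rewrite rtrZ.
under eq_bigr => o _ do rewrite ap.
rewrite exchange_big /=; apply: ler_sum => y _; rewrite -mulr_suml.
have r0 : 0 <= rtr (apply_instr Psi b (W y)) by apply: gram_rtr_ge0; exact: gram_apply.
rewrite -[leRHS]mul1r ler_wpM2r //.
apply: (@le_trans _ _ (\sum_o encY b.1 y o)); last by rewrite sum_encY.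
apply: ler_sum => o _.
by case: (g _ _ _); rewrite ?mul1r // mul0r encY_ge0.
Qed.

Variables (beta tau : R).
Hypothesis beta_gt0 : 0 < beta.
Hypothesis tau_gt0 : 0 < tau.
Hypothesis beta_tau : 2 ^+ leak * (2 ^+ (n - 2 * m) * beta) <= tau ^+ 2.

(** When the total mass vanishes no string is good, so both classes are empty and the hashing bound
    is needed only for positive mass. *)
Definition good (y : bits n) : bool := (0 < w) && (rtr (W y) <= beta * w).

Definition good_weight p o : R := \sum_(y | good y) encY p y o * rtr (W y).

Definition good_marginal p o (z : bits m) : R :=
  \sum_(y | good y && ((halves p y).2 == z)) encY p y o * rtr (W y).

(* A heavy second string is the one that Bob is able to guess; its marginal
   stays above a threshold, so that few of them exist. *)
Definition heavy p o (y : bits n) : bool :=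
  tau * good_weight p o < good_marginal p o (halves p y).2.

(* The class is Bob's choice bit C. Strings that are not good are too likely for
   the hash functions to help; their total weight is small by the uncertainty
   relation. *)
Definition in_class (c : bool) p o y : bool := good y && (heavy p o y == c).

(** The bits outside [I_0] and [I_1] are free: a pair of substrings has [2^(n - 2 m)] extensions,
    each of weight at most [beta * w]. *)
Let p2 : R := 2 ^+ (n - 2 * m) * (beta * w).
(** In the heavy class at most [1 / tau] second strings occur, each jointly with a given first
    string of weight at most [p2]. *)
Definition class_marginal (c : bool) p o : R := if c then p2 / tau else tau * good_weight p o.

Lemma term_ge0 p o y : 0 <= encY p y o * rtr (W y).
Proof. by rewrite mulr_ge0 ?encY_ge0 ?mass_ge0. Qed.

Lemma w_ge0 : 0 <= w.
Proof. by rewrite -sum_W; apply: sumr_ge0 => y _; exact: mass_ge0. Qed.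

Lemma good_weight_ge0 p o : 0 <= good_weight p o.
Proof. by apply: sumr_ge0 => y _; exact: term_ge0. Qed.

Lemma good_marginal_ge0 p o z : 0 <= good_marginal p o z.
Proof. by apply: sumr_ge0 => y _; exact: term_ge0. Qed.

Lemma sum_good_marginal p o : \sum_z good_marginal p o z = good_weight p o.
Proof.
rewrite /good_weight (partition_big (fun y => (halves p y).2) xpredT) //.
Qed.

Lemma sum_good_weight p : \sum_o good_weight p o <= w.
Proof.
rewrite exchange_big -sum_W /= [leLHS]big_mkcond /=; apply: ler_sum => y _.
by case: ifP => _; rewrite ?mass_ge0 // -mulr_suml sum_encY mul1r.
Qed.

Lemma count_halves p x : \sum_(y | halves p y == x) 1 = 2 ^+ (n - 2 * m) :> R.
Proof.
have := sum_prod_part p (fun=> 1 : R) x.1 x.2.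
rewrite !big1_eq !mul1r big_bool /= (_ : 1 + 1 = 2) // => <-.
rewrite big_mkcond; apply: eq_bigr => y _; rewrite mul1r.
by case: x => x0 x1; rewrite /halves xpair_eqE /=; case: ifP.
Qed.

Lemma p2_ge0 : 0 <= p2.
Proof. by rewrite !mulr_ge0 ?exprn_ge0 ?w_ge0 ?(ltW beta_gt0). Qed.

(** The probability of the code word is bounded by 1; the price is the factor [2^leak] in the later
    sum over code words. *)
Lemma class_joint_le c p o x :
  \sum_(y | halves p y == x) (in_class c p o y)%:R * encY p y o * rtr (W y) <= p2.
Proof.
rewrite /p2 -(count_halves p x) mulr_suml; apply: ler_sum => y _; rewrite mul1r.
rewrite /in_class /good; case: (_ < _) => /=; last by rewrite !mul0r mulr_ge0 ?w_ge0 ?(ltW beta_gt0).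
case: (boolP (rtr (W y) <= _)) => hy /=; last by rewrite !mul0r mulr_ge0 ?w_ge0 ?(ltW beta_gt0).
apply: le_trans hy; rewrite -[leRHS]mul1r ler_wpM2r ?mass_ge0 //.
by case: (_ == c); rewrite ?mul1r ?encY_le1 // mul0r.
Qed.

Lemma class_marginal_le c p o z :
  \sum_(y | coord c (halves p y) == z) (in_class c p o y)%:R * encY p y o * rtr (W y) <=
  class_marginal c p o.
Proof.
have gw := good_weight_ge0 p o.
case: c => /=; last first.
  have [hz|hz] := ltP (tau * good_weight p o) (good_marginal p o z).
    rewrite big1 ?mulr_ge0 ?(ltW tau_gt0) // => y /eqP yz.
    have -> : in_class false p o y = false by rewrite /in_class /heavy /= yz hz andbF.
    by rewrite !mul0r.
  apply: le_trans hz; rewrite /good_marginal [leRHS]big_mkcondl; apply: ler_sum => y _.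
  by rewrite /in_class; case: (good y); rewrite ?mul0r //; case: (_ == _);
     rewrite ?mul1r // !mul0r term_ge0.
rewrite (partition_big (fun y => (halves p y).2) xpredT) //=.
(* For a heavy value the ratio exceeds 1, so the number of heavy values is at most the sum of all
   ratios, [1 / tau]. *)
apply: (@le_trans _ _ (\sum_z' (good_marginal p o z' / (tau * good_weight p o)) * p2)).
  apply: ler_sum => z' _.
  have [hz|hz] := ltP (tau * good_weight p o) (good_marginal p o z'); last first.
    rewrite big1 => [|y /andP[_ /eqP yz]].
      apply: mulr_ge0 p2_ge0; apply: divr_ge0 (good_marginal_ge0 _ _ _) _.
      exact: mulr_ge0 (ltW tau_gt0) gw.
    have -> : in_class true p o y = false by rewrite /in_class /heavy /= yz ltNge hz andbF.
    by rewrite !mul0r.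
  have pos : 0 < tau * good_weight p o.
    rewrite mulr_gt0 // lt_neqAle gw andbT eq_sym; apply/eqP => g0.
    have : good_marginal p o z' <= good_weight p o.
      rewrite -sum_good_marginal (bigD1 z') //= lerDl sumr_ge0 // => z'' _.
      exact: good_marginal_ge0.
    by rewrite g0; rewrite g0 mulr0 in hz; rewrite leNgt hz.
  have : \sum_(y | ((halves p y).1 == z) && ((halves p y).2 == z'))
      (in_class true p o y)%:R * encY p y o * rtr (W y) <= 1 * p2.
    rewrite mul1r; apply: le_trans (class_joint_le true p o (z, z')).
    by rewrite le_eqVlt; apply/orP; left; apply/eqP; apply: eq_bigl => y.
  move/le_trans; apply; rewrite ler_wpM2r ?p2_ge0 // ler_pdivlMr // mul1r ltW //.
rewrite -!mulr_suml sum_good_marginal.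
have := p2_ge0; move: p2 => r2 r20.
have [->|n0] := eqVneq (good_weight p o) 0; first by rewrite !mul0r divr_ge0 // ltW.
rewrite le_eqVlt; apply/orP; left; apply/eqP; field.
by rewrite n0 gt_eqF.
Qed.

Lemma class_total_le c (t : R) (V : ipair n m * Mf -> bits leak -> HK -> 'M[C]_d') : 0 < t ->
  (forall b o s, contraction (V b o s)) ->
  \sum_b \sum_o \sum_s rtr (V b o s *m apply_instr Psi b
     (\sum_y (hcoef R c s (halves b.1 y))%:C *: (((in_class c b.1 o y)%:R * encY b.1 y o)%:C *: W y))) <=
  K ^+ 2 * ((t * (d%:R * (4 * (2 ^+ l * tau) ^+ 2 + 2 * (2 ^+ l * tau))) + t^-1) / 2) * w.
Proof.
move=> t0 hV.
have [w0|w0] := ltP 0 w; last first.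
  have -> : w = 0 by apply/eqP; rewrite eq_le w0 w_ge0.
  rewrite mulr0 big1 // => b _; rewrite big1 // => o _; rewrite big1 // => s _.
  rewrite big1 => [|y _]; last first.
    by rewrite /in_class /good ltNge w0 /= !mul0r scale0r scaler0.
  have := @apply_instr_sum1 _ _ _ _ Psi b unit [::] xpredT (fun=> 0).
  by rewrite !big_nil => ->; rewrite mulmx0 rtr0.
have L0 : 0 < 2 ^+ l :> R by rewrite exprn_gt0.
have q0 : 0 <= 2 * q by rewrite mulr_ge0 // invr_ge0 ltW.
have p20 : 0 < p2 by rewrite !mulr_gt0 ?exprn_gt0.
pose M p o := 4 * p2 + 2 * q * class_marginal c p o.
have M0 p o : 0 < M p o.
  apply: ltr_pwDl; first by apply: mulr_gt0 p20.
  apply: mulr_ge0 q0 _; rewrite /class_marginal; case: (c).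
    by apply: divr_ge0; rewrite ltW.
  by apply: mulr_ge0 (good_weight_ge0 _ _); rewrite ltW.
have sp2 : \sum_(o : bits leak) p2 <= tau ^+ 2 * w.
  by rewrite sum_bits_const /p2 !mulrA ler_wpM2r ?w_ge0 // -!mulrA.
have hMt p : \sum_o M p o <= (4 * tau ^+ 2 + 2 * q * tau) * w.
  (* By the choice of [tau] the heavy class obeys the same marginal bound [tau * w] as the light
     one. *)
  have hm : \sum_o class_marginal c p o <= tau * w.
    rewrite /class_marginal; case: (c).
      rewrite -mulr_suml ler_pdivrMr //; apply: (le_trans sp2).
      by rewrite le_eqVlt; apply/orP; left; apply/eqP; ring.
    by rewrite -mulr_sumr ler_wpM2l ?sum_good_weight // ltW.
  have -> : \sum_o M p o = 4 * \sum_(o : bits leak) p2 + 2 * q * \sum_o class_marginal c p o.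
    by rewrite !mulr_sumr -big_split.
  have -> : (4 * tau ^+ 2 + 2 * q * tau) * w = 4 * (tau ^+ 2 * w) + 2 * q * (tau * w) by ring.
  by apply: lerD; rewrite ler_wpM2l.
apply: (le_trans (class_sum_le t0 M0 (fun _ _ => lexx _) hMt (class_joint_le c) (class_marginal_le c) hV)).
rewrite le_eqVlt; apply/orP; left; apply/eqP; rewrite /q; field.
by rewrite !gt_eqF.
Qed.

End ClassSum.

(** * The ideal state for an honest Alice *)

Section SecurityForAlice.
Local Arguments part : simpl never.
Variables (R : realType) (n m l leak : nat) (h : hash_family m l) (ec : ec_scheme R n m leak).
Variables (A Mf : finType) (d d' : nat) (W : A -> bits n -> bits n -> 'M[R[i]]_d) (w : A -> R).
Variable Psi : A -> bits n -> instrument R (ipair n m * Mf)%type d d'.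
Local Notation C := R[i].
Local Notation key := (hash_key h).
Local Notation View := (A * bits n * (ipair n m * Mf) * bits leak * (key * key))%type.
Hypothesis gramW : forall a th y, gram (W a th y).
Hypothesis sum_W : forall a th, \sum_y rtr (W a th y) = w a.
Hypothesis total_w : 2 ^+ n * \sum_a w a = 1.
Let K : R := #|key|%:R.
Let q : R := (2 ^+ l)^-1.

Definition vfirst (v : View) : A := v.1.1.1.1.
Definition vbasis (v : View) : bits n := v.1.1.1.2.
Definition vreply (v : View) : ipair n m * Mf := v.1.1.2.
Definition vcode (v : View) : bits leak := v.1.2.

Definition venc (v : View) (y : bits n) : R := encY ec (vbasis v) (vreply v).1 y (vcode v).

Definition vstate (v : View) (y : bits n) : 'M[C]_d' :=
  apply_instr (Psi (vfirst v) (vbasis v)) (vreply v) (W (vfirst v) (vbasis v) y).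

Definition vmatch (c : bool) (v : View) (y : bits n) (s : bits l) : R :=
  (hash (sel c v.2.1 v.2.2) (sel c (halves (vreply v).1 y).1 (halves (vreply v).1 y).2) == s)%:R.

(** Bob's conditional state with Alice's strings reweighted by [phi]. Real state, ideal state and
    all error terms are blocks, so comparing them amounts to comparing the functions [phi]. *)
Definition block (v : View) (phi : bits n -> R) : 'M[C]_d' :=
  \sum_y (phi y * venc v y)%:C *: vstate v y.

Lemma gram_vstate v y : gram (vstate v y).
Proof. exact: gram_apply. Qed.

Lemma gram_block v phi : (forall y, 0 <= phi y) -> gram (block v phi).
Proof.
move=> p0; apply: gram_sum => y _; apply: gramZ; last exact: gram_vstate.
by rewrite ler0c mulr_ge0 ?encY_ge0.
Qed.

Lemma rtr_block v phi : rtr (block v phi) = \sum_y phi y * venc v y * rtr (vstate v y).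
Proof. by rewrite rtr_sum; apply: eq_bigr => y _; rewrite rtrZ. Qed.

Lemma blockD v phi psi : block v (fun y => phi y + psi y) = block v phi + block v psi.
Proof. by rewrite -big_split; apply: eq_bigr => y _; rewrite mulrDl rmorphD scalerDl. Qed.

Lemma blockN v phi : block v (fun y => - phi y) = - block v phi.
Proof. by rewrite -sumrN; apply: eq_bigr => y _; rewrite mulNr rmorphN scaleNr. Qed.

Lemma eq_block v phi psi : phi =1 psi -> block v phi = block v psi.
Proof. by move=> e; apply: eq_bigr => y _; rewrite e. Qed.

Lemma sum_view (F : View -> R) :
  \sum_v F v = \sum_a \sum_th \sum_b \sum_o \sum_k F (a, th, b, o, k).
Proof. by rewrite 4!sum_pair. Qed.

Lemma sum_rtr_block (phi : bits l -> bits l -> View -> bits n -> R) (psi : A -> bits n -> bits n -> R) :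
  (forall v y, \sum_s0 \sum_s1 phi s0 s1 v y = psi (vfirst v) (vbasis v) y) ->
  \sum_(t : bits l * bits l * View) K ^- 2 * rtr (block t.2 (phi t.1.1 t.1.2 t.2)) =
  \sum_a \sum_th \sum_y psi a th y * rtr (W a th y).
Proof.
move=> H.
have K0 : K != 0 by rewrite gt_eqF // (key_gt0 R h).
rewrite 2!sum_pair /=; under eq_bigr => s0 _ do rewrite exchange_big /=.
rewrite exchange_big /=.
have E v : \sum_s0 \sum_s1 K ^- 2 * rtr (block v (phi s0 s1 v)) =
   K ^- 2 * \sum_y psi (vfirst v) (vbasis v) y * venc v y * rtr (vstate v y).
  under eq_bigr => s0 _ do rewrite -mulr_sumr; rewrite -mulr_sumr; congr (_ * _).
  under eq_bigr => s0 _ do (under eq_bigr => s1 _ do rewrite rtr_block; rewrite exchange_big /=).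
  rewrite exchange_big /=; apply: eq_bigr => y _.
  under eq_bigr => s0 _ do (under eq_bigr => s1 _ do rewrite -mulrA; rewrite -mulr_suml).
  by rewrite -mulr_suml H mulrA.
under eq_bigr => v _ do rewrite E.
rewrite sum_view; apply: eq_bigr => a _; apply: eq_bigr => th _.
transitivity (\sum_b \sum_o \sum_y psi a th y * encY ec th b.1 y o * rtr (apply_instr (Psi a th) b (W a th y))).
  apply: eq_bigr => b _; apply: eq_bigr => o _.
  set Z := (X in _ = X); transitivity (\sum_(k : key * key) K ^- 2 * Z); first by [].
  rewrite sumr_const card_prod -(mulr_natl (_ * Z)) natrM -/K mulrA.
  by rewrite -expr2 mulfV ?mul1r // expf_neq0.
transitivity (\sum_b \sum_y psi a th y * rtr (apply_instr (Psi a th) b (W a th y))).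
  apply: eq_bigr => b _; rewrite exchange_big; apply: eq_bigr => y _.
  under eq_bigr => o _ do rewrite mulrAC.
  by rewrite -mulr_sumr sum_encY mulr1.
by rewrite exchange_big; apply: eq_bigr => y _; rewrite -mulr_sumr rtr_apply.
Qed.

Lemma sum_vmatch c v y : \sum_s vmatch c v y s = 1.
Proof.
rewrite (bigD1 (hash (sel c v.2.1 v.2.2) (sel c (halves (vreply v).1 y).1 (halves (vreply v).1 y).2))) //=.
rewrite big1 => [|s /negbTE ns]; first by rewrite /vmatch eqxx addr0.
by rewrite /vmatch eq_sym ns.
Qed.

Lemma vmatch_ge0 c v y s : 0 <= vmatch c v y s.
Proof. exact: ler0n. Qed.

Variables (beta tau t e1 : R).
Hypothesis beta_gt0 : 0 < beta.
Hypothesis tau_gt0 : 0 < tau.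
Hypothesis t_gt0 : 0 < t.
Hypothesis beta_tau : 2 ^+ leak * (2 ^+ (n - 2 * m) * beta) <= tau ^+ 2.
Hypothesis bad_le : \sum_a \sum_th \sum_y
  (beta * w a < rtr (W a th y))%R%:R * rtr (W a th y) <= e1.

Definition vclass (c : bool) (v : View) (y : bits n) : R :=
  (in_class ec (vbasis v) (W (vfirst v) (vbasis v)) (w (vfirst v)) beta tau c (vreply v).1 (vcode v) y)%:R.
Definition vbad (v : View) (y : bits n) : R :=
  (~~ good (W (vfirst v) (vbasis v)) (w (vfirst v)) beta y)%:R.

Lemma vclass_sum v y : vclass false v y + vclass true v y + vbad v y = 1.
Proof.
rewrite /vclass /vbad /in_class; case: (good _ _ _ y); rewrite /= ?addr0 ?add0r //.
by case: (heavy _ _ _ _ _ _ _ _ _) => /=; rewrite ?addr0 ?add0r.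
Qed.

Lemma vclass_ge0 c v y : 0 <= vclass c v y.
Proof. exact: ler0n. Qed.

Lemma vbad_ge0 v y : 0 <= vbad v y.
Proof. exact: ler0n. Qed.

(** Strings that are not good also need a choice bit; they are put with [C = 0], which costs no more
    than their weight. *)
Definition ideal_alice : cq R (bits l * bits l * View * bool)%type d' :=
  fun '(s0, s1, v, c) => (K ^- 2)%:C *: block v (fun y =>
    if c then q * (vclass true v y * vmatch true v y s1)
    else q * ((vclass false v y + vbad v y) * vmatch false v y s0)).

Lemma sum_vbad : \sum_a \sum_th \sum_y
   (~~ good (W a th) (w a) beta y)%:R * rtr (W a th y) <= e1.
Proof.
apply: le_trans bad_le; apply: ler_sum => a _; apply: ler_sum => th _; apply: ler_sum => y _.
have p0 y' : 0 <= rtr (W a th y') by apply: gram_rtr_ge0.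
rewrite /good; case: ltP => [w0|w0] /=; first by rewrite -ltNge.
have -> : rtr (W a th y) = 0; last by rewrite !mulr0.
apply/eqP; rewrite eq_le p0 andbT; apply: le_trans w0.
by rewrite -(sum_W a th) (bigD1 y) //= lerDl sumr_ge0.
Qed.

Lemma KV_ge0 : 0 <= K ^- 2.
Proof. by rewrite invr_ge0 exprn_ge0. Qed.

Lemma ideal_alice_gram u : gram (ideal_alice u).
Proof.
case: u => [[[s0 s1] v] c]; apply: gramZ; first by rewrite ler0c KV_ge0.
have q0 : 0 <= q by rewrite invr_ge0 exprn_ge0.
apply: gram_block => y; case: c; rewrite mulr_ge0 // mulr_ge0 ?vmatch_ge0 ?vclass_ge0 //.
by rewrite addr_ge0 ?vclass_ge0 ?vbad_ge0.
Qed.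

Lemma sum_pW : \sum_a \sum_th \sum_y rtr (W a th y) = 1.
Proof.
rewrite -total_w mulr_sumr; apply: eq_bigr => a _.
by under eq_bigr => th _ do rewrite sum_W; rewrite sum_bits_const.
Qed.

Lemma ideal_alice_tr : \sum_u \tr (ideal_alice u) = 1.
Proof.
under eq_bigr => u _ do rewrite (gram_tr (ideal_alice_gram u)).
rewrite -rmorph_sum sum_pair /=; apply: (congr1 (fun x : R => x%:C) (y := 1)).
have L0 : 2 ^+ l != 0 :> R by rewrite expf_neq0 ?pnatr_eq0.
have E := @sum_rtr_block (fun s0 s1 v y => q * (vclass true v y * vmatch true v y s1)
   + q * ((vclass false v y + vbad v y) * vmatch false v y s0)) (fun _ _ _ => 1).
rewrite -sum_pW -[RHS](eq_bigr _ (fun a _ => eq_bigr _ (fun th _ => eq_bigr _ (fun y _ => mul1r _)))).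
rewrite -E => [|v y]; last first.
  under eq_bigr => s0 _ do rewrite big_split /= -!mulr_sumr sum_vmatch sum_bits_const.
  rewrite big_split /= sum_bits_const -!mulr_sumr sum_vmatch !mulr1 !mulrA !mulfV // !mul1r.
  by rewrite mulrAC mulVf // mul1r addrA (addrC (vclass true v y)) vclass_sum.
apply: eq_bigr => -[[s0 s1] v] _; rewrite big_bool /= !rtrZ -mulrDr; congr (_ * _).
by rewrite -rtrD -blockD.
Qed.

(** The class estimate is proportional to [w a] for each first outcome and basis string; these
    masses add up to 1. *)
Lemma class_part_le c (V : bits l * bits l * View -> 'M[C]_d') : (forall u, contraction (V u)) ->
  \sum_u K ^- 2 * rtr (V u *m block u.2 (fun y => vclass c u.2 y *
     hcoef R c (u.2.2, u.1) (halves (vreply u.2).1 y))) <=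
  (t * (d%:R * (4 * (2 ^+ l * tau) ^+ 2 + 2 * (2 ^+ l * tau))) + t^-1) / 2.
Proof.
move=> hV; set B := (X in _ <= X).
have K0 : 0 < K by exact: (key_gt0 R h).
rewrite -mulr_sumr sum_pair exchange_big /= sum_view.
rewrite mulrC ler_pdivrMr ?exprn_gt0 // mulrC -[leRHS]mulr1 -sum_pW !mulr_sumr.
apply: ler_sum => a _; rewrite mulr_sumr; apply: ler_sum => th _; rewrite sum_W.
have := @class_total_le R n m l leak h ec Mf d d' (Psi a th) th (W a th) (w a) (gramW a th)
  (sum_W a th) beta tau beta_gt0 tau_gt0 beta_tau c t
  (fun b o s => V (s.2, (a, th, b, o, s.1))) t_gt0 (fun b o s => hV _).
rewrite -/K -/B; apply: le_trans.
rewrite le_eqVlt; apply/orP; left; apply/eqP.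
apply: eq_bigr => b _; apply: eq_bigr => o _; rewrite [RHS]sum_pair.
apply: eq_bigr => k _; apply: eq_bigr => s _; congr (rtr (_ *m _)).
rewrite /block.
transitivity (\sum_y ((hcoef R c (k, s) (halves b.1 y))%:C * ((vclass c (a, th, b, o, k) y) * encY ec th b.1 y o)%:C)
    *: apply_instr (Psi a th) b (W a th y)).
  by apply: eq_bigr => y _; congr (_ *: _); rewrite -rmorphM /venc /=; congr (_%:C); ring.
rewrite -apply_instr_sum; congr apply_instr; apply: eq_bigr => y _.
by rewrite scalerA.
Qed.

Lemma secure_for_alice_abstract (e : R) (rho : cq R (bits l * bits l * View)%type d') :
  (forall s0 s1 v, rho (s0, s1, v) = (K ^- 2)%:C *:
     block v (fun y => vmatch false v y s0 * vmatch true v y s1)) ->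
  e1 + (t * (d%:R * (4 * (2 ^+ l * tau) ^+ 2 + 2 * (2 ^+ l * tau))) + t^-1) / 2 <= e ->
  ot_secure_for_alice e rho.
Proof.
move=> rhoE he; exists ideal_alice.
have L0 : (2 ^ l)%N%:R != 0 :> C by rewrite pnatr_eq0 -lt0n expn_gt0.
have const (X : 'M[C]_d') : (2 ^ l)%N%:R^-1 *: \sum_(s : bits l) X = X.
  by rewrite sumr_const card_bits -(scaler_nat _ X) scalerA mulVf // scale1r.
split.
- exact: gram_is_state ideal_alice_gram ideal_alice_tr.
- by move=> s0 s1 v; exact: esym (const (ideal_alice (s0, s1, v, false))).
- by move=> s0 s1 v; exact: esym (const (ideal_alice (s0, s1, v, true))).
apply: trdist_le => V hV.
pose B c u := block u.2 (fun y => vclass c u.2 y * hcoef R c (u.2.2, u.1) (halves (vreply u.2).1 y)).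
pose X (u : bits l * bits l * View) := block u.2 (fun y => vbad u.2 y *
   (vmatch false u.2 y u.1.1 * vmatch true u.2 y u.1.2)).
pose Y (u : bits l * bits l * View) := block u.2 (fun y => vbad u.2 y *
   (q * vmatch false u.2 y u.1.1)).
have q0 : 0 <= q by rewrite invr_ge0 exprn_ge0.
have gX u : gram (X u) by apply: gram_block => y; rewrite !mulr_ge0 ?vbad_ge0 ?vmatch_ge0.
have gY u : gram (Y u) by apply: gram_block => y; rewrite !mulr_ge0 ?vbad_ge0 ?vmatch_ge0.
have hX : \sum_u K ^- 2 * rtr (X u) <= e1.
  apply: le_trans sum_vbad; rewrite le_eqVlt; apply/orP; left; apply/eqP.
  apply: (@sum_rtr_block (fun s0 s1 v y => vbad v y * (vmatch false v y s0 * vmatch true v y s1))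
    (fun a th y => (~~ good (W a th) (w a) beta y)%:R)) => v y.
  under eq_bigr => s0 _ do rewrite -!mulr_sumr sum_vmatch mulr1.
  by rewrite -mulr_sumr sum_vmatch mulr1.
have hY : \sum_u K ^- 2 * rtr (Y u) <= e1.
  apply: le_trans sum_vbad; rewrite le_eqVlt; apply/orP; left; apply/eqP.
  apply: (@sum_rtr_block (fun s0 s1 v y => vbad v y * (q * vmatch false v y s0))
    (fun a th y => (~~ good (W a th) (w a) beta y)%:R)) => v y.
  under eq_bigr => s0 _ do rewrite sum_bits_const.
  under eq_bigr => s0 _ do rewrite mulrCA (mulrA _ q) mulfV ?expf_neq0 ?pnatr_eq0 // mul1r.
  by rewrite -mulr_sumr sum_vmatch mulr1.
(* Insert the partition of 1 into the two classes and the bad strings. Each class leaves the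
   deviation of the one hash value that was replaced; the bad strings leave a difference of two
   positive terms. *)
have split u : rho u - (fun '(s0, s1, b) => \sum_(c : bool) ideal_alice (s0, s1, b, c)) u =
    (K ^- 2)%:C *: (B false u + B true u + X u - Y u).
  case: u => [[s0 s1] v]; rewrite rhoE big_bool /= -scalerDr -scalerBr; congr (_ *: _).
  rewrite -blockD -!blockN -!blockD; apply: eq_block => y /=.
  rewrite [X in X - _](_ : _ = (vclass false v y + vclass true v y + vbad v y) *
    (vmatch false v y s0 * vmatch true v y s1)); last by rewrite vclass_sum mul1r.
  rewrite /hcoef /hdev /= -/q /vmatch /=; ring.
have term u : rtr (V u *m (rho u - (fun '(s0, s1, b) => \sum_(c : bool) ideal_alice (s0, s1, b, c)) u)) <=
   K ^- 2 * rtr (V u *m B false u) + K ^- 2 * rtr (V u *m B true u) + K ^- 2 * rtr (X u) + K ^- 2 * rtr (Y u).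
  rewrite split -scalemxAr rtrZ -!mulrDr ler_wpM2l ?KV_ge0 //.
  rewrite mulmxBr !mulmxDr rtrB !rtrD; apply: lerD; first by rewrite lerD2l rtr_contraction.
  have := norm_rtr_contraction (hV u) (gY u); rewrite ler_norml => /andP[+ _].
  by rewrite lerNl.
have : \sum_u rtr (V u *m (rho u - (fun '(s0, s1, b) => \sum_(c : bool) ideal_alice (s0, s1, b, c)) u)) <=
  \sum_u K ^- 2 * rtr (V u *m B false u) + \sum_u K ^- 2 * rtr (V u *m B true u)
  + \sum_u K ^- 2 * rtr (X u) + \sum_u K ^- 2 * rtr (Y u).
  by rewrite -!big_split; apply: ler_sum => u _; exact: term.
have := class_part_le false hV; have := class_part_le true hV.
rewrite -/(B _ _).
lra.
Qed.

End SecurityForAlice.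

(** * Passing from all rounds to the kept ones *)

Section Marginal.
Variables (R : realType) (N n : nat) (J : {set 'I_N}).
Hypothesis cardJ : #|J| = n.

Lemma upd_eq k (u y : bits k) j b b' :
  (upd u j b' == upd y j b) = (b' == b) && (upd u j false == upd y j false).
Proof.
apply/eqP/andP => [e|[/eqP -> /eqP e]].
  have := congr1 (fun z : bits k => z j) e; rewrite !ffunE eqxx => ->; split=> //.
  by apply/eqP; rewrite -(upd_upd u j b') e upd_upd.
by rewrite -(upd_upd u j false) e upd_upd.
Qed.

(** The right-hand condition compares the strings away from [j], both being reset there. It admits
    two strings for each one in the fibre, hence the factor 1/2. *)
Lemma sum_fiber_upd (y : bits n) j b (F : bits N -> R) :
  \sum_(x | restr n J x == upd y j b) F x =
  2^-1 * \sum_(x | upd (restr n J x) j false == upd y j false) F (upd x (pos cardJ j) b).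
Proof.
have e2 : (2 : R) != 0 by rewrite pnatr_eq0.
apply: (mulfI e2); rewrite mulrA mulfV // mul1r big_mkcond mulr_natl.
rewrite -(sum_upd (pos cardJ j)) [RHS]big_mkcond; apply: eq_bigr => x _.
by rewrite big_bool /= !(restr_upd cardJ) (upd_eq _ _ _ b true) (upd_eq _ _ _ b false); case: b; case: (_ == upd y j false); rewrite /= ?addr0 ?add0r.
Qed.

(** Resetting position [j] makes the range of summation independent of the bit and basis there, so
    the marginal is a sum of sites. *)
Lemma site_marginal (f : bits N -> bits N -> R) :
  (forall x theta i, site (fun b tau => f (upd x i b) (upd theta i tau))) ->
  forall (y th : bits n) j, site (fun b tau =>
    \sum_(x | restr n J x == upd y j b) \sum_(theta | restr n J theta == upd th j tau) f x theta).
Proof.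
move=> hf y th j.
have -> : (fun b tau => \sum_(x | restr n J x == upd y j b)
     \sum_(theta | restr n J theta == upd th j tau) f x theta) = fun b tau =>
   2^-1 * \sum_(x | upd (restr n J x) j false == upd y j false) (2^-1 *
     \sum_(theta | upd (restr n J theta) j false == upd th j false)
       f (upd x (pos cardJ j) b) (upd theta (pos cardJ j) tau)).
  apply/funext => b; apply/funext => tau; rewrite sum_fiber_upd; congr (_ * _).
  by apply: eq_bigr => x _; rewrite sum_fiber_upd.
apply: siteZ; first by rewrite invr_ge0.
apply: site_sum => x _; apply: siteZ; first by rewrite invr_ge0.
by apply: site_sum => theta _; exact: hf.
Qed.

End Marginal.

Section DishonestBob.
Local Arguments part : simpl never.
Variables (R : realType) (n m l leak N d d' : nat) (h : hash_family m l) (ec : ec_scheme R n m leak).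
Variables (Mem Mf : finType) (S : bob_first n N Mem -> bits N -> bits N -> 'M[R[i]]_d).
Variable Psi : bob_first n N Mem -> bits n -> instrument R (ipair n m * Mf)%type d d'.
Local Notation C := R[i].
Local Notation A := (bob_first n N Mem).
Local Notation key := (hash_key h).
Local Notation View := (A * bits n * (ipair n m * Mf) * bits leak * (key * key))%type.
Hypothesis gramS : forall a x theta, gram (S a x theta).
Hypothesis site_S : forall a x theta i,
  site (fun b tau => rtr (S a (upd x i b) (upd theta i tau))).
Hypothesis indep_S : forall a theta theta', \sum_x rtr (S a x theta) = \sum_x rtr (S a x theta').
Hypothesis total_S : forall theta, \sum_a \sum_x rtr (S a x theta) = 2 ^+ N.

Definition post_state (a : A) (th y : bits n) : 'M[C]_d :=
  (4 ^- N)%:C *: \sum_(x | restr n (val a.1) x == y) \sum_(theta | restr n (val a.1) theta == th) S a x theta.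

(** By no signalling the mass does not depend on the kept bases, so [[ffun=> false]] is an arbitrary
    choice; [2 ^+ (N - n)] counts the bases of the discarded rounds. *)
Definition post_mass (a : A) : R :=
  4 ^- N * (2 ^+ (N - n) * \sum_x rtr (S a x [ffun=> false])).

Lemma gram_post a th y : gram (post_state a th y).
Proof.
apply: gramZ; first by rewrite ler0c invr_ge0 exprn_ge0.
by apply: gram_sum => x _; apply: gram_sum => theta _.
Qed.

Lemma rtr_post a th y : rtr (post_state a th y) =
  4 ^- N * \sum_(x | restr n (val a.1) x == y) \sum_(theta | restr n (val a.1) theta == th) rtr (S a x theta).
Proof.
by rewrite rtrZ rtr_sum; congr (_ * _); apply: eq_bigr => x _; rewrite rtr_sum.
Qed.

Lemma card_fiber (J : {set 'I_N}) (th : bits n) : #|J| = n ->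
  \sum_(theta : bits N | restr n J theta == th) 1 = 2 ^+ (N - n) :> R.
Proof.
move=> hJ; rewrite big_mkcond.
have := sum_restr (fun y => if y == th then 1 else 0 : R) hJ => ->.
by rewrite -big_mkcond big_pred1_eq mulr1.
Qed.

Lemma sum_post a th : \sum_y rtr (post_state a th y) = post_mass a.
Proof.
under eq_bigr => y _ do rewrite rtr_post.
rewrite -mulr_sumr /post_mass; congr (_ * _).
transitivity (\sum_x \sum_(theta | restr n (val a.1) theta == th) rtr (S a x theta)).
  by rewrite [RHS](partition_big (restr n (val a.1)) xpredT).
rewrite exchange_big /= -(card_fiber th (eqP (valP a.1))) mulr_suml.
by apply: eq_bigr => theta _; rewrite mul1r; exact: indep_S.
Qed.

Lemma nsub_leN (a : A) : (n <= N)%N.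
Proof. by rewrite -(eqP (valP a.1)) -[leqRHS]card_ord max_card. Qed.

Lemma total_post : 2 ^+ n * \sum_a post_mass a = 1.
Proof.
have e2 : 2 ^+ N != 0 :> R by rewrite expf_neq0 ?pnatr_eq0.
have e4 : 4 ^+ N = 2 ^+ N * 2 ^+ N :> R by rewrite -exprMn -natrM.
rewrite mulr_sumr (eq_bigr (fun a => 4 ^- N * 2 ^+ N * \sum_x rtr (S a x [ffun=> false]))) => [|a _].
  rewrite -mulr_sumr total_S e4; field.
  exact: e2.
by rewrite /post_mass mulrCA mulrA -mulrA (mulrA (2 ^+ n)) -exprD subnKC ?nsub_leN // mulrA.
Qed.

Lemma site_post a (y th : bits n) j : site (fun b tau => rtr (post_state a (upd th j tau) (upd y j b))).
Proof.
have := @siteZ R (4 ^- N) _ _ (site_marginal (f := fun x theta => rtr (S a x theta))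
  (eqP (valP a.1)) (site_S a) y th j).
rewrite invr_ge0 exprn_ge0 // => /(_ isT); congr site.
by apply/funext => b; apply/funext => tau; rewrite rtr_post.
Qed.

(** The masses sum to [2^-n], the probability of a single basis string; this supplies the 1/2 per
    qubit. *)
Lemma bad_post (s beta : R) : 0 < s -> 0 < beta ->
  \sum_a \sum_th \sum_y (beta * post_mass a < rtr (post_state a th y))%R%:R * rtr (post_state a th y) <=
  (unc s / 2) ^+ n * beta `^ (- s).
Proof.
move=> s0 b0.
have e2 : 2 ^+ n != 0 :> R by rewrite expf_neq0 ?pnatr_eq0.
apply: (@le_trans _ _ (\sum_a unc s ^+ n * beta `^ (- s) * post_mass a)).
  apply: ler_sum => a _.
  have := @uncertainty R n (fun y th => rtr (post_state a th y)) s beta [ffun=> false] s0 b0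
    (fun y th => gram_rtr_ge0 (gram_post a th y)) (fun y th j => site_post a y th j).
  by under eq_bigr => th _ do under eq_bigr => y _ do rewrite sum_post; rewrite sum_post.
rewrite -mulr_sumr -(mulfK e2 (\sum_a post_mass a)) (mulrC (\sum_a _)) total_post.
by rewrite le_eqVlt; apply/orP; left; apply/eqP; rewrite expr_div_n; ring.
Qed.

Lemma secure_for_alice_view (s beta tau t e : R) (rho : cq R (bits l * bits l * View)%type d') :
  0 < s -> 0 < beta -> 0 < tau -> 0 < t ->
  2 ^+ leak * (2 ^+ (n - 2 * m) * beta) <= tau ^+ 2 ->
  (forall s0 s1 a th b o r0 r1, rho (s0, s1, (a, th, b, o, (r0, r1))) =
    ((4 ^ N * #|key| ^ 2)%N%:R^-1) *: \sum_x \sum_(theta | restr n (val a.1) theta == th)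
      (ec_enc ec th b.1 (restr m (part b.1 false) (restr n (val a.1) x))
         (restr m (part b.1 true) (restr n (val a.1) x)) o *
       ((hash r0 (restr m (part b.1 false) (restr n (val a.1) x)) == s0) &&
        (hash r1 (restr m (part b.1 true) (restr n (val a.1) x)) == s1))%:R) *:
      apply_instr (Psi a th) b (S a x theta)) ->
  (unc s / 2) ^+ n * beta `^ (- s) +
    (t * (d%:R * (4 * (2 ^+ l * tau) ^+ 2 + 2 * (2 ^+ l * tau))) + t^-1) / 2 <= e ->
  ot_secure_for_alice e rho.
Proof.
move=> s0' b0 tau0 t0 htau rhoE he.
apply: (@secure_for_alice_abstract R n m l leak h ec A Mf d d' post_state post_mass Psi
  gram_post sum_post total_post beta tau t _ b0 tau0 t0 htau (bad_post s0' b0) e rho _ he).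
move=> s0 s1 [[[[a th] b] o] [r0 r1]]; rewrite rhoE /block.
have -> : (4 ^ N * #|key| ^ 2)%N%:R^-1 = (#|key|%:R ^- 2)%:C * (4 ^- N)%:C :> C.
  rewrite natr_embed -fmorphV -rmorphM -invfM; congr (_^-1)%:C.
  by rewrite natrM !natrX mulrC.
rewrite -scalerA; congr (_ *: _).
rewrite (partition_big (restr n (val a.1)) xpredT) //= scaler_sumr; apply: eq_bigr => y _.
rewrite /vstate /post_state /= apply_instrZ scalerA mulrC -scalerA; congr (_ *: _).
rewrite apply_instr_sum1 scaler_sumr; apply: eq_bigr => x /eqP xy.
rewrite apply_instr_sum1 scaler_sumr; apply: eq_bigr => theta _; congr (_ *: _).
rewrite xy /venc /encY /vmatch /= [RHS]rmorphM [X in _ = _ * X]encRE [RHS]mulrC; congr (_ * _).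
by rewrite -natrM mulnb rmorph_nat.
Qed.

End DishonestBob.

Section DishonestBobInstance.
Variables (R : realType) (n m l leak : nat) (h : hash_family m l) (ec : ec_scheme R n m leak).
Variable B : dishonest_bob R n m.

Lemma site_apply (K : finType) N d (E : instrument R K (hdim N) d) k (x theta : bits N) i :
  site (fun b tau => rtr (apply_instr E k (pure (ket R (upd x i b) (upd theta i tau))))).
Proof.
have := @site_sum R _ (index_enum (kraus_index E)) predT (fun j b tau =>
  fn (@kraus _ _ _ _ E k j *m ket R (upd x i b) (upd theta i tau))) (fun j _ => site_ket _ _ _ _).
by congr site; apply/funext => b; apply/funext => tau; rewrite rtr_apply_pure.
Qed.

Lemma secure_for_alice (s beta tau t e : R) :
  0 < s -> 0 < beta -> 0 < tau -> 0 < t ->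
  2 ^+ leak * (2 ^+ (n - 2 * m) * beta) <= tau ^+ 2 ->
  (unc s / 2) ^+ n * beta `^ (- s) +
    (t * ((db_dim B)%:R * (4 * (2 ^+ l * tau) ^+ 2 + 2 * (2 ^+ l * tau))) + t^-1) / 2 <= e ->
  ot_secure_for_alice e (@real_dishonest_bob R n m l leak h ec B).
Proof.
move=> s0 b0 tau0 t0 htau he.
have gS a (x theta : bits (db_rounds B)) : gram (apply_instr (db_station B) a (pure (ket R x theta))).
  by apply: gram_apply; exact: gram_pure.
have rtrE k : \sum_(x : bits (db_rounds B)) rtr (apply_instr (db_station B) k.1 (pure (ket R x k.2))) =
   complex.Re (\sum_x \tr (apply_instr (db_station B) k.1 (pure (ket R x k.2)))).
  by rewrite Re_sum.
apply: (@secure_for_alice_view R n m l leak (db_rounds B) (db_dim B) (db_final_dim B) h ec (db_mem B) (db_final_mem B)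
  (fun a x theta => apply_instr (db_station B) a (pure (ket R x theta))) (@db_reply R n m B) gS
  (fun a x theta i => site_apply _ _ _ _ _) _ _ s beta tau t e _ s0 b0 tau0 t0 htau _ he).
- move=> a theta theta'; apply: etrans (rtrE (a, theta)) (etrans _ (esym (rtrE (a, theta')))).
  exact: congr1 (sum_tr_instr _ a theta theta').
- move=> theta; under eq_bigr => a _ do rewrite (rtrE (a, theta)).
  by rewrite -Re_sum /= sum_tr_station -!natrX natr_embed.
by [].
Qed.

End DishonestBobInstance.

(** * Numerical estimates *)

Section Numerics.
Variable R : realType.

Lemma powR_expR (a b : R) : expR a `^ b = expR (b * a).
Proof. by rewrite /powR gt_eqF ?expR_gt0 // expRK. Qed.

Lemma exprn2_expR k : 2 ^+ k = expR (k%:R * ln 2) :> R.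
Proof. by rewrite expRM_natl lnK // posrE. Qed.

Lemma ln2_ge_half : 2^-1 <= ln 2 :> R.
Proof.
have : expR 2^-1 <= 2 :> R.
  have := expR_ge1Dx (- 2^-1 : R); rewrite expRN.
  have h := expR_gt0 (2^-1 : R); rewrite -(ler_pM2r h) mulVf ?gt_eqF //; lra.
by rewrite -(ler_ln (x := expR _)) ?posrE ?expR_gt0 // expRK.
Qed.

Lemma ln2_le_45 : ln 2 <= 4 / 5 :> R.
Proof.
rewrite -ler_expR lnK ?posrE //.
have h := @expR_ge_quad R (4 / 5); have : 0 <= 4 / 5 :> R by lra.
by move=> /h; lra.
Qed.

Variables (n m l leak : nat) (eps D : R).
Let N : R := n%:R.
Let L : R := ln eps^-1.
Let alpha1 : R := Num.sqrt (L / (2 * N)).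
Let delta0 : R := Num.sqrt (32 * L / N).
Let delta' : R := (2 - log2 delta0) * delta0.
Let lambda : R := 1 / 2 - 2 * delta'.
Let rate : R := lambda - leak%:R / N - 2 * alpha1.
Let mu : R := 1 - Num.sqrt (1 - eps ^+ 2).
Hypothesis heps : 0 < eps < 1.
Hypothesis hD : 0 <= D.
Hypothesis hm : m = Num.truncn ((1 / 2 - alpha1) * N).
Hypothesis hrate : 0 < rate.
Hypothesis hn : 2 * ((l%:R + D + 1 - 2 * log2 mu) / rate) <= N.

Lemma L_gt0 : 0 < L.
Proof. by case/andP: heps => e0 e1; rewrite ln_gt0 // invf_gt1. Qed.

Lemma expRN_L : expR (- L) = eps.
Proof. by case/andP: heps => e0 e1; rewrite /L lnV ?posrE // opprK lnK // posrE. Qed.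

Lemma mu_gt0 : 0 < mu.
Proof.
case/andP: heps => e0 e1; rewrite subr_gt0 -[ltRHS]sqrtr1 ltr_sqrt // ltrBlDr ltrDl.
by rewrite exprn_gt0.
Qed.

Lemma mu_le_sqr : mu <= eps ^+ 2.
Proof.
case/andP: heps => e0 e1; rewrite /mu lerBlDr -lerBlDl.
have h0 : 0 <= 1 - eps ^+ 2 by rewrite subr_ge0 expr_le1 // ltW.
rewrite -[leLHS]ger0_norm // -sqrtr_sqr ler_wsqrtr // expr2 -[leRHS]mulr1.
by rewrite ler_wpM2l // gerBl sqr_ge0.
Qed.

Lemma mu_le : mu <= eps.
Proof.
case/andP: heps => e0 e1; apply: le_trans mu_le_sqr _.
by rewrite expr2 ger_pMl // ltW.
Qed.

(** Through this the term [- 2 log2 mu] in the condition on [n] controls [L], and with it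
    [delta0]. *)
Lemma ln_mu_le : ln mu <= - (2 * L).
Proof.
have h := mu_le_sqr; rewrite -ler_expR lnK ?posrE ?mu_gt0 //; apply: le_trans h _.
by rewrite -mulrN (expRM_natl 2) expRN_L.
Qed.

Lemma ln2_gt0 : 0 < ln 2 :> R.
Proof. by have := ln2_ge_half; lra. Qed.

Lemma rate_ge : l%:R + D + 1 - 2 * log2 mu <= N * rate / 2.
Proof. by move: hn; rewrite mulrA ler_pdivrMr //; lra. Qed.

Lemma log2_mu_le : log2 mu <= - (2 * L) / ln 2.
Proof. by rewrite ler_pM2r ?invr_gt0 ?ln2_gt0 // ln_mu_le. Qed.

(** For [n = 0] the divisions by [n] all give 0 and the rate is 1/2, so positivity of the rate does
    not exclude this case; the condition on [n] does. *)
Lemma N_gt0 : 0 < N.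
Proof.
rewrite lt_neqAle ler0n andbT eq_sym; apply/eqP => N0.
have := rate_ge; rewrite N0 mul0r mul0r => h.
have : log2 mu <= 0.
  apply: (le_trans log2_mu_le); rewrite mulNr oppr_le0 divr_ge0 ?(ltW ln2_gt0) //.
  by rewrite mulr_ge0 // ltW // L_gt0.
have : 0 <= l%:R :> R by [].
by move: hD; lra.
Qed.

Lemma delta0_ge0 : 0 <= delta0. Proof. exact: sqrtr_ge0. Qed.

Lemma delta0E : delta0 ^+ 2 = 32 * L / N.
Proof. by rewrite sqr_sqrtr // divr_ge0 ?(ltW N_gt0) // mulr_ge0 // ltW // L_gt0. Qed.

Lemma delta0_sqr : N * delta0 ^+ 2 = 32 * L.
Proof. by rewrite delta0E mulrC divfK // gt_eqF // N_gt0. Qed.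

Lemma delta0_gt0 : 0 < delta0.
Proof. by rewrite sqrtr_gt0 divr_gt0 ?mulr_gt0 ?L_gt0 ?N_gt0. Qed.

Lemma alpha1E : alpha1 = delta0 / 8.
Proof.
have d0 : 0 <= delta0 / 8 by rewrite divr_ge0 // delta0_ge0.
rewrite -[RHS]ger0_norm // -sqrtr_sqr; congr Num.sqrt.
rewrite expr_div_n delta0E; field.
by rewrite gt_eqF // N_gt0.
Qed.

Lemma rate_le : rate <= 1 / 2 - 2 * delta' - delta0 / 4.
Proof.
have : 0 <= leak%:R / N by rewrite divr_ge0 // ltW // N_gt0.
by rewrite /rate /lambda alpha1E; lra.
Qed.

Lemma rate_ge_sqr : delta0 ^+ 2 / (4 * ln 2) <= rate.
Proof.
have h2 := ln2_gt0; have hN := N_gt0; have h := rate_ge; have hl := log2_mu_le.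
have l0 : 0 <= l%:R :> R by [].
have : 8 * (L / ln 2) <= N * rate.
  have : - (2 * L) / ln 2 = - 2 * (L / ln 2) by ring.
  by move: hD; lra.
have -> : 8 * (L / ln 2) = N * (delta0 ^+ 2 / (4 * ln 2)).
  by rewrite [RHS]mulrA delta0_sqr; field; rewrite gt_eqF.
by rewrite ler_pM2l.
Qed.

(* For delta0 >= 1 the size of n demanded by the hypothesis on l contradicts the
   positivity of the rate; between 1/4 and 1 the rate itself is negative. *)
Lemma delta0_le : delta0 <= 1 / 4.
Proof.
rewrite leNgt; apply/negP => d4.
have h2 := ln2_gt0; have hr := rate_le.
have [d1|d1] := leP 1 delta0.
  have hs := rate_ge_sqr.
  have d0 := delta0_gt0.
  have e8 : ln 8 = 3 * ln 2 :> R.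
    have -> : 8 = 2 ^+ 3 :> R by rewrite -natrX.
    by rewrite lnXn // mulr_natl.
  (* The tangent of the logarithm at 8: with this point the quadratic terms of the two bounds on the
     rate cancel exactly. *)
  have hlog : ln delta0 <= 3 * ln 2 + (delta0 / 8 - 1).
    have -> : delta0 = 8 * (delta0 / 8) by field.
    rewrite lnM ?posrE ?divr_gt0 // e8 lerD2l.
    have := @le_ln1Dx R (delta0 / 8 - 1); rewrite (_ : 1 + (delta0 / 8 - 1) = delta0 / 8); last by ring.
    rewrite (_ : 8 * (delta0 / 8) = delta0); last by field.
    by apply; rewrite ltrBrDl subrr divr_gt0.
  have l2d : log2 delta0 <= 3 + (delta0 / 8 - 1) / ln 2.
    by rewrite /log2 ler_pdivrMr // mulrDl divfK ?gt_eqF.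
  have hd' : delta' >= (- 1 - (delta0 / 8 - 1) / ln 2) * delta0.
    by rewrite /delta' ler_pM2r //; lra.
  have hv : 5 / 4 <= (ln 2)^-1 :> R.
    by have := ln2_le_45; rewrite -lef_pV2 ?posrE //; lra.
  have : delta0 ^+ 2 / (4 * ln 2) = delta0 ^+ 2 / ln 2 / 4.
    by field; rewrite gt_eqF.
  have e : (- 1 - (delta0 / 8 - 1) / ln 2) * delta0 =
     - delta0 - delta0 ^+ 2 / ln 2 / 8 + delta0 / ln 2 by ring.
  rewrite e in hd'.
  have : delta0 * (5 / 4) <= delta0 / ln 2 by rewrite ler_pM2l.
  by move: hs; lra.
have hlog : log2 delta0 <= 0.
  by rewrite /log2 pmulr_lle0 ?invr_gt0 // ln_le0 // ltW.
have : 2 * delta0 <= delta' by rewrite /delta' ler_pM2r ?delta0_gt0 //; lra.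
by move: hrate; lra.
Qed.

Lemma delta'_ge : 4 * delta0 <= delta'.
Proof.
rewrite /delta' ler_pM2r ?delta0_gt0 //.
have : log2 delta0 <= - 2; last by lra.
rewrite /log2 ler_pdivrMr ?ln2_gt0 //.
rewrite -ler_expR lnK ?posrE ?delta0_gt0 // mulNr expRN -exprn2_expR -natrX.
by have := delta0_le; lra.
Qed.

Lemma delta'_gt0 : 0 < delta'.
Proof. by have := delta'_ge; have := delta0_gt0; lra. Qed.

Lemma delta'_le : delta' <= 1 / 4.
Proof. by have := rate_le; have := delta0_gt0; move: hrate; lra. Qed.

Lemma m_bounds : (1 / 2 - alpha1) * N - 1 <= m%:R <= (1 / 2 - alpha1) * N.
Proof.
have h0 : 0 <= (1 / 2 - alpha1) * N.
  by rewrite mulr_ge0 ?(ltW N_gt0) // alpha1E; have := delta0_le; lra.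
have := truncn_itv h0; rewrite -hm => /andP[h1 h2]; rewrite h1 andbT.
by move: h2; rewrite -natr1; lra.
Qed.

Lemma double_m_le_n : (2 * m <= n)%N.
Proof.
case/andP: m_bounds => _ h; rewrite -(ler_nat R) natrM -/N.
have : 0 <= alpha1 * N by rewrite mulr_ge0 ?sqrtr_ge0 // ltW // N_gt0.
by lra.
Qed.

Lemma short_tail (theta : bits n) :
  \sum_(t : bits n) (#|agree theta t| < m)%N%:R <= 2 ^+ n * eps.
Proof.
have -> : eps = expR (- (2 * alpha1 ^+ 2 * n%:R)).
  rewrite -expRN_L; congr (expR (- _)); rewrite -/N alpha1E expr_div_n.
  by have := delta0_sqr; lra.
apply: agree_tail => [|k km]; first exact: sqrtr_ge0.
case/andP: m_bounds => _ h; rewrite -/N.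
have : k%:R <= m%:R :> R by rewrite ler_nat ltnW.
by lra.
Qed.

Lemma secrecy_exponent :
  l%:R + 1 - N * rate / 2 <= 2 * (ln mu / ln 2) - D.
Proof. by have := rate_ge; rewrite /log2; lra. Qed.

(** Maximises [2 s delta' ln 2 - s^2], the exponent per qubit left by the uncertainty relation at
    the threshold [2^(- lambda n)]. *)
Let s : R := delta' * ln 2.

Lemma s_gt0 : 0 < s.
Proof. by rewrite mulr_gt0 ?delta'_gt0 ?ln2_gt0. Qed.

Lemma sqr_s_ge : 4 * delta0 ^+ 2 <= s ^+ 2.
Proof.
have h : 2 * delta0 <= s.
  have : 4 * delta0 * 2^-1 <= s.
    by apply: ler_pM; rewrite ?delta'_ge ?ln2_ge_half ?invr_ge0 ?mulr_ge0 ?delta0_ge0.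
  by lra.
have : (2 * delta0) ^+ 2 <= s ^+ 2.
  rewrite lerXn2r // nnegrE; last exact: ltW s_gt0.
  exact: mulr_ge0 (ler0n _ 2) delta0_ge0.
by rewrite exprMn -natrX.
Qed.

Lemma unc_pow_le k : (unc s / 2) ^+ k <= expR (k%:R * (s ^+ 2 - s * ln 2 / 2)).
Proof.
have e : unc s / 2 = 1 + (s ^+ 2 - s * ln 2 / 2) by rewrite /unc; field.
rewrite expRM_natl lerXn2r ?nnegrE ?expR_ge0 //.
  by rewrite divr_ge0 ?unc_ge0 // ltW // s_gt0.
by rewrite e; exact: expR_ge1Dx.
Qed.

(** The exponents combine to [- N s^2], and [N s^2 >= 128 L]. *)
Lemma bad_alice_le : (unc s / 2) ^+ n * expR (- (lambda * N * ln 2)) `^ (- s) <= eps.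
Proof.
have h := unc_pow_le n; rewrite powR_expR.
apply: (le_trans (ler_wpM2r (expR_ge0 _) h)); rewrite -expRD -expRN_L ler_expR -/N.
have -> : N * (s ^+ 2 - s * ln 2 / 2) + - s * - (lambda * N * ln 2) = - (N * s ^+ 2).
  by rewrite /lambda /s; ring.
rewrite lerN2; have := delta0_sqr; have := L_gt0.
have : N * (4 * delta0 ^+ 2) <= N * s ^+ 2 by rewrite ler_wpM2l ?sqr_s_ge // ltW // N_gt0.
by lra.
Qed.

(** Rounding [m] down adds at most [s ln 2 / 2], bounded by 1/8. As [L] may be arbitrarily small,
    this is paid for by the factor 2 in front of [eps]. *)
Lemma bad_string_le : expR (- (N * rate / 2 * ln 2)) `^ (- s) * (unc s / 2) ^+ m <= 2 * eps.
Proof.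
have h := unc_pow_le m; rewrite powR_expR.
apply: (le_trans (ler_wpM2l (expR_ge0 _) h)); rewrite -expRD.
have -> : 2 * eps = expR (ln 2 - L) by rewrite expRD expRN_L lnK // posrE.
rewrite ler_expR.
have [h1 h2] := andP m_bounds; have hN := N_gt0.
have s0 := s_gt0; have l2 := ln2_gt0; have hr := rate_le.
have hm2 : m%:R * s ^+ 2 <= N / 2 * s ^+ 2.
  rewrite ler_wpM2r ?sqr_ge0 //; apply: (le_trans h2).
  have : 0 <= alpha1 * N by rewrite mulr_ge0 ?sqrtr_ge0 // ltW.
  by lra.
have hm1 : ((1 / 2 - alpha1) * N - 1) * (s * ln 2 / 2) <= m%:R * (s * ln 2 / 2).
  by rewrite ler_wpM2r // divr_ge0 // mulr_ge0 // ltW.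
have hk : N * rate / 2 * ln 2 * s <= N * (1 / 2 - 2 * delta' - 2 * alpha1) / 2 * ln 2 * s.
  do 3 (rewrite ler_wpM2r; [|by rewrite ?invr_ge0 // ltW|]) => //.
  by rewrite ler_wpM2l ?(ltW hN) // alpha1E; lra.
have ha : 0 <= N * alpha1 * (s * ln 2).
  exact: mulr_ge0 (mulr_ge0 (ltW hN) (sqrtr_ge0 _)) (mulr_ge0 (ltW s0) (ltW l2)).
have e2 : N * delta' * (s * ln 2) = N * s ^+ 2 by rewrite /s; ring.
have hs : s * ln 2 / 2 <= 1 / 8.
  have : s * ln 2 <= 1 / 4 * 1 * 1; last by lra.
  rewrite ler_pM ?(ltW s0) ?(ltW l2) ?ln2_le1 //.
  by rewrite ler_pM ?(ltW delta'_gt0) ?(ltW l2) ?ln2_le1 ?delta'_le.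
have hd : N * (4 * delta0 ^+ 2) <= N * s ^+ 2 by rewrite ler_wpM2l ?sqr_s_ge // ltW.
have := delta0_sqr; have := L_gt0; have := ln2_ge_half.
have -> : - s * - (N * rate / 2 * ln 2) + m%:R * (s ^+ 2 - s * ln 2 / 2) =
  N * rate / 2 * ln 2 * s + m%:R * s ^+ 2 - m%:R * (s * ln 2 / 2) by ring.
lra.
Qed.

Lemma hash_error_le : 2 ^+ l * 2 * expR (- (N * rate / 2 * ln 2)) <= mu ^+ 2.
Proof.
have l2 := ln2_gt0.
have -> : 2 ^+ l * 2 * expR (- (N * rate / 2 * ln 2)) = expR ((l%:R + 1 - N * rate / 2) * ln 2).
  by rewrite -exprSr exprn2_expR -expRD -natr1; congr expR; ring.
rewrite -(lnK (x := mu)) ?posrE ?mu_gt0 // -expRM_natl ler_expR.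
have : 0 <= D * ln 2 by rewrite mulr_ge0 // ltW.
have : (2 * (ln mu / ln 2) - D) * ln 2 = 2 * ln mu - D * ln 2 by field; rewrite gt_eqF.
have : (l%:R + 1 - N * rate / 2) * ln 2 <= (2 * (ln mu / ln 2) - D) * ln 2.
  by rewrite ler_wpM2r ?secrecy_exponent // ltW.
by lra.
Qed.

(** The heaviness threshold for which the condition relating [beta] and [tau] is an equality. *)
Let tau : R := expR ((leak%:R + (n - 2 * m)%N%:R - lambda * N) / 2 * ln 2).

Lemma tau_sqr : 2 ^+ leak * (2 ^+ (n - 2 * m) * expR (- (lambda * N * ln 2))) = tau ^+ 2.
Proof. by rewrite -expRM_natl !exprn2_expR -!expRD; congr expR; field. Qed.

Lemma memory_error_le (d : nat) : log2 d%:R <= D -> d%:R * (2 ^+ l * tau) <= mu ^+ 2.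
Proof.
move=> hd; have l2 := ln2_gt0.
have [->|d0] := posnP d; first by rewrite mul0r sqr_ge0.
have dD : d%:R <= expR (D * ln 2).
  rewrite -(lnK (x := d%:R)) ?posrE ?ltr0n // ler_expR.
  by move: hd; rewrite /log2 ler_pdivrMr.
apply: (@le_trans _ _ (expR (D * ln 2) * (2 ^+ l * tau))).
  by rewrite ler_wpM2r // mulr_ge0 ?exprn_ge0 ?expR_ge0.
rewrite exprn2_expR -!expRD -(lnK (x := mu)) ?posrE ?mu_gt0 // -expRM_natl ler_expR.
(* Rounding [m] down may leave two further positions free; after halving they cost one bit, the
   [+ 1] in the condition on [n]. *)
have hnm : (n - 2 * m)%N%:R <= 2 * alpha1 * N + 2.
  rewrite natrB ?double_m_le_n // natrM -/N; case/andP: m_bounds; lra.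
have e : N * rate = lambda * N - leak%:R - 2 * alpha1 * N.
  by rewrite /rate; field; rewrite gt_eqF // N_gt0.
have h : (D + (l%:R + (leak%:R + (n - 2 * m)%N%:R - lambda * N) / 2)) * ln 2 <=
   (2 * (ln mu / ln 2)) * ln 2.
  rewrite ler_pM2r //; have := secrecy_exponent; rewrite e; lra.
move: h; rewrite -mulrA divfK ?gt_eqF //; lra.
Qed.

(** With [t] equal to [(2 mu)^-1] the hashing terms amount to at most [5 mu / 2], on top of [eps]
    for the strings that are too likely. *)
Lemma alice_error_le (d : nat) : log2 d%:R <= D ->
  (unc s / 2) ^+ n * expR (- (lambda * N * ln 2)) `^ (- s) +
  ((2 * mu)^-1 * (d%:R * (4 * (2 ^+ l * tau) ^+ 2 + 2 * (2 ^+ l * tau))) + (2 * mu)^-1^-1) / 2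
  <= 8 * eps.
Proof.
move=> hd; have m0 := mu_gt0; have hmem := memory_error_le hd.
set x := 2 ^+ l * tau in hmem *.
have x0 : 0 <= x by rewrite mulr_ge0 ?exprn_ge0 ?expR_ge0.
have dx : d%:R * x ^+ 2 <= mu ^+ 2 * mu ^+ 2.
  have [->|d1] := posnP d; first by rewrite mul0r mulr_ge0 ?sqr_ge0.
  apply: (@le_trans _ _ ((d%:R * x) * (d%:R * x))); last by apply: ler_pM => //; exact: mulr_ge0.
  have -> : (d%:R * x) * (d%:R * x) = d%:R * (d%:R * x ^+ 2) by ring.
  by rewrite ler_wpM2l // ler_peMl ?sqr_ge0 // ler1n.
have mu1 : mu <= 1 by have := mu_le; case/andP: heps; lra.
have mu2 : mu ^+ 2 * mu ^+ 2 <= mu ^+ 2.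
  by rewrite ger_pMl ?exprn_gt0 // expr_le1 // ltW.
have hA : d%:R * (4 * x ^+ 2 + 2 * x) <= 6 * mu ^+ 2.
  have -> : d%:R * (4 * x ^+ 2 + 2 * x) = 4 * (d%:R * x ^+ 2) + 2 * (d%:R * x) by ring.
  by lra.
have : (2 * mu)^-1 * (d%:R * (4 * x ^+ 2 + 2 * x)) <= (2 * mu)^-1 * (6 * mu ^+ 2).
  by rewrite ler_wpM2l // invr_ge0 mulr_ge0 // ltW.
have -> : (2 * mu)^-1 * (6 * mu ^+ 2) = 3 * mu by field; rewrite gt_eqF.
have := bad_alice_le; have := mu_le; rewrite invrK; case/andP: heps.
lra.
Qed.

(** Three times [eps] for too few agreements, decoding aborts and decoding failures; four times for
    strings of too large probability; and [mu <= eps] for hashing. *)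
Lemma correct_error_le :
  3 * eps + 2 * (2 * eps) +
  (mu^-1 * 2 ^+ l * 2 * expR (- (N * rate / 2 * ln 2)) + mu^-1^-1) / 2 <= 8 * eps.
Proof.
have m0 := mu_gt0; have h := hash_error_le.
have : mu^-1 * (2 ^+ l * 2 * expR (- (N * rate / 2 * ln 2))) <= mu^-1 * mu ^+ 2.
  by rewrite ler_wpM2l // invr_ge0 ltW.
have -> : mu^-1 * mu ^+ 2 = mu by field; rewrite gt_eqF.
rewrite !mulrA invrK; have := mu_le.
lra.
Qed.

End Numerics.

Theorem theorem6 (R : realType) (n m l leak : nat) (eps D : R)
    (dev : honest_device R) (h : hash_family m l) (ec : ec_scheme R n m leak) :
  let alpha1 : R := Num.sqrt (ln eps^-1 / (2 * n%:R)) in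
  let delta0 : R := Num.sqrt (32 * ln eps^-1 / n%:R) in
  let delta' : R := (2 - log2 delta0) * delta0 in
  let lambda : R := 1 / 2 - 2 * delta' in
  let rate : R := lambda - leak%:R / n%:R - 2 * alpha1 in
  0 < eps < 1 ->
  0 <= D ->
  m = Num.truncn ((1 / 2 - alpha1) * n%:R) ->
  ec_reliable dev ec eps ->
  0 < rate ->
  2 * ((l%:R + D + 1 - 2 * log2 (1 - Num.sqrt (1 - eps ^+ 2))) / rate) <= n%:R ->
  implements_rand_ot dev h ec D (8 * eps).
Proof.
move=> alpha1 delta0 delta' lambda rate heps hD hm rel hrate hn.
have mn := double_m_le_n heps hD hm hrate hn.
have tail := short_tail heps hD hm hrate hn.
have m0 := mu_gt0 heps.
have s0 := s_gt0 heps hD hrate hn.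
split=> [|A|B hB].
- apply: (honest_correct h _ _ mn tail rel _ (correct_error_le heps hD hrate hn)).
  + by rewrite invr_gt0.
  + exact: expR_gt0.
  apply: le_trans (bad_string_le heps hD hm hrate hn).
  exact: (string_tail m (@site_left _ dev) (@site_right _ dev) (@round_lawR_total _ dev) s0 (expR_gt0 _)).
- apply: (secure_for_bob ec A mn) => theta; apply: (le_trans (tail theta)).
  rewrite ler_wpM2l ?exprn_ge0 //; case/andP: heps; lra.
apply: (secure_for_alice h ec s0 _ _ _ _ (alice_error_le heps hD hm hrate hn hB)).
- exact: expR_gt0.
- exact: expR_gt0.
- by rewrite invr_gt0 mulr_gt0.
by rewrite tau_sqr.
Qed.
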